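(* Let $0<T<\infty$, let $k\ge 1$ be an integer, and let $u_0\in C^2(I)$ with $u_0(0)=u_0(1)=0$ and $|u_0|<\pi$ on $I$. Let $u=u(t,r)$, with $u(t)=u(t,\cdot)$, be the solution on $[0,T]\times I$ of $$\partial_t u=\partial_{rr}u+\frac1r\partial_r u-\frac{\sin(2u)}{2r^2}\ \ (r\in I,\ t\in(0,T]),\qquad u(0,r)=u_0(r),\qquad u(t,0)=u(t,1)=0\ \ (t\in[0,T]),$$ and assume that it satisfies $$\max_{t\in[0,T]}\Big\{\|u(t)\|_{W^{k+1}_\infty(I)}+\|\partial_t u(t)\|_{H^1(I)}+\|\partial_{tt}u(t)\|_{L^2(I)}\Big\}<\infty .$$ Assume further that $u_0\in H^{k+1}(I)$ and $u_0\in\mathcal E_1$. For $h=1/N$ and $\tau=T/J$ with $N,J\in\mathbb N$, take $u_h^0\in S^k_{h,0}\cap\mathcal E_1$, let $(u_h^j)_{1\le j\le J}$ be the solution of the discrete problem with initial value $u_h^0$ (as defined in the context), and let $e_h^j:=u_h^j-u(t_j)$, $t_j:=j\tau$. Then: (i) There exist constants $C,c>0$, independent of $h$, $\tau$ (and of $j$ and $u_h^0$), but depending on $T$ and on the regularity assumption $\max_{t\in[0,T]}\big\{\|u(t)\|_{W^{k+1}_\infty(I)}+\|\partial_t u(t)\|_{H^1(I)}+\|\partial_{tt}u(t)\|_{L^2(I)}\big\}<\infty$ on $u$, such that for all $1\le j\le J$ $$\|\partial_r e_h^j\|_{0,r}\le C(\tau+h^k)+c\,\|u_0-u_h^0\|_{H^1_r}.$$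 (ii) Assume in addition that $\|u_0-u_h^0\|_{H^1_r}\le c_0h^k$ with a constant $c_0$ independent of $h$ and $\tau$. Then there is a constant $C>0$ independent of $h$ and $\tau$ such that for all sufficiently small $h$ and $\tau$ and all $1\le j\le J$ $$\|e_h^j\|_{H^1_r}\le C(\tau+h^k).$$
   Context: $I=[0,1]$. For functions on $I$: $(v,w)_{0,r}=\int_0^1 v(r)w(r)\,r\,dr$, $(v,w)_{H^1_r}=(\partial_r v,\partial_r w)_{0,r}+\left(\frac vr,\frac wr\right)_{0,r}$, with corresponding norms $\|\cdot\|_{0,r}$, $\|\cdot\|_{H^1_r}$. $H^1_{r,0}=\{v:I\to\mathbb R:\ \|v\|_{0,r}<\infty,\ \|v\|_{H^1_r}<\infty,\ v(0)=v(1)=0\}$. The energy is $\mathcal E(v)=\frac12\int_0^1\left((\partial_r v)^2+\frac{\sin^2 v}{r^2}\right)r\,dr$, and $\mathcal E_b=\{v\in H^1_{r,0}:\ \mathcal E(v)\le 2b\}$ for $b>0$; thus $\mathcal E_1=\{v\in H^1_{r,0}:\mathcal E(v)\le2\}$. Further $f(v)=v-\frac12\sin(2v)$. Finite element space: for $h=1/N$ and grid points $r_i=ih$, $i=0,\dots,N$, let $S^k_{h,0}$ be the space of continuous functions $v$ on $I$ with $v(0)=v(1)=0$ whose restriction to each $[r_i,r_{i+1}]$ is a polynomial of degree at most $k$. Discrete problem: given $u_h^0\in S^k_{h,0}$ and $\tau=T/J$, for $j=0,\dots,J-1$ the function $u_h^{j+1}\in S^k_{h,0}$ is the unique solution of $$\left(\frac{u_h^{j+1}-u_h^j}{\tau},v_h\right)_{0,r}+(u_h^{j+1},v_h)_{H^1_r}=\left(\frac{f(u_h^j)}{r^2},v_h\right)_{0,r}\quad\text{for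 all }v_h\in S^k_{h,0}.$$ *)

(* Defs.v *)
From HB Require Import structures.
From mathcomp Require Import all_boot all_order all_algebra.
From mathcomp Require Import all_classical all_reals all_analysis.

Set Implicit Arguments.
Unset Strict Implicit.
Unset Printing Implicit Defensive.

Import Order.TTheory GRing.Theory Num.Theory.
Import numFieldNormedType.Exports.

Local Open Scope classical_set_scope.
Local Open Scope ring_scope.

Section Definitions.
Context {R : realType}.
Implicit Types (v w g phi : R -> R) (n m k : nat).

Local Notation mu := (@lebesgue_measure R).

(* Functions on I = [0,1] are represented by total functions R -> R; none of
   the notions below depends on the values taken outside of I. *)
Definition unit_interval : set R := `[0, 1].
Local Notation I := unit_interval.

(* One-sided at the end points when A is a closed interval. *)
Definition has_deriv_within (A : set R) (f : R -> R) (x d : R) : Prop :=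
  (fun y => (f y - f x) / (y - x)) @ within A x^' --> d.

Fixpoint Cn_within (A : set R) n (f : R -> R) : Prop :=
  match n with
  | 0 => {within A, continuous f}
  | n'.+1 => exists2 g, (forall x, A x -> has_deriv_within A f x (g x))
                      & Cn_within A n' g
  end.

Definition test_function phi : Prop :=
  (forall n x, derivable (derive1n n phi) x 1) /\
  (exists a b, [/\ 0 < a, b < 1 & forall x, x \notin `[a, b] -> phi x = 0]).

Definition weak_deriv n v g : Prop :=
  [/\ locally_integrable `]0, 1[ v, locally_integrable `]0, 1[ g &
      forall phi, test_function phi ->
        \int[mu]_(r in `]0, 1[) (v r * derive1n n phi r) =
        (-1) ^+ n * \int[mu]_(r in `]0, 1[) (g r * phi r)].

Definition weakly_derivable n v : Prop := exists g, weak_deriv n v g.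

(* A chosen representative of the n-th weak derivative, which is unique up to
   a.e. equality on ]0,1[; it is meaningful only if weakly_derivable n v. *)
Definition wD n v : R -> R := get [set g | weak_deriv n v g].

Definition normL (p : \bar R) v : \bar R := ('N[mu]_p [EFin \o (v \_ I)])%E.

Definition memL (p : \bar R) v : Prop := v \_ I \in Lfun mu p.

Definition sobolev m (p : \bar R) v : Prop :=
  forall i, (i <= m)%N -> weakly_derivable i v /\ memL p (wD i v).

Definition normWoo m v : \bar R := (\sum_(i < m.+1) normL +oo (wD i v))%E.

Definition normH m v : \bar R :=
  sqrte (\sum_(i < m.+1) normL 2 (wD i v) ^+ 2)%E.

Definition ip0r v w : R := \int[mu]_(r in I) (v r * w r * r).

Definition ipH1r v w : R :=
  ip0r (wD 1 v) (wD 1 w) + ip0r (fun r => v r / r) (fun r => w r / r).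

(* The norms are extended-real valued, so that their finiteness is meaningful. *)
Definition sqnorm0r v : \bar R := (\int[mu]_(r in I) (v r ^+ 2 * r)%:E)%E.

Definition norm0r v : \bar R := sqrte (sqnorm0r v).

Definition normH1r v : \bar R :=
  sqrte (sqnorm0r (wD 1 v) + sqnorm0r (fun r => v r / r)%R)%E.

(* An element of H^1_r has a unique representative that is continuous on I;
   the end point conditions refer to it. *)
Definition H1r0 v : Prop :=
  [/\ {within I, continuous v}, weakly_derivable 1 v,
      (norm0r v < +oo)%E, (normH1r v < +oo)%E & v 0 = 0 /\ v 1 = 0].

Definition energy v : \bar R :=
  ((2^-1)%:E *
   \int[mu]_(r in I) ((wD 1 v r ^+ 2 + sin (v r) ^+ 2 / r ^+ 2) * r)%:E)%E.

Definition energy_set (b : R) v : Prop :=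
  H1r0 v /\ (energy v <= (2 * b)%:E)%E.

Definition nonlin (x : R) : R := x - 2^-1 * sin (2 * x).

(* S^k_{h,0} for the mesh size h = 1/N. *)
Definition fe_space k N v : Prop :=
  [/\ {within I, continuous v}, v 0 = 0, v 1 = 0 &
      forall i : nat, (i < N)%N ->
        exists2 p : {poly R}, (size p <= k.+1)%N &
          forall r, i%:R / N%:R <= r <= i.+1%:R / N%:R -> v r = p.[r]].

Definition discrete_step k N (tau : R) (U V : R -> R) : Prop :=
  fe_space k N V /\
  forall w, fe_space k N w ->
    ip0r (fun r => (V r - U r) / tau) w + ipH1r V w =
    ip0r (fun r => nonlin (U r) / r ^+ 2) w.

(* uh 0, ..., uh J is the discrete solution with initial value uh 0. *)
Definition discrete_solution k N J (tau : R) (uh : nat -> R -> R) : Prop :=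
  fe_space k N (uh 0%N) /\
  forall j, (j < J)%N -> discrete_step k N tau (uh j) (uh j.+1).

(* u t r is the solution and ut t r its time derivative. *)
Record pde_solution (T : R) (u0 : R -> R) (u ut : R -> R -> R) : Prop := {
  sol_continuous :
    {within `[0, T] `*` I, continuous (fun z : R * R => u z.1 z.2)};
  sol_dt : forall t r : R, t \in `[0, T] -> I r ->
    has_deriv_within `[0, T] (fun s => u s r) t (ut t r);
  sol_dr : forall t r : R, t \in `]0, T] -> r \in `]0, 1[ ->
    derivable (u t) r 1 /\ derivable (derive1 (u t)) r 1;
  sol_pde : forall t r : R, t \in `]0, T] -> r \in `]0, 1[ ->
    ut t r = derive1n 2 (u t) r + r^-1 * derive1 (u t) r
             - sin (2 * u t r) / (2 * r ^+ 2);
  sol_init : forall r, I r -> u 0 r = u0 r;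
  sol_bc : forall t : R, t \in `[0, T] -> u t 0 = 0 /\ u t 1 = 0 }.

(* The L^2(I)-valued function w has the derivative g at t, within A. *)
Definition has_L2deriv_within (A : set R) (w : R -> R -> R) (t : R) g : Prop :=
  (fun s => normL 2 (fun r => (w s r - w t r) / (s - t) - g r)%R)
    @ within A t^' --> 0%E.

(* max_t (|u(t)|_{W^{k+1}_oo} + |u_t(t)|_{H^1} + |u_tt(t)|_{L^2}) <= M, where
   u_tt(t), an element of L^2(I), is the derivative of u_t in L^2(I). *)
Record regularity_bound (T : R) k (M : R) (u ut utt : R -> R -> R) : Prop := {
  reg_u : forall t : R, t \in `[0, T] -> sobolev k.+1 +oo (u t);
  reg_ut : forall t : R, t \in `[0, T] -> sobolev 1 2 (ut t);
  reg_utt : forall t : R, t \in `[0, T] ->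
    memL 2 (utt t) /\ has_L2deriv_within `[0, T] ut t (utt t);
  reg_bound : forall t : R, t \in `[0, T] ->
    (normWoo k.+1 (u t) + normH 1 (ut t) + normL 2 (utt t) <= M%:E)%E }.

End Definitions.

(* Main.v *)
(* Let w be the discrete parabolic projection of u: it starts from the Ritz projection of u(0) and solves
   the implicit Euler scheme driven by the increments of u.  Its error eps = w - u is O(h^k) in H^1_r: the
   Ritz error is O(h^(k+1)) when tested with finite element functions (Aubin-Nitsche, with an explicit
   dual solution), and the difference between w and the Ritz projection is estimated by smoothing
   properties of the implicit Euler scheme and an inverse inequality.  Also |eps| <= C r pointwise.

   The remainder z = u_h - w satisfies the scheme with right-hand side f(u_h) - f(u) = f(z) + A, where
   |A| <= C (r |sin z| + r^2 |eps| + r^2 tau).  The monotone part f(z) is kept: testing with the increment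
   of z and using that f is the derivative of the convex function (x^2 - sin^2 x) / 2 yields
   E(z_(j+1)) <= (1 + C tau) E(z_j) + C tau (tau + h^k)^2 for the energy E, and Gronwall's lemma gives (i).
   If E(z) <= 1/2, then cos z >= 1/2 and E(z) controls z / r as well, which gives (ii). *)

Require Import Defs.
From mathcomp Require Import all_boot all_order all_algebra.
From mathcomp Require Import all_classical all_reals all_analysis.
From mathcomp Require Import measurable_realfun ess_sup_inf ring lra.

Set Implicit Arguments.
Unset Strict Implicit.
Unset Printing Implicit Defensive.

Import Order.TTheory GRing.Theory Num.Theory.
Import numFieldNormedType.Exports.

Local Open Scope classical_set_scope.
Local Open Scope ring_scope.

(** * Lipschitz functions and their primitives on [0,1] *)

Section BoundedMeasurable.
Context {R : realType}.
Implicit Types (f g v w : R -> R) (a b c x y K : R).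
Local Notation mu := (@lebesgue_measure R).
Local Notation I := (@unit_interval R).

(** The assumed regularity gives no spatial rate for the time derivative of the Ritz error, so a
    splitting through the Ritz projection at each time level is not enough; a projection that solves
    the scheme itself sees this error only through increments. Its estimate loses a factor [N] in
    the inverse inequality, and the additional power of [h] gained by duality pays for exactly this
    loss. As [E] sees the remainder only through its derivative and [sin z], no bound on [z] itself
    may enter the estimate of [A], and (i) is confined to the derivative; the bounds of [u] and
    [eps] by multiples of [r] supply the powers of [r] that compensate the division by [r^2]. The
    functions to be estimated are Lipschitz on [0,1] and are handled as primitives of bounded
    functions; almost everywhere statements serve mainly to pass from weak derivatives to such
    representatives. All constants of (i) are built from [T], [k] and [M] alone, hence can precede
    [u] in the quantifiers. *)

Definition integ a b f : R := \int[mu]_(x in `[a, b]) f x.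

(** Boundedness holds at every point of [0,1], not only almost everywhere, so the class is closed
    under products and pointwise estimates need no exceptional sets. *)
Definition bmeas f := measurable_fun I f /\ exists K, forall x, 0 <= x <= 1 -> `|f x| <= K.

Lemma unit_intervalE x : I x = (0 <= x <= 1) :> Prop.
Proof. by rewrite /unit_interval /= in_itv. Qed.

Lemma itvsub a b : 0 <= a -> b <= 1 -> `[a, b] `<=` I.
Proof.
by move=> a0 b1 x /=; rewrite unit_intervalE in_itv/= => /andP[? ?]; apply/andP; split; lra.
Qed.

Lemma bmeas_integrable a b f : 0 <= a -> b <= 1 -> bmeas f ->
  mu.-integrable `[a, b] (EFin \o f).
Proof.
move=> a0 b1 [mf [K fK]].
apply: measurable_bounded_integrable => //.
- by rewrite /= lebesgue_measure_itv/=; case: ifP; rewrite ltry.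
- by apply: measurable_funS mf; [exact: measurable_itv|exact: itvsub].
- exists K; split; first by rewrite num_real.
  move=> M KM x /= xab; apply: (le_trans _ (ltW KM)); apply: fK.
  by rewrite -unit_intervalE; exact: (itvsub a0 b1).
Qed.

Lemma bmeasD f g : bmeas f -> bmeas g -> bmeas (fun x => f x + g x).
Proof.
move=> [mf [K fK]] [mg [L gL]]; split; first exact: measurable_funD.
exists (K + L) => x x01; apply: (le_trans (ler_normD _ _)).
by apply: lerD; [exact: fK|exact: gL].
Qed.

Lemma bmeasM f g : bmeas f -> bmeas g -> bmeas (fun x => f x * g x).
Proof.
move=> [mf [K fK]] [mg [L gL]]; split; first exact: measurable_funM.
exists (K * L) => x x01; rewrite normrM.
by apply: ler_pM => //; [exact: fK|exact: gL].
Qed.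

Lemma bmeas_cst c : bmeas (fun=> c).
Proof. by split; [exact: measurable_cst|exists `|c|]. Qed.

Lemma bmeas_id : bmeas (fun x => x).
Proof.
split; first exact: measurable_id.
by exists 1 => x /andP[x0 x1]; rewrite ger0_norm.
Qed.

Lemma bmeasZ c f : bmeas f -> bmeas (fun x => c * f x).
Proof. by move=> bf; apply: bmeasM => //; exact: bmeas_cst. Qed.

Lemma bmeasN f : bmeas f -> bmeas (fun x => - f x).
Proof.
move=> bf; have := bmeasZ (-1) bf.
by congr bmeas; apply/funext => x; rewrite mulN1r.
Qed.

Lemma bmeasB f g : bmeas f -> bmeas g -> bmeas (fun x => f x - g x).
Proof. by move=> bf bg; apply: bmeasD => //; exact: bmeasN. Qed.

Lemma bmeasX n f : bmeas f -> bmeas (fun x => f x ^+ n).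
Proof.
elim: n => [|n ih] bf; first by under eq_fun do rewrite expr0; exact: bmeas_cst.
under eq_fun do rewrite exprS.
by apply: bmeasM => //; exact: ih.
Qed.

Lemma bmeas_norm f : bmeas f -> bmeas (fun x => `|f x|).
Proof.
move=> [mf [K fK]]; split; first exact: measurableT_comp.
by exists K => x x01; rewrite normr_id; exact: fK.
Qed.

Lemma bmeas_bounded_comp (h : R -> R) f L : continuous h -> (forall x, `|h x| <= L) ->
  measurable_fun I f -> bmeas (fun x => h (f x)).
Proof.
move=> ch hL mf; split.
  by apply: (measurableT_comp _ mf); exact: continuous_measurable_fun.
by exists L => x _.
Qed.

Lemma bmeas_sin f : bmeas f -> bmeas (fun x => sin (f x)).
Proof.
case=> mf _; apply: (@bmeas_bounded_comp _ _ 1) mf; first exact: continuous_sin.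
by move=> x; rewrite ler_norml sin_geN1 sin_le1.
Qed.

Lemma continuous_oo_measurable a b f : {in `]a, b[, continuous f} ->
  measurable_fun `[a, b] f.
Proof.
move=> cf; apply: (@measurable_fun_itv_cc _ _ _ false true).
apply: open_continuous_measurable_fun; first exact: itv_open.
by move=> x; rewrite inE; exact: cf.
Qed.

Lemma measurable_inv_I : measurable_fun I (fun x => x^-1).
Proof.
apply: continuous_oo_measurable => x /=; rewrite in_itv/= => /andP[x0 _].
by apply: inv_continuous; rewrite gt_eqF.
Qed.

(** A linear zero at the origin cancels the singularity; at [x = 0] itself the convention [0^-1 = 0]
    gives the value 0, so that quotients by [r] can be formed on the closed interval. *)
Lemma bmeas_div f K : measurable_fun I f -> (forall x, 0 <= x <= 1 -> `|f x| <= K * x) ->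
  bmeas (fun x => f x / x).
Proof.
move=> mf fK; split.
  by apply: measurable_funM => //; exact: measurable_inv_I.
exists `|K| => x x01; have [->|x0] := eqVneq x 0.
  by rewrite invr0 mulr0 normr0.
have xp : 0 < x by rewrite lt_neqAle eq_sym x0; case/andP: x01.
rewrite normrM normfV (gtr0_norm xp) ler_pdivrMr//.
by apply: (le_trans (fK _ x01)); rewrite ler_pM2r// ler_norm.
Qed.

Lemma eq_integ a b f g : (forall x, a <= x <= b -> f x = g x) -> integ a b f = integ a b g.
Proof. by move=> fg; apply: eq_Rintegral => x; rewrite inE/= in_itv/=; exact: fg. Qed.

Section fixed_bounds.
Variables (a b : R).
Hypotheses (a0 : 0 <= a) (b1 : b <= 1).

Lemma integD f g : bmeas f -> bmeas g ->
  integ a b (fun x => f x + g x) = integ a b f + integ a b g.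
Proof. by move=> bf bg; apply: RintegralD => //; exact: bmeas_integrable. Qed.

Lemma integB f g : bmeas f -> bmeas g ->
  integ a b (fun x => f x - g x) = integ a b f - integ a b g.
Proof. by move=> bf bg; apply: RintegralB => //; exact: bmeas_integrable. Qed.

Lemma integZ c f : bmeas f -> integ a b (fun x => c * f x) = c * integ a b f.
Proof. by move=> bf; apply: RintegralZl => //; exact: bmeas_integrable. Qed.

Lemma integ_le f g : bmeas f -> bmeas g -> (forall x, a <= x <= b -> f x <= g x) ->
  integ a b f <= integ a b g.
Proof.
move=> bf bg fg; apply: le_Rintegral => //.
- exact: bmeas_integrable.
- exact: bmeas_integrable.
Qed.

Lemma integ_ge0 f : (forall x, a <= x <= b -> 0 <= f x) -> 0 <= integ a b f.
Proof. by move=> f0; apply: Rintegral_ge0 => x /=; rewrite in_itv; exact: f0. Qed.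

Lemma integ_cst c : a <= b -> integ a b (fun=> c) = c * (b - a).
Proof.
move=> ab; rewrite /integ Rintegral_cst//.
rewrite [fine _]/= lebesgue_measure_itv/= lte_fin.
by move: ab; rewrite le_eqVlt => /orP[/eqP->|->]; rewrite ?ltxx ?subrr.
Qed.

Lemma integ_norm f K : a <= b -> bmeas f -> (forall x, a <= x <= b -> `|f x| <= K) ->
  `|integ a b f| <= K * (b - a).
Proof.
move=> ab bf fK; apply: (le_trans (le_normr_Rintegral _ _)) => //.
  exact: bmeas_integrable.
rewrite -integ_cst//; apply: integ_le => //; first exact: bmeas_norm.
exact: bmeas_cst.
Qed.

Lemma integ_cat c f : bmeas f -> a <= c <= b -> integ a b f = integ a c f + integ c b f.
Proof.
move=> bf /andP[ac cb].
have := @Rintegral_itvB R f (BLeft a) (BRight b) c.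
rewrite !bnd_simp => /(_ (bmeas_integrable a0 b1 bf)) => /(_ ac cb) e.
rewrite /integ; apply/eqP; rewrite addrC -subr_eq; apply/eqP.
rewrite e; apply: Rintegral_itv_obnd_cbnd.
have : mu.-integrable `[c, b] (EFin \o f) by apply: bmeas_integrable => //; exact: le_trans ac.
by apply: integrableS => //; exact: subset_itv_oc_cc.
Qed.

End fixed_bounds.

Lemma integ_pt a f : integ a a f = 0.
Proof. by rewrite /integ set_itv1 Rintegral_set1. Qed.

End BoundedMeasurable.

(** * Lipschitz functions as primitives of bounded functions *)

Section Antiderivatives.
Context {R : realType}.
Implicit Types (f g v w : R -> R) (a b c x y K : R).
Local Notation I := (@unit_interval R).

(* [v] is Lipschitz on [0,1]: a bounded [g] is a chosen representative of its derivative. *)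
Definition antider v g :=
  bmeas g /\ forall a b, 0 <= a -> a <= b -> b <= 1 -> v b - v a = integ a b g.

Lemma arch_le0 (x C : R) : (forall n : nat, (0 < n)%N -> n%:R * x <= C) -> x <= 0.
Proof.
move=> H; rewrite leNgt; apply/negP => x0.
have C0 : 0 <= C by apply: le_trans (H 1%N isT); rewrite mul1r ltW.
have := H (Num.truncn (C / x)).+1 isT.
rewrite -ler_pdivlMr// leNgt => /negP; apply.
by apply: truncnS_gt.
Qed.

(** Over n equal pieces of [x, y] the increments add up to at most
    [n C ((y - x) / n)^2 = C (y - x)^2 / n], for every n. *)
Lemma sqr_lip_const (h : R -> R) C :
  (forall x y, 0 <= x -> x <= y -> y <= 1 -> `|h y - h x| <= C * (y - x) ^+ 2) ->
  forall x y, 0 <= x -> x <= y -> y <= 1 -> h y = h x.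
Proof.
move=> H x y x0 xy y1; apply/eqP; rewrite -subr_eq0 -normr_le0.
apply: (@arch_le0 _ (C * (y - x) ^+ 2)) => n n0.
pose p i := x + (i%:R / n%:R) * (y - x).
have nR : 0 < n%:R :> R by rewrite ltr0n.
have -> : h y - h x = \sum_(0 <= i < n) (h (p i.+1) - h (p i)).
  rewrite telescope_sumr//; congr (h _ - h _); rewrite /p.
    by rewrite divff ?gt_eqF// mul1r addrC subrK.
  by rewrite mul0r mul0r addr0.
have p_le i : (i <= n)%N -> 0 <= p i <= 1.
  move=> ilen; have t1 : i%:R / n%:R <= 1 :> R by rewrite ler_pdivrMr// mul1r ler_nat.
  have t0 : 0 <= i%:R / n%:R :> R by rewrite divr_ge0.
  rewrite /p; set t := _ / _ in t0 t1 *; apply/andP; split; nra.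
rewrite mulrC -ler_pdivlMr//.
apply: (le_trans (ler_norm_sum _ _ _)).
have -> : C * (y - x) ^+ 2 / n%:R = \sum_(0 <= i < n) C * ((y - x) / n%:R) ^+ 2.
  rewrite sumr_const_nat subn0 -mulr_natr; field.
  by rewrite gt_eqF.
rewrite big_nat [leRHS]big_nat; apply: ler_sum => i /andP[_ ilt].
have /andP[p0 p1] := p_le i (ltnW ilt); have /andP[q0 q1] := p_le i.+1 ilt.
have e : p i.+1 - p i = (y - x) / n%:R.
  by rewrite /p -(natr1 i); field; rewrite gt_eqF.
rewrite -e; apply: H => //.
by rewrite -subr_ge0 e divr_ge0// ?subr_ge0// ltW.
Qed.

Lemma antiderE v g a b : antider v g -> 0 <= a -> a <= b -> b <= 1 ->
  integ a b g = v b - v a.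
Proof. by move=> [_ H] *; rewrite H. Qed.

Lemma antider_bound v g K a b : antider v g -> 0 <= a -> a <= b -> b <= 1 ->
  (forall x, a <= x <= b -> `|g x| <= K) -> `|v b - v a| <= K * (b - a).
Proof. by move=> [bg vg] a0 ab b1 gK; rewrite vg//; exact: integ_norm. Qed.

Lemma bmeas_pos_bound f : bmeas f -> exists2 K, 0 <= K & forall x, 0 <= x <= 1 -> `|f x| <= K.
Proof.
move=> [_ [K fK]]; exists `|K| => // x x01.
by apply: le_trans (ler_norm K); exact: fK.
Qed.

Lemma antider_lip_bound v g K : antider v g -> (forall x, 0 <= x <= 1 -> `|g x| <= K) ->
  forall x y, 0 <= x <= 1 -> 0 <= y <= 1 -> `|v y - v x| <= K * `|y - x|.
Proof.
move=> vg gK; suff H x y : 0 <= x -> x <= y -> y <= 1 -> `|v y - v x| <= K * `|y - x|.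
  move=> x y /andP[x0 x1] /andP[y0 y1]; have [xy|yx] := leP x y; first exact: H.
  by rewrite distrC [`|y - x|]distrC; apply: H => //; exact: ltW.
move=> x0 xy y1; rewrite (@ger0_norm _ (y - x)) ?subr_ge0//.
apply: (antider_bound vg) => // z /andP[xz zy]; apply: gK.
by rewrite (le_trans x0 xz) (le_trans zy y1).
Qed.

Lemma antider_lip v g : antider v g -> exists2 K, 0 <= K &
  forall x y, 0 <= x <= 1 -> 0 <= y <= 1 -> `|v y - v x| <= K * `|y - x|.
Proof.
move=> vg; have [K K0 gK] := bmeas_pos_bound vg.1; exists K => //.
exact: antider_lip_bound gK.
Qed.

Lemma lip_within (A : set R) f K : 0 <= K -> (forall x y, A x -> A y -> `|f y - f x| <= K * `|y - x|) ->
  {within A, continuous f}.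
Proof.
move=> K0 H; apply/subspace_continuousP => x Ax.
apply/cvgrPdist_le => e e0; rewrite near_withinE.
have K1 : 0 < K + 1 by lra.
apply/nbhs_ballP; exists (e / (K + 1)) => /=; first by rewrite divr_gt0.
move=> y; rewrite /ball/= distrC => yx Ay; rewrite distrC; apply: (le_trans (H x y Ax Ay)).
rewrite ltr_pdivlMr// in yx; have := normr_ge0 (y - x); lra.
Qed.

Lemma antider_continuous v g : antider v g -> {within I, continuous v}.
Proof. by move=> /antider_lip[K K0 H]; apply: (lip_within K0) => x y; rewrite !unit_intervalE; exact: H. Qed.

Lemma within_continuous_bmeas v : {within I, continuous v} -> bmeas v.
Proof.
move=> cv; split; first by apply: subspace_continuous_measurable_fun => //; exact: measurable_itv.
have [x _ H] := EVT_max ler01 cv; have [y _ H'] := EVT_min ler01 cv.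
exists (`|v x| + `|v y|) => z z01; have zI : z \in `[0, 1] by rewrite in_itv.
have := H _ zI; have := H' _ zI; have := ler_norm (v x).
have := ler_norm (- v y); rewrite normrN ler_norml.
have := normr_ge0 (v x); have := normr_ge0 (v y).
by move=> *; apply/andP; split; lra.
Qed.

Lemma antider_bmeas v g : antider v g -> bmeas v.
Proof. by move=> /antider_continuous; exact: within_continuous_bmeas. Qed.

Lemma antiderD v g w f : antider v g -> antider w f ->
  antider (fun x => v x + w x) (fun x => g x + f x).
Proof.
move=> [bg vg] [bf wf]; split; first exact: bmeasD.
by move=> a b a0 ab b1; rewrite integD// -vg// -wf//; ring.
Qed.

Lemma antiderZ c v g : antider v g -> antider (fun x => c * v x) (fun x => c * g x).
Proof.
move=> [bg vg]; split; first exact: bmeasZ.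
by move=> a b a0 ab b1; rewrite integZ// -vg//; ring.
Qed.

Lemma antiderN v g : antider v g -> antider (fun x => - v x) (fun x => - g x).
Proof.
move=> /(antiderZ (-1)); congr antider; apply/funext => x; exact: mulN1r.
Qed.

Lemma antiderB v g w f : antider v g -> antider w f ->
  antider (fun x => v x - w x) (fun x => g x - f x).
Proof. by move=> vg wf; apply: antiderD => //; exact: antiderN. Qed.

Lemma antider_cst c : antider (fun=> c) (fun=> 0).
Proof.
split; first exact: bmeas_cst.
by move=> a b a0 ab b1; rewrite integ_cst// mul0r subrr.
Qed.

Lemma antider_id : antider (fun x => x) (fun=> 1).
Proof.
split; first exact: bmeas_cst.
by move=> a b a0 ab b1; rewrite integ_cst// mul1r.
Qed.

Lemma eq_antider v w g f : antider v g -> (forall x, 0 <= x <= 1 -> v x = w x) ->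
  (forall x, 0 <= x <= 1 -> g x = f x) -> antider w f.
Proof.
move=> [[mg [K gK]] vg] vw gf; split; first split.
- by apply: eq_measurable_fun mg => x; rewrite inE unit_intervalE => /gf.
- by exists K => x x01; rewrite -gf//; exact: gK.
- move=> a b a0 ab b1; rewrite -!vw ?(le_trans a0)//= ?(le_trans ab)// vg//.
  by apply: eq_integ => x /andP[ax xb]; apply: gf; rewrite (le_trans a0)//= (le_trans xb).
Qed.

(* The increment of a primitive differs from the integral by O((y - x)^2),
   so no product rule for a.e. derivatives is needed. *)
Lemma sqr_lip_antider h f C : bmeas f ->
  (forall x y, 0 <= x -> x <= y -> y <= 1 ->
    `|h y - h x - integ x y f| <= C * (y - x) ^+ 2) -> antider h f.
Proof.
move=> bf H; split => // a b a0 ab b1.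
pose k x := h x - integ 0 x f.
suff : k b = k a.
  rewrite /k (integ_cat _ b1 bf (c := a)) ?a0//; move: (integ 0 a f) (integ a b f) => X Y.
  by move=> e; lra.
apply: (@sqr_lip_const k C) => // x y x0 xy y1.
rewrite /k (integ_cat _ y1 bf (c := x)) ?x0//.
apply: le_trans (H _ _ x0 xy y1); rewrite le_eqVlt; apply/orP; left; apply/eqP.
congr (`|_|); ring.
Qed.

(** Since [v y w y - v x w x = w x (v y - v x) + v y (w y - w x)], the defect on [x, y] is the
    integral of [g z (w x - w z) + (v y - v z) f z], where both differences are O(y - x). *)
Lemma antiderM v g w f : antider v g -> antider w f ->
  antider (fun x => v x * w x) (fun x => g x * w x + v x * f x).
Proof.
move=> vg wf.
have [bg _] := vg; have [bf _] := wf.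
have bv := antider_bmeas vg; have bw := antider_bmeas wf.
have [G G0 gG] := bmeas_pos_bound bg; have [F F0 fF] := bmeas_pos_bound bf.
apply: (@sqr_lip_antider _ _ (2 * G * F)).
  by apply: bmeasD; exact: bmeasM.
move=> x y x0 xy y1.
have -> : v y * w y - v x * w x - integ x y (fun z => g z * w z + v z * f z) =
   integ x y (fun z => g z * (w x - w z) + (v y - v z) * f z).
  rewrite (_ : v y * w y - v x * w x = w x * (v y - v x) + v y * (w y - w x)); last by ring.
  rewrite (vg.2 _ _ x0 xy y1) (wf.2 _ _ x0 xy y1) -!integZ// -integD//; last 2 first.
    exact: bmeasZ.
    exact: bmeasZ.
  rewrite -integB//; last 2 first.
  - by apply: bmeasD; exact: bmeasZ.
  - by apply: bmeasD; exact: bmeasM.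
  by apply: eq_integ => z _; ring.
rewrite (_ : _ * (y - x) ^+ 2 = 2 * G * F * (y - x) * (y - x)); last by ring.
apply: integ_norm => //.
  apply: bmeasD; apply: bmeasM => //; apply: bmeasB => //; exact: bmeas_cst.
move=> z /andP[xz zy].
have z1 : z <= 1 by exact: le_trans y1.
have z0 : 0 <= z by exact: le_trans xz.
have gz : `|g z| <= G by rewrite gG// z0.
have fz : `|f z| <= F by rewrite fF// z0.
have sub p q (f' : R -> R) D : 0 <= p -> q <= 1 -> (forall x, 0 <= x <= 1 -> `|f' x| <= D) ->
  forall t, p <= t <= q -> `|f' t| <= D.
  move=> p0 q1 H t /andP[pt tq]; apply: H.
  by rewrite (le_trans p0 pt) (le_trans tq q1).
have wz : `|w x - w z| <= F * (y - x).
  rewrite distrC; apply: (le_trans (antider_bound wf x0 xz z1 _)).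
    exact: sub fF.
  by apply: ler_wpM2l => //; lra.
have vz : `|v y - v z| <= G * (y - x).
  apply: (le_trans (antider_bound vg z0 zy y1 _)).
    exact: sub gG.
  by apply: ler_wpM2l => //; lra.
apply: (le_trans (ler_normD _ _)); rewrite !normrM.
have e1 : `|g z| * `|w x - w z| <= G * (F * (y - x)) by apply: ler_pM.
have e2 : `|v y - v z| * `|f z| <= (G * (y - x)) * F by apply: ler_pM.
apply: (le_trans (lerD e1 e2)); rewrite le_eqVlt; apply/orP; left; apply/eqP; ring.
Qed.

End Antiderivatives.

(** * Mean value estimates and the fundamental theorem of calculus *)

Section Calculus.
Context {R : realType}.
Implicit Types (f g v w : R -> R) (a b c x y K : R).
Local Notation I := (@unit_interval R).

Lemma MVT_between f (df : R -> R) a b : (forall x, is_derive x 1 f (df x)) ->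
  exists2 t, 0 <= t <= 1 & f b - f a = df (a + t * (b - a)) * (b - a).
Proof.
move=> fd.
have cf x y : {within `[x, y], continuous f}.
  apply: continuous_subspaceT => z.
  by apply: differentiable_continuous; apply/derivable1_diffP; have [] := fd z.
have [ab|ba|->] := ltgtP a b; last by exists 0; rewrite ?lexx ?ler01// !subrr mulr0.
- have [c cab e] := MVT ab (fun x _ => fd x) (cf _ _).
  have ba0 : 0 < b - a by rewrite subr_gt0.
  have [ac cb] : a <= c /\ c <= b by rewrite !(itvP cab).
  exists ((c - a) / (b - a)).
    by rewrite divr_ge0 ?subr_ge0 ?(ltW ab)//= ler_pdivrMr// mul1r lerD2r.
  by rewrite divfK ?gt_eqF// [a + _]addrC subrK.
- have [c cab e] := MVT ba (fun x _ => fd x) (cf _ _).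
  have ba0 : b - a < 0 by rewrite subr_lt0.
  have [ac cb] : b <= c /\ c <= a by rewrite !(itvP cab).
  exists ((c - a) / (b - a)).
    by rewrite ler_ndivlMr// mul0r subr_le0 cb/= ler_ndivrMr// mul1r lerD2r.
  by rewrite divfK ?lt_eqF// [a + _]addrC subrK -[LHS]opprB e -mulrN opprB.
Qed.

Lemma sin_lip a b : `|sin b - sin a| <= `|b - a| :> R.
Proof.
have [t _ ->] := MVT_between a b (fun x => is_derive_sin x).
by rewrite normrM ler_piMl// ler_norml cos_geN1 cos_le1.
Qed.

Lemma norm_sin_le x : `|sin x| <= `|x| :> R.
Proof. by have := sin_lip 0 x; rewrite sin0 !subr0. Qed.

Lemma norm_sin_le1 x : `|sin x| <= 1 :> R.
Proof. by rewrite ler_norml sin_geN1 sin_le1. Qed.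

Lemma norm_cos_le1 x : `|cos x| <= 1 :> R.
Proof. by rewrite ler_norml cos_geN1 cos_le1. Qed.

Lemma cos_taylor1 a b : `|cos b - cos a + sin a * (b - a)| <= (b - a) ^+ 2 :> R.
Proof.
have [t t01 ->] := MVT_between a b (fun x => is_derive_cos x).
rewrite (_ : _ + _ = (sin a - sin (a + t * (b - a))) * (b - a)); last by ring.
rewrite normrM -real_normK ?num_real// expr2; apply: ler_wpM2r => //.
rewrite distrC; apply: (le_trans (sin_lip _ _)).
rewrite (_ : a + _ - a = t * (b - a)); last by ring.
by rewrite normrM ler_piMl// ger0_norm; case/andP: t01.
Qed.

(** The second order remainder of the cosine and the Lipschitz bound of [v] make the defect
    quadratic. The formula turns [1 - cos] into an integral that the energy bounds. *)
Lemma antider_cos v g : antider v g ->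
  antider (fun x => cos (v x)) (fun x => - (sin (v x) * g x)).
Proof.
move=> vg.
have [bg _] := vg; have bv := antider_bmeas vg.
have [G G0 gG] := bmeas_pos_bound bg.
have bs := bmeas_sin bv.
apply: (@sqr_lip_antider _ _ _ (2 * G ^+ 2)).
  by apply: bmeasN; exact: bmeasM.
move=> x y x0 xy y1.
have sub (f' : R -> R) p q D : 0 <= p -> q <= 1 -> (forall x, 0 <= x <= 1 -> `|f' x| <= D) ->
  forall t, p <= t <= q -> `|f' t| <= D.
  move=> p0 q1 H t /andP[pt tq]; apply: H.
  by rewrite (le_trans p0 pt) (le_trans tq q1).
have -> : cos (v y) - cos (v x) - integ x y (fun z => - (sin (v z) * g z)) =
  (cos (v y) - cos (v x) + sin (v x) * (v y - v x)) +
   integ x y (fun z => (sin (v z) - sin (v x)) * g z).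
  rewrite (vg.2 _ _ x0 xy y1) -integZ// -[RHS]addrA -integD//; last 2 first.
    exact: bmeasZ.
    by apply: bmeasM => //; apply: bmeasB => //; exact: bmeas_cst.
  congr (_ + _); rewrite -mulN1r -integZ//; last by apply: bmeasN; exact: bmeasM.
  by apply: eq_integ => z _; ring.
apply: (le_trans (ler_normD _ _)).
have yx0 : 0 <= y - x by rewrite subr_ge0.
have e1 : (v y - v x) ^+ 2 <= (G * (y - x)) ^+ 2.
  rewrite -real_normK ?num_real// lerXn2r ?nnegrE ?mulr_ge0//.
  by apply: (antider_bound vg x0 xy y1); exact: sub gG.
have e2 : `|integ x y (fun z => (sin (v z) - sin (v x)) * g z)| <= (G * (y - x) * G) * (y - x).
  apply: integ_norm => //.
    by apply: bmeasM => //; apply: bmeasB => //; exact: bmeas_cst.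
  move=> z /andP[xz zy].
  rewrite normrM; apply: ler_pM => //.
    apply: (le_trans (sin_lip _ _)).
    apply: (le_trans (antider_bound vg x0 xz (le_trans zy y1) _)).
      by apply: sub gG => //; exact: le_trans y1.
    by apply: ler_wpM2l => //; lra.
  by rewrite gG// (le_trans x0)//= (le_trans zy).
apply: (le_trans (lerD (le_trans (cos_taylor1 _ _) e1) e2)).
by rewrite le_eqVlt; apply/orP; left; apply/eqP; ring.
Qed.

Lemma antider_integ g : bmeas g -> antider (fun x => integ 0 x g) g.
Proof.
move=> bg; split => // a b a0 ab b1.
by rewrite (integ_cat _ b1 bg (c := a)) ?a0// addrC addKr.
Qed.

Lemma itv_within a b v : 0 <= a -> b <= 1 -> {within I, continuous v} ->
  {within `[a, b], continuous v}.
Proof. by move=> a0 b1; apply: continuous_subspaceW; exact: itvsub. Qed.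

Lemma MVT_lip v g K : {within I, continuous v} ->
  (forall x, 0 < x < 1 -> is_derive x 1 v (g x)) ->
  (forall x, 0 < x < 1 -> `|g x| <= K) ->
  forall x y, 0 <= x <= 1 -> 0 <= y <= 1 -> `|v y - v x| <= K * `|y - x|.
Proof.
move=> cv dv gK.
suff H x y : 0 <= x -> x < y -> y <= 1 -> `|v y - v x| <= K * `|y - x|.
  move=> x y /andP[x0 x1] /andP[y0 y1].
  have [xy|yx|->] := ltgtP x y; first exact: H.
    by rewrite distrC [`|y - x|]distrC; exact: H.
  by rewrite !subrr normr0 mulr0.
move=> x0 xy y1.
have [|c cxy ->] := MVT (df := g) xy _ (itv_within x0 y1 cv).
  move=> z; rewrite in_itv/= => /andP[xz zy]; apply: dv.
  by rewrite (le_lt_trans x0 xz) (lt_le_trans zy y1).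
rewrite normrM ler_wpM2r// gK//.
move: cxy; rewrite in_itv/= => /andP[xz zy].
by rewrite (le_lt_trans x0 xz) (lt_le_trans zy y1).
Qed.

(** Differentiability is known inside ]0,1[ only, so the fundamental theorem is applied on
    [a + d, b - d] and the two ends are controlled by the bound [K]. *)
Lemma deriv_antider v g K : {within I, continuous v} ->
  (forall x, 0 < x < 1 -> is_derive x 1 v (g x)) ->
  (forall x, 0 < x < 1 -> {for x, continuous g}) ->
  (forall x, 0 <= x <= 1 -> `|g x| <= K) -> antider v g.
Proof.
move=> cv dv cg gK.
have bg : bmeas g.
  split; last by exists K.
  by apply: continuous_oo_measurable => x /=; rewrite in_itv; exact: cg.
have K0 : 0 <= K by apply: le_trans (gK 0 _); rewrite ?lexx ?ler01.
have lv := MVT_lip cv dv (fun x => fun h => gK x (andb_true_intro (conj (ltW (andP h).1) (ltW (andP h).2)))).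
have H a b : 0 < a -> a < b -> b < 1 -> v b - v a = integ a b g.
  move=> a0 ab b1; rewrite /integ /Rintegral.
  rewrite (continuous_FTC2 (F := v) ab)//.
  - apply/continuous_in_subspaceT => x; rewrite inE/= in_itv/= => /andP[ax xb]; apply: cg.
    by rewrite (lt_le_trans a0)// (le_lt_trans xb).
  - have dI x : a <= x <= b -> derivable v x 1.
      move=> /andP[ax xb].
      have [] := dv x; last by [].
      by rewrite (lt_le_trans a0)// (le_lt_trans xb).
    have cI x : a <= x <= b -> {for x, continuous v}.
      by move=> /dI /derivable1_diffP /differentiable_continuous.
    split.
    + by move=> x; rewrite in_itv/= => /andP[ax xb]; apply: dI; rewrite !ltW.
    + by apply: cvg_at_right_filter; apply: cI; rewrite lexx ltW.
    + by apply: cvg_at_left_filter; apply: cI; rewrite lexx ltW.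
  - move=> x; rewrite in_itv/= => /andP[ax xb].
    rewrite derive1E; apply: derive_val; apply: dv.
    by rewrite (lt_trans a0)// (lt_trans xb).
split => // a b a0 ab b1.
apply/eqP; rewrite -subr_eq0 -normr_le0; apply/ler_addgt0Pr => e e0; rewrite add0r.
have [->|] := eqVneq a b; first by rewrite subrr integ_pt subrr normr0 ltW.
move=> anb; have {}ab : a < b by rewrite lt_neqAle anb.
(* A third of the length keeps the middle interval nonempty; [v] and the integral each contribute at
   most [K d] at each end, hence the requirement [4 K d <= e]. *)
pose d := Num.min ((b - a) / 3) (e / (4 * K + 1)).
have d0 : 0 < d by rewrite lt_min !divr_gt0// ?subr_gt0//; lra.
have d1 : d <= (b - a) / 3 by rewrite ge_min lexx.
have d2 : d * (4 * K + 1) <= e by rewrite -ler_pdivlMr ?ge_min ?lexx ?orbT//; lra.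
have dab : a + d < b - d by lra.
have Hd := H (a + d) (b - d) ltac:(lra) dab ltac:(lra).
have i1 : integ a b g = integ a (a + d) g + integ (a + d) (b - d) g + integ (b - d) b g.
  rewrite (integ_cat a0 b1 bg (c := a + d)); last by apply/andP; split; lra.
  by rewrite -addrA; congr (_ + _); apply: integ_cat => //; [lra|apply/andP; split; lra].
have j1 : `|integ a (a + d) g| <= K * (a + d - a).
  apply: integ_norm => //; [lra|lra|move=> x /andP[? ?]; apply: gK; apply/andP; split; lra].
have j2 : `|integ (b - d) b g| <= K * (b - (b - d)).
  apply: integ_norm => //; [lra|lra|move=> x /andP[? ?]; apply: gK; apply/andP; split; lra].
have j3 : `|v (a + d) - v a| <= K * `|a + d - a|.
  by apply: lv; apply/andP; split; lra.
have j4 : `|v b - v (b - d)| <= K * `|b - (b - d)|.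
  by apply: lv; apply/andP; split; lra.
rewrite (_ : a + d - a = d) in j1 j3; last by ring.
rewrite (_ : b - (b - d) = d) in j2 j4; last by ring.
rewrite (gtr0_norm d0) in j3 j4.
rewrite i1 -Hd.
rewrite (_ : _ - _ = (v (a + d) - v a) + (v b - v (b - d)) - integ a (a + d) g - integ (b - d) b g); last by ring.
move: j1 j2 j3 j4; rewrite !ler_norml => /andP[? ?] /andP[? ?] /andP[? ?] /andP[? ?].
by apply/andP; split; lra.
Qed.

Lemma antider_poly (p : {poly R}) : antider (fun x => p.[x]) (fun x => p^`().[x]).
Proof.
have cp : continuous (fun x : R => p.[x]) by move=> x; exact: continuous_horner.
have cq : continuous (fun x : R => p^`().[x]) by move=> x; exact: continuous_horner.
have [K _ HK] := bmeas_pos_bound (within_continuous_bmeas (continuous_subspaceT (A := I) cq)).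
apply: (@deriv_antider _ _ K) => //.
- exact: continuous_subspaceT.
- by move=> x _; exact: is_derive_poly.
- by move=> x _; exact: cq.
Qed.

Lemma eq_integ_oo a b f g : 0 <= a -> b <= 1 -> bmeas f -> bmeas g ->
  (forall x, a < x < b -> f x = g x) -> integ a b f = integ a b g.
Proof.
move=> a0 b1 bf bg fg.
have H h : bmeas h -> integ a b h = \int[@lebesgue_measure R]_(x in `]a, b[) h x.
  move=> bh; have ih := bmeas_integrable a0 b1 bh.
  rewrite /integ -Rintegral_itv_bndo_bndc.
    rewrite -Rintegral_itv_obnd_cbnd//.
    by apply: integrableS ih => //; exact: subset_itv_oo_cc.
  by apply: integrableS ih => //; exact: subset_itv_co_cc.
rewrite !H//; apply: eq_Rintegral => x.
by rewrite inE/= in_itv; exact: fg.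
Qed.

Lemma ae_imp (P Q : R -> Prop) : {ae @lebesgue_measure R, forall x, P x} ->
  (forall x, P x -> Q x) -> {ae @lebesgue_measure R, forall x, Q x}.
Proof.
by move=> aP PQ; apply: (@filterS _ _ (ae_filter_ringOfSetsType (@lebesgue_measure R)) _ _ _ aP).
Qed.

Lemma ae_and (P Q : R -> Prop) : {ae @lebesgue_measure R, forall x, P x} ->
  {ae @lebesgue_measure R, forall x, Q x} -> {ae @lebesgue_measure R, forall x, P x /\ Q x}.
Proof.
move=> aP aQ.
exact: (@filterI _ _ (ae_filter_ringOfSetsType (@lebesgue_measure R)) _ _ aP aQ).
Qed.

Lemma eq_integ_ae a b f g : 0 <= a -> b <= 1 -> measurable_fun I f -> measurable_fun I g ->
  {ae @lebesgue_measure R, forall x, I x -> f x = g x} -> integ a b f = integ a b g.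
Proof.
move=> a0 b1 mf mg fg; rewrite /integ /Rintegral; congr fine.
have sI := itvsub a0 b1.
apply: ae_eq_integral => //.
- by apply/measurable_EFinP; apply: measurable_funS mf => //; exact: measurable_itv.
- by apply/measurable_EFinP; apply: measurable_funS mg => //; exact: measurable_itv.
- by apply: (ae_imp fg) => x fgx /sI/fgx /= ->.
Qed.

Lemma is_derive_quad f r d C : (\forall s \near r, `|f s - f r - d * (s - r)| <= C * (s - r) ^+ 2) ->
  is_derive r 1 f d.
Proof.
move=> H.
suff cv : h^-1 *: (f (h *: 1 + r) - f r) @[h --> 0^'] --> d.
  by apply: DeriveDef; [apply/cvg_ex; exists d|exact: cvg_lim].
have /nbhs_ballP[D /= D0 HD] := H.
apply/subr_cvg0; apply: (@cvg_to_0_linear _ _ C D) => // h /andP[h0 hD].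
have := HD (h + r); rewrite /ball/= opprD addrCA subrr addr0 normrN => /(_ hD).
rewrite addrK => Hh; rewrite /GRing.scale/= mulr1.
rewrite normr_gt0 in h0.
rewrite -[d](mulKf h0) -mulrBr normrM normfV ler_pdivrMl ?normr_gt0//.
by rewrite mulrCA -expr2 real_normK ?num_real// [h * d]mulrC.
Qed.

End Calculus.

(** * The fundamental lemma of the calculus of variations *)

Section FlatFunctions.
Context {R : realType}.
Implicit Types (q P : {poly R}) (r x y : R) (m : nat).

(* exp (- 1 / q) on the set where q is positive, with a polynomial
   prefactor: the class is stable under differentiation. *)
Definition flat q P m r : R :=
  if 0 < q.[r] then P.[r] * q.[r]^-1 ^+ m * expR (- q.[r]^-1) else 0.

(** The inequality [exp t >= t] at [t = 1 / (n s)], raised to the power n: the exponential beats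
    every negative power of [s]. *)
Lemma expRN_inv_le (s : R) n : (0 < n)%N -> 0 < s -> expR (- s^-1) <= (n%:R * s) ^+ n.
Proof.
move=> n0 s0; have nR : 0 < n%:R :> R by rewrite ltr0n.
rewrite expRN -[leRHS]invrK lef_pV2 ?posrE ?expR_gt0 ?invr_gt0 ?exprn_gt0 ?mulr_gt0//.
rewrite -exprVn.
have -> : expR s^-1 = expR ((n%:R * s)^-1) ^+ n.
  rewrite -expRM_natl -mulr_natl; congr expR; field.
  by rewrite !gt_eqF.
rewrite lerXn2r ?nnegrE ?expR_ge0 ?invr_ge0 ?mulr_ge0 ?ltW//.
by have := expR_ge1Dx (n%:R * s)^-1; lra.
Qed.

(** The polynomial factor left after differentiating [P q^-m exp (- 1 / q)] and taking out
    [q^-(m+2) exp (- 1 / q)]. *)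
Definition flat_num q P m := P^`() * q ^+ 2 - (m%:R *: (P * q^`() * q)) + P * q^`().

Lemma horner_near_bounded P r : exists2 K, 0 <= K & \forall s \near r, `|P.[s]| <= K.
Proof.
exists (`|P.[r]| + 1) => //.
have /cvgrPdist_le/(_ 1 ltr01) := @continuous_horner R P r.
apply: filterS => s h.
rewrite -lerBlDl; apply: le_trans h.
by rewrite distrC; exact: lerB_dist.
Qed.

Lemma is_derive_flat q P m r : is_derive r 1 (flat q P m) (flat q (flat_num q P m) m.+2 r).
Proof.
rewrite {2}/flat; case: ltgtP => q0.
- apply: (near_eq_is_derive (f := fun s => P.[s] * q.[s]^-1 ^+ m * expR (- q.[s]^-1))).
    have : \forall s \near r, 0 < q.[s].
      exact: (@continuous_horner R q r _ (lt_nbhsr q0)).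
    by apply: filterS => s qs; rewrite /flat qs.
  have dP := is_derive_poly P r; have dq := is_derive_poly q r.
  have qn0 : q.[r] != 0 by rewrite gt_eqF.
  have dV := is_deriveV qn0 dq.
  have dX := is_deriveX m dV.
  have dE := @is_derive1_comp R expR (- (fun y => q.[y]^-1)) r _ _ (is_derive_expR _) (is_deriveN dV).
  have := is_deriveM (is_deriveM dP dX) dE.
  have -> : (horner P * (fun y => q.[y]^-1) ^+ m * (expR \o - (fun y => q.[y]^-1)) : R -> R) =
    (fun s => P.[s] * q.[s]^-1 ^+ m * expR (- q.[s]^-1)).
    by apply/funext => s; rewrite fctE /= exprfctE.
  move=> h; apply: (is_derive_eq h).
  rewrite exprfctE.
  change (P.[r] * q.[r]^-1 ^+ m * (expR (- q.[r]^-1) * - (- q.[r] ^- 2 * q^`().[r])) +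
    expR (- q.[r]^-1) * (P.[r] * (m%:R * q.[r]^-1 ^+ m.-1 * (- q.[r] ^- 2 * q^`().[r])) +
      q.[r]^-1 ^+ m * P^`().[r]) =
    (flat_num q P m).[r] * q.[r]^-1 ^+ m.+2 * expR (- q.[r]^-1)).
  rewrite /flat_num !(hornerD, hornerN, hornerM, hornerZ, horner_exp).
  move: (expR _) (P^`().[r]) P.[r] (q^`().[r]) => E P1 P0 q1.
  case: m {dX h} => [|m]; first by rewrite !expr0; field.
  rewrite -natr1 [m.+1.-1]/= !exprS.
  by move: (q.[r]^-1 ^+ m) => Z; field.
- apply: (near_eq_is_derive (f := fun=> 0)).
  have : \forall s \near r, q.[s] < 0.
    exact: (@continuous_horner R q r _ (lt_nbhsl q0)).
  by apply: filterS => s qs; rewrite /flat ltNge (ltW qs).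
(* At a root of [q] the linear factor [s - r] divides [q]. With exponent m + 2 the exponential bound
   leaves two powers of [q] after cancelling [q^-m], so the function is quadratic in [s - r] and has
   derivative 0. *)
- have [K K0 PK] := horner_near_bounded P r.
  have /factor_theorem[q1 q1E] : root q r by rewrite rootE q0.
  have [L L0 qL] := horner_near_bounded q1 r.
  apply: (@is_derive_quad _ _ _ _ (K * m.+2%:R ^+ m.+2 * L ^+ 2)).
  near=> s.
  have Ps : `|P.[s]| <= K by near: s.
  have qs : `|q1.[s]| <= L by near: s.
  rewrite /flat mul0r subr0 -q0 ltxx subr0.
  case: ltP => [qs0|_]; last by rewrite normr0 mulr_ge0 ?sqr_ge0// mulr_ge0 ?sqr_ge0// mulr_ge0 ?exprn_ge0.
  have e1 : q.[s] <= L * `|s - r|.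
    rewrite q1E hornerM hornerXsubC; apply: (le_trans (ler_norm _)).
    by rewrite normrM ler_wpM2r.
  rewrite !normrM (ger0_norm (expR_ge0 _)) (@ger0_norm _ (_ ^+ m)); last first.
    by rewrite exprn_ge0// invr_ge0 ltW.
  have e2 : q.[s]^-1 ^+ m * expR (- q.[s]^-1) <= m.+2%:R ^+ m.+2 * q.[s] ^+ 2.
    have := @expRN_inv_le q.[s] m.+2 isT qs0.
    rewrite exprMn -[m.+2 in X in _ * X]addn2 exprD => h.
    rewrite exprVn ler_pdivrMl ?exprn_gt0//; apply: (le_trans h).
    by rewrite le_eqVlt; apply/orP; left; apply/eqP; ring.
  have e3 : q.[s] ^+ 2 <= L ^+ 2 * (s - r) ^+ 2.
    rewrite -exprMn -[leRHS]real_normK ?num_real// normrM (ger0_norm L0).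
    by rewrite lerXn2r ?nnegrE ?mulr_ge0// ltW.
  have N0 : 0 <= m.+2%:R ^+ m.+2 :> R by rewrite exprn_ge0.
  rewrite -[leLHS]mulrA (_ : _ * (s - r) ^+ 2 =
    K * (m.+2%:R ^+ m.+2 * (L ^+ 2 * (s - r) ^+ 2))); last by rewrite !mulrA.
  apply: ler_pM => //.
    by rewrite mulr_ge0 ?expR_ge0// exprn_ge0// invr_ge0 ltW.
  exact: le_trans e2 (ler_wpM2l N0 e3).
Unshelve. all: by end_near. Qed.

Lemma derive1n_flat q P m n : exists P' m', derive1n n (flat q P m) = flat q P' m'.
Proof.
elim: n => [|n [P' [m' ih]]]; first by exists P, m.
exists (flat_num q P' m'), m'.+2; rewrite derive1nS ih.
by apply/funext => r; rewrite derive1E; apply: derive_val; exact: is_derive_flat.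
Qed.

(** For [x <= y] it is positive on ]x, y[ only; the factor n drives [exp (- 1 / q)] to 1 there, so
    that the bumps converge to the indicator. *)
Definition bump_poly x y (n : nat) : {poly R} := n%:R *: (('X - x%:P) * (y%:P - 'X)).

Definition smooth_bump x y n := flat (bump_poly x y n) 1 0.

Lemma smooth_bumpE x y n r : x <= y -> (0 < n)%N ->
  smooth_bump x y n r = if x < r < y then expR (- (n%:R * ((r - x) * (y - r)))^-1) else 0.
Proof.
move=> xy n0; have qE : (bump_poly x y n).[r] = n%:R * ((r - x) * (y - r)).
  by rewrite /bump_poly hornerZ hornerM hornerXsubC hornerD hornerN hornerC hornerX.
rewrite /smooth_bump /flat qE hornerC expr0 !mul1r; congr (if _ then _ else _).
rewrite pmulr_rgt0 ?ltr0n//.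
apply/idP/idP => [h|/andP[? ?]]; last by rewrite mulr_gt0 ?subr_gt0.
have [rx|xr|rx] := ltgtP r x; last by move: h; rewrite rx subrr mul0r ltxx.
- move: h; rewrite nmulr_rgt0 ?subr_lt0// => yr; exfalso; lra.
- by move: h; rewrite pmulr_rgt0 ?subr_gt0.
Qed.

Lemma smooth_bump_test_function x y n : x <= y -> (0 < n)%N -> 0 < x -> y < 1 -> test_function (smooth_bump x y n).
Proof.
move=> xy n0 x0 y1; split.
  move=> k r; have [P [m e]] := derive1n_flat (bump_poly x y n) 1 0 k.
  by rewrite /smooth_bump e; have [] := is_derive_flat (bump_poly x y n) P m r.
exists x, y; split => // r.
rewrite in_itv/= smooth_bumpE//; case: ifP => // /andP[xr ry].
by rewrite !ltW.
Qed.

Lemma smooth_bump_ge0_le1 x y n r : x <= y -> (0 < n)%N -> 0 <= smooth_bump x y n r <= 1.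
Proof.
move=> xy n0; rewrite smooth_bumpE//; case: ifP => [/andP[xr ry]|_]; last by rewrite lexx ler01.
rewrite expR_ge0 -[leRHS]expR0 ler_expR oppr_le0 invr_ge0.
by rewrite !mulr_ge0// subr_ge0 ltW.
Qed.

Lemma smooth_bump_cvg x y r : x <= y -> (fun n => smooth_bump x y n.+1 r) @ \oo --> (\1_(`]x, y[) r : R).
Proof.
move=> xy; rewrite indicE mem_setE in_itv/=.
rewrite (_ : (fun n => _) = fun n => if x < r < y then expR (- (n.+1%:R * ((r - x) * (y - r)))^-1) else 0);
  last by apply/funext => n; rewrite smooth_bumpE.
have [/andP[xr ry]|_] := boolP (x < r < y); last exact: cvg_cst.
have q0 : 0 < (r - x) * (y - r) by rewrite mulr_gt0 ?subr_gt0.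
have -> : (fun n => expR (- (n.+1%:R * ((r - x) * (y - r)))^-1)) =
    expR \o (fun n => - (harmonic n * ((r - x) * (y - r))^-1)).
  by apply/funext => n /=; rewrite invfM.
set c := _^-1.
have : (expR \o (fun n => - (harmonic n * c))) @ \oo --> expR (- (0 * c)).
  apply: continuous_cvg; first exact: continuous_expR.
  by apply: cvgN; apply: cvgMl; exact: cvg_harmonic.
by rewrite mul0r oppr0 expR0.
Qed.

End FlatFunctions.

Section FundamentalLemma.
Context {R : realType}.
Implicit Types (f g v w phi : R -> R) (a b x y : R) (n : nat).
Local Notation mu := (@lebesgue_measure R).
Local Notation I := (@unit_interval R).

Lemma locally_integrable_itv g x y : locally_integrable `]0, 1[ g -> 0 < x -> y < 1 ->
  mu.-integrable `[x, y] (EFin \o g).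
Proof.
move=> [mg _ ig] x0 y1.
have sub : `[x, y] `<=` (`]0, 1[ : set R).
  by move=> z /=; rewrite !in_itv/= => /andP[xz zy]; rewrite (lt_le_trans x0)//= (le_lt_trans zy).
apply/integrableP; split.
  by apply/measurable_EFinP; apply: measurable_funS mg => //; exact: measurable_itv.
exact: (ig _ sub (@segment_compact _ _ _)).
Qed.

Lemma ae_neq c : {ae mu, forall x, x != c}.
Proof.
exists [set c]; split => //; first exact: lebesgue_measure_set1.
by move=> x /= /negP; rewrite negbK => /eqP.
Qed.

Section with_g.
Variable g : R -> R.
Hypothesis lg : locally_integrable `]0, 1[ g.
Hypothesis g0 : forall phi, test_function phi -> \int[mu]_(r in `]0, 1[) (g r * phi r) = 0.

(** The bumps on ]x, y[ converge to the indicator and their products with [g] are dominated by |g|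
    on [x, y], a compact subset of ]0,1[. *)
Let int0 x y : 0 < x -> x <= y -> y < 1 -> \int[mu]_(r in `]x, y[) g r = 0.
Proof.
move=> x0 xy y1.
have igxy := locally_integrable_itv lg x0 y1.
pose D := [set` `]0%R, 1%R[] : set R.
have mD : measurable D by exact: measurable_itv.
have mg : measurable_fun D g by case: lg.
pose f_ n r := (g r * smooth_bump x y n.+1 r)%:E.
pose F r := (g r * \1_(`]x, y[) r)%:E.
pose G r := `|((g \_ `[x, y]) r)%:E|%E.
have mb n : measurable_fun D (smooth_bump x y n.+1).
  apply: measurable_funTS; apply: continuous_measurable_fun => r.
  apply: differentiable_continuous; apply/derivable1_diffP.
  have [] := smooth_bump_test_function xy (ltn0Sn n) x0 y1.
  by move=> /(_ 0%N r) d _; exact: d.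
have iG : mu.-integrable D (EFin \o (g \_ `[x, y])).
  have mxy : measurable (`[x, y] : set R) by exact: measurable_itv.
  rewrite -restrict_EFin; apply/(integrable_restrict mu mxy mD).
  apply: integrableS igxy => //.
  exact: measurableI.
have Gle n r : `|g r * smooth_bump x y n.+1 r| <= `|(g \_ `[x, y]) r|.
  rewrite patchE; have [rxy|rxy] := boolP (r \in `[x, y]).
    rewrite mem_set//= normrM ler_piMr//.
    by have /andP[b0 b1] := smooth_bump_ge0_le1 r xy (ltn0Sn n); rewrite ger0_norm.
  rewrite memNset//=; last by apply/negP.
  rewrite smooth_bumpE//; case: ifP => [/andP[xr ry]|_]; last by rewrite mulr0 normr0.
  by move: rxy; rewrite in_itv/= (ltW xr) (ltW ry).
have [] := @dominated_convergence _ _ _ mu D mD f_ F G.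
- move=> n; apply/measurable_EFinP; exact: (measurable_funM mg (mb n)).
- apply/measurable_EFinP; apply: (measurable_funM mg).
  apply: measurable_indic; exact: measurable_itv.
- apply: aeW => r Dr; rewrite /f_ /F; apply: cvg_EFin.
    by apply: nearW => n.
  apply: cvgMr; exact: smooth_bump_cvg.
- exact: (integrable_abse iG).
- by apply: aeW => r n _; rewrite /f_ /G /= lee_fin.
move=> _ _ cv.
have c0 : (fun n => \int[mu]_(r in D) f_ n r)%E = fun=> 0%E.
  apply/funext => n.
  have := g0 (smooth_bump_test_function xy (ltn0Sn n) x0 y1).
  rewrite /Rintegral => /eqP; rewrite fine_eq0 => [/eqP//|].
  apply: integrable_fin_num => //.
  apply: (@le_integrable _ _ _ mu D mD _ (EFin \o (g \_ `[x, y]))) => //.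
  - by apply/measurable_EFinP; exact: (measurable_funM mg (mb n)).
  - by move=> r _; rewrite /= lee_fin.
have e0 : (\int[mu]_(r in D) F r = 0)%E.
  apply/esym; move: cv; rewrite [X in X @ _ --> _](_ : _ = fun=> 0%E); last first.
    by apply/funext => n; exact: (congr1 (fun h => h n) c0).
  by move/cvg_lim => <-//; rewrite lim_cst.
have -> : \int[mu]_(r in `]x, y[) g r = \int[mu]_(r in D) ((g \_ `]x, y[) r).
  rewrite -Rintegral_mkcondr; congr (Rintegral _ _ _).
  apply/seteqP; split => r /=; rewrite !in_itv/=; last by case.
  move=> /andP[xr ry]; split; last by rewrite xr ry.
  by rewrite /D/= in_itv/= (lt_trans x0)//= (lt_trans ry).
rewrite /Rintegral (_ : (\int[mu]_(r in D) _)%E = 0%E)// -e0.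
apply: eq_integral => r _; rewrite /F patchE indicE.
by case: ifP => _; rewrite ?mulr1 ?mulr0.
Qed.

(** Local integrability gives a primitive only on compact subintervals. On each of them the
    primitive is constant, so Lebesgue differentiation yields [g = 0] almost everywhere; countably
    many of them exhaust ]0,1[. *)
Lemma fundamental_lemma : {ae mu, forall x, I x -> g x = 0}.
Proof.
have H n : {ae mu, forall x, n.+2%:R^-1 < x < 1 - n.+2%:R^-1 -> g x = 0}.
  set a := n.+2%:R^-1; set u := 1 - a.
  have a0 : 0 < a by rewrite invr_gt0.
  have u1 : u < 1 by rewrite /u; lra.
  have ig := locally_integrable_itv lg a0 u1.
  have mau : measurable (`[a, u] : set R) by exact: measurable_itv.
  pose f := g \_ `[a, u].
  have lf : locally_integrable [set: R] f by exact: integrable_locally.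
  have iT : mu.-integrable setT (EFin \o f).
    by rewrite -restrict_EFin; exact: ((@integrable_mkcond _ _ _ mu _ (EFin \o g) (measurable_itv _)).1 ig).
  have ify y : mu.-integrable [set` Interval (BLeft a) (BRight y)] (EFin \o f).
    by apply: integrableS iT.
  apply: (ae_imp (FTC1 ify lf)) => x H /andP[ax xu].
  have [] := H; first by rewrite /= lte_fin.
  set F := fun x => _.
  have F0 : \forall z \near x, 0 = F z.
    have : \forall z \near x, a < z < u.
      near=> z; apply/andP; split; near: z; [exact: lt_nbhsr|exact: lt_nbhsl].
    apply: filterS => z /andP[az zu]; rewrite /F.
    have e : \int[mu]_(t in `[a, z]) f t = \int[mu]_(t in `[a, z]) g t.
      apply: eq_Rintegral => t; rewrite inE/= in_itv/= => /andP[at_ tz].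
      by rewrite /f patchE mem_set//= in_itv/= at_ (le_trans tz)// ltW.
    have igz : mu.-integrable `[a, z] (EFin \o g).
      by apply: (locally_integrable_itv lg) => //; exact: lt_trans u1.
    rewrite e -Rintegral_itv_obnd_cbnd; last first.
      by apply: integrableS igz => //; exact: subset_itv_oc_cc.
    rewrite -Rintegral_itv_bndo_bndc; last first.
      by apply: integrableS igz => //; exact: subset_itv_oo_cc.
    by rewrite int0// ?(ltW az)// (lt_trans zu).
  move=> _; rewrite derive1E -(near_eq_derive _ F0) derive_cst => /esym <-.
  by rewrite /f patchE mem_set//= in_itv/= !ltW.
apply: (ae_imp (ae_and (ae_foralln H) (ae_and (ae_neq 0) (ae_neq 1)))) => x [Hx [x0 x1]].
rewrite unit_intervalE => /andP[x0' x1'].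
have xp : 0 < x by rewrite lt_neqAle eq_sym x0.
have xm : 0 < 1 - x by rewrite subr_gt0 lt_neqAle x1.
have [n nP] : exists n : nat, n.+2%:R^-1 < Num.min x (1 - x).
  exists (Num.truncn (Num.min x (1 - x))^-1).
  have m0 : 0 < Num.min x (1 - x) by rewrite lt_min xp xm.
  rewrite -[ltRHS]invrK ltf_pV2 ?posrE ?invr_gt0//.
  apply: (lt_le_trans (truncnS_gt _)); by rewrite ler_nat.
apply: (Hx n); move: nP; rewrite lt_min => /andP[n1 n2].
by rewrite n1/= ltrBrDr addrC -ltrBrDr.
Unshelve. all: by end_near. Qed.

End with_g.
End FundamentalLemma.

(** * Weak derivatives *)

Section WeakDerivatives.
Context {R : realType}.
Implicit Types (f g p q v w phi psi : R -> R) (a b x y : R) (n i : nat).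
Local Notation mu := (@lebesgue_measure R).
Local Notation I := (@unit_interval R).

Lemma derivable_continuous f x : derivable f x 1 -> {for x, continuous f}.
Proof. by move=> /derivable1_diffP /differentiable_continuous. Qed.

Lemma test_derive1n phi n : test_function phi -> test_function (derive1n n phi).
Proof.
move=> [dphi [a [b [a0 b1 sup]]]]; split.
  by move=> m x; have := dphi (m + n)%N x; rewrite /derive1n iterD.
exists a, b; split => //.
elim: n => [//|n ih] x xab; rewrite derive1nS derive1E.
rewrite (@near_eq_derive _ _ _ _ (fun=> 0)) ?derive_cst//.
have : \forall y \near x, ~ `[a, b]%classic y.
  have oC : open (~` `[a, b] : set R) by apply: closed_openC; exact: itv_closed.
  by apply: (open_nbhs_nbhs (conj oC _)) => /=; apply/negP.
by apply: filterS => y /= /negP yab; exact: ih.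
Qed.

Lemma test_continuous phi : test_function phi -> continuous phi.
Proof. by move=> [d _] x; apply: derivable_continuous; exact: (d 0%N). Qed.

Lemma test_bmeas phi : test_function phi -> bmeas phi.
Proof.
by move=> /test_continuous c; apply: within_continuous_bmeas; exact: continuous_subspaceT.
Qed.

Lemma test_antider phi : test_function phi -> antider phi (derive1n 1 phi).
Proof.
move=> tphi; have t1 := test_derive1n 1 tphi.
have [K K0 HK] := bmeas_pos_bound (test_bmeas t1).
apply: (@deriv_antider _ _ _ K) => //.
- by apply: continuous_subspaceT; exact: test_continuous.
- move=> x _; case: tphi => d _; apply: DeriveDef; first exact: (d 0%N).
  by rewrite derive1n1 derive1E.
- by move=> x _; exact: test_continuous.
Qed.

Lemma test_ends phi : test_function phi -> phi 0 = 0 /\ phi 1 = 0.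
Proof.
move=> [_ [a [b [a0 b1 sup]]]]; split; apply: sup; rewrite in_itv/=.
  by rewrite leNgt a0.
by rewrite [1 <= b]leNgt b1 andbF.
Qed.

Lemma derive1n_lin n phi psi k : test_function phi -> test_function psi ->
  derive1n n (fun x => phi x - k * psi x) = (fun x => derive1n n phi x - k * derive1n n psi x).
Proof.
move=> tphi tpsi; elim: n => [//|n ih].
rewrite !derive1nS ih; apply/funext => x.
have d1 := tphi.1 n x; have d2 := tpsi.1 n x.
rewrite !derive1E; apply: derive_val.
rewrite [X in is_derive _ _ X](_ : _ = derive1n n phi - k *: derive1n n psi)//.
apply: is_deriveB; first exact/derivableP.
by apply: is_deriveZ; exact/derivableP.
Qed.

Lemma test_lin phi psi k : test_function phi -> test_function psi ->
  test_function (fun x => phi x - k * psi x).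
Proof.
move=> tphi tpsi; split.
  move=> n x; rewrite derive1n_lin//.
  have d1 := tphi.1 n x; have d2 := tpsi.1 n x.
  rewrite [X in derivable X](_ : _ = derive1n n phi - k *: derive1n n psi)//.
  by apply: derivableB => //; exact: derivableZ.
have [_ [a [b [a0 b1 s1]]]] := tphi; have [_ [c [d [c0 d1 s2]]]] := tpsi.
exists (Num.min a c), (Num.max b d); split; [by rewrite lt_min a0|by rewrite gt_max b1|].
move=> x; rewrite in_itv/= ge_min le_max negb_and !negb_or => h.
rewrite s1 ?s2 ?mulr0 ?subr0// in_itv/= negb_and.
  by case/orP: h => /andP[h1 h2]; rewrite ?h1 ?h2 ?orbT.
by case/orP: h => /andP[h1 h2]; rewrite ?h1 ?h2 ?orbT.
Qed.

Lemma integrable_oo f : bmeas f -> mu.-integrable `]0, 1[ (EFin \o f).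
Proof.
move=> bf; apply: (integrableS _ _ _ (bmeas_integrable (lexx 0) (lexx 1) bf)) => //.
exact: subset_itv_oo_cc.
Qed.

Lemma integ01E f : bmeas f -> \int[mu]_(x in `]0, 1[) f x = integ 0 1 f.
Proof.
move=> bf; have ih := bmeas_integrable (lexx 0) (lexx 1) bf.
rewrite /integ -Rintegral_itv_bndo_bndc.
  by rewrite -Rintegral_itv_obnd_cbnd//; exact: integrable_oo.
by apply: integrableS ih => //; exact: subset_itv_co_cc.
Qed.

Lemma bmeas_locally_integrable f : bmeas f -> locally_integrable `]0, 1[ f.
Proof.
move=> bf; apply: open_integrable_locally; [exact: itv_open|exact: integrable_oo].
Qed.

Lemma locally_integrable_test g phi : locally_integrable `]0, 1[ g -> test_function phi ->
  mu.-integrable `]0, 1[ (EFin \o (fun r => g r * phi r)).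
Proof.
move=> lg tphi; have [_ [a [b [a0 b1 sup]]]] := tphi.
have [K K0 phiK] := bmeas_pos_bound (test_bmeas tphi).
have ig := locally_integrable_itv lg a0 b1.
pose D := [set` `]0%R, 1%R[] : set R.
have mD : measurable D by exact: measurable_itv.
have mab : measurable (`[a, b] : set R) by exact: measurable_itv.
have iG : mu.-integrable D (EFin \o (g \_ `[a, b])).
  rewrite -restrict_EFin; apply/(integrable_restrict mu mab mD).
  apply: integrableS ig => //; exact: measurableI.
apply: (@le_integrable _ _ _ mu D mD _ (fun r => K%:E * (EFin \o (g \_ `[a, b])) r)%E) => //.
- apply/measurable_EFinP; case: lg => mg _ _.
  apply: (measurable_funM mg); apply: measurable_funTS.
  by apply: continuous_measurable_fun; exact: test_continuous.
- move=> r; rewrite /D/= in_itv/= => /andP[r0 r1]; rewrite lee_fin patchE normrM normrM.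
  rewrite (ger0_norm K0) mulrC.
  have [rab|rab] := boolP (r \in `[a, b]).
    by rewrite mem_set//= ler_wpM2r// phiK// !ltW.
  by rewrite memNset//= ?sup// ?normr0 ?mul0r ?mulr0//; apply/negP.
- exact: integrableZl.
Qed.

Lemma weak_deriv_unique n v g1 g2 : weak_deriv n v g1 -> weak_deriv n v g2 ->
  {ae mu, forall x, I x -> g1 x = g2 x}.
Proof.
move=> [lv l1 h1] [_ l2 h2].
have H : {ae mu, forall x, I x -> g1 x - g2 x = 0}.
  apply: fundamental_lemma.
    split; [|exact: itv_open|].
      by apply: measurable_funB; [case: l1|case: l2].
    move=> K KI cK.
    have i1 : mu.-integrable K (EFin \o g1).
      apply/integrableP; split; last by case: l1 => _ _; exact.
      apply/measurable_EFinP; case: l1 => m1 _ _.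
      by apply: measurable_funS m1 => //; exact: measurable_itv.
    have i2 : mu.-integrable K (EFin \o g2).
      apply/integrableP; split; last by case: l2 => _ _; exact.
      apply/measurable_EFinP; case: l2 => m2 _ _.
      by apply: measurable_funS m2 => //; exact: measurable_itv.
    have := @integrableB _ _ _ mu K (compact_measurable cK) _ _ i1 i2.
    by move=> /integrableP[_].
  move=> phi tphi; under eq_Rintegral do rewrite mulrBl.
  rewrite RintegralB//; [|exact: locally_integrable_test..].
  apply/eqP; rewrite subr_eq0; apply/eqP.
  have := h1 _ tphi; rewrite h2// => /(congr1 (fun z => (-1) ^+ n * z)).
  by rewrite !mulrA -!exprMn !mulN1r opprK !expr1n !mul1r.
apply: (ae_imp H) => x Hx xI; apply/eqP; rewrite -subr_eq0; apply/eqP; exact: Hx.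
Qed.

Lemma wDP n v g : weak_deriv n v g -> weak_deriv n v (wD n v).
Proof.
move=> h; have : exists g, weak_deriv n v g by exists g.
exact: getPex.
Qed.

Lemma antider_weak_deriv v g : antider v g -> weak_deriv 1 v g.
Proof.
move=> vg; have bg := vg.1; have bv := antider_bmeas vg.
split; [exact: bmeas_locally_integrable..|].
move=> phi tphi.
have tp := test_antider tphi; have [p0 p1] := test_ends tphi.
have bphi := test_bmeas tphi; have bphi' := tp.1.
rewrite !integ01E; [|exact: bmeasM..].
have := antiderE (antiderM vg tp) (lexx 0) ler01 (lexx 1).
rewrite p0 p1 !mulr0 subrr integD//; [|exact: bmeasM..].
by move=> /eqP; rewrite addr_eq0 expr1 mulN1r => /eqP ->; rewrite opprK.
Qed.

Lemma locally_integrable_measurable g : locally_integrable `]0, 1[ g -> measurable_fun I g.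
Proof. by move=> [mg _ _]; exact: (@measurable_fun_itv_cc _ _ _ false true). Qed.

(** The bridge from [wD], a choice among almost everywhere equal functions, to an explicit bounded
    representative. *)
Lemma antider_wD v g : antider v g ->
  measurable_fun I (wD 1 v) /\ {ae mu, forall x, I x -> wD 1 v x = g x}.
Proof.
move=> /antider_weak_deriv h; have h' := wDP h; split; last exact: weak_deriv_unique h' h.
by case: h' => _ + _; exact: locally_integrable_measurable.
Qed.

(** The definition treats each order separately; testing order i with [phi'] and order i + 1 with
    [phi] relates two successive orders. *)
Lemma weak_deriv_chain i v p q : weak_deriv i v p -> weak_deriv i.+1 v q -> weak_deriv 1 p q.
Proof.
move=> [_ lp hp] [_ lq hq]; split => // phi tphi.
have h1 := hp _ (test_derive1n 1 tphi); have h2 := hq _ tphi.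
have e : derive1n i (derive1n 1 phi) = derive1n i.+1 phi by rewrite derive1n1 derive1Sn.
rewrite e h2 in h1.
rewrite expr1 mulN1r; move: h1; rewrite exprS.
set B := Rintegral _ _ _; set A := Rintegral _ _ _ => h1.
have ss : (-1) ^+ i * (-1) ^+ i = 1 :> R by rewrite -exprMn mulN1r opprK expr1n.
rewrite -[A]mul1r -ss -mulrA -h1 mulN1r mulNr mulrN mulrA ss.
by rewrite mul1r.
Qed.

(** Cutting off a representative turns an almost everywhere bound into a bound at every point, as
    [bmeas] requires. *)
Definition trunc_at (M x : R) := Num.max (- M) (Num.min M x).

Lemma trunc_at_norm M x : 0 <= M -> `|trunc_at M x| <= M.
Proof.
by move=> M0; rewrite ler_norml /trunc_at le_max ge_max ge_min lexx/= lexx; apply/andP; split => //; lra.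
Qed.

Lemma trunc_at_id M x : `|x| <= M -> trunc_at M x = x.
Proof.
rewrite ler_norml => /andP[h1 h2]; rewrite /trunc_at (min_idPr h2).
exact/max_idPr.
Qed.

(** The primitive from minus infinity vanishes to the left of the support, and the zero mean makes
    it vanish to the right. *)
Lemma test_primitive psi : test_function psi -> integ 0 1 psi = 0 ->
  exists2 phi, test_function phi & derive1n 1 phi = psi.
Proof.
move=> tpsi i0; have [d [a [b [a0 b1 sup]]]] := tpsi.
have cpsi := test_continuous tpsi.
have bpsi := test_bmeas tpsi.
have psi0 x : ~~ (0 <= x <= 1) -> psi x = 0.
  move=> h; apply: sup; apply: contra h; rewrite in_itv/= => /andP[ax xb].
  by rewrite (le_trans (ltW a0))//= (le_trans xb)// ltW.
have ipsi : mu.-integrable setT (EFin \o psi).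
  have -> : psi = psi \_ `[0, 1].
    apply/funext => x; rewrite patchE; case: ifPn => //.
    by rewrite mem_setE in_itv => /psi0.
  rewrite -restrict_EFin.
  exact: ((@integrable_mkcond _ _ _ mu _ (EFin \o psi) (measurable_itv _)).1
    (bmeas_integrable (lexx 0) (lexx 1) bpsi)).
pose phi x := \int[mu]_(t in `]-oo, x]) psi t.
have dphi x : derivable phi x 1 /\ derive1 phi x = psi x.
  apply: (@continuous_FTC1 _ psi -oo%O x (x + 1)) => //.
  - by rewrite ltrDl.
  - by apply: integrableS ipsi.
  - by rewrite /= ltNyr.
  - exact: cpsi.
have e : derive1n 1 phi = psi by apply/funext => x; rewrite derive1n1 (dphi x).2.
exists phi => //; split.
  case=> [|n] x; first exact: (dphi x).1.
  by rewrite derive1Sn -derive1n1 e; exact: d.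
exists a, b; split => // x xab.
have [xa|ax] := ltP x a.
  rewrite /phi (_ : Rintegral _ _ _ = \int[mu]_(t in `]-oo, x]) (cst 0) t); last first.
    apply: eq_Rintegral => t; rewrite inE/= in_itv/= => tx; apply: sup.
    by rewrite in_itv/= leNgt (le_lt_trans tx).
  by rewrite Rintegral_cst ?mul0r//; exact: measurable_itv.
have bx : b < x by move: xab; rewrite in_itv/= ax/= ltNge.
have -> : phi x = \int[mu]_(t in `]-oo, x] `&` `[0, 1]) psi t.
  rewrite Rintegral_mkcondr; apply: eq_Rintegral => t _; rewrite patchE.
  by case: ifPn => //; rewrite mem_setE in_itv => /psi0.
have -> : \int[mu]_(t in `]-oo, x] `&` `[0, 1]) psi t = \int[mu]_(t in `[0, 1] `&` `]-oo, x]) psi t.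
  by rewrite setIC.
rewrite -[RHS]i0 /integ Rintegral_mkcondr; apply: eq_Rintegral => t _; rewrite patchE.
case: ifPn => //; rewrite mem_setE in_itv/= -ltNge => xt; apply/esym/sup.
by rewrite in_itv/= [t <= b]leNgt (lt_trans bx xt) andbF.
Qed.

(** Let [Q0] be the primitive of the truncated [q]. Then [p - Q0] is orthogonal to derivatives of
    test functions, that is, to test functions of mean zero. Any test function becomes one after
    subtracting a multiple of a fixed bump [eta], so [p - Q0] is constant almost everywhere. *)
Lemma du_bois_reymond p q M : 0 <= M -> weak_deriv 1 p q ->
  {ae mu, forall x, I x -> `|q x| <= M} ->
  exists Q q', [/\ antider Q q', forall x, `|q' x| <= M,
    {ae mu, forall x, I x -> q' x = q x} & {ae mu, forall x, I x -> p x = Q x}].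
Proof.
move=> M0 [lp lq hpq] qM.
pose q' x := trunc_at M (q x).
have q'q : {ae mu, forall x, I x -> q' x = q x}.
  by apply: (ae_imp qM) => x h /h; exact: trunc_at_id.
have q'M x : `|q' x| <= M by exact: trunc_at_norm.
have bq' : bmeas q'.
  split; last by exists M.
  have mq := locally_integrable_measurable lq.
  by apply: measurable_maxr => //; apply: measurable_minr.
pose Q0 x := integ 0 x q'.
have aQ : antider Q0 q' by exact: antider_integ.
have bQ := antider_bmeas aQ.
have lQ := bmeas_locally_integrable bQ.
have key phi : test_function phi -> \int[mu]_(r in `]0, 1[) ((p r - Q0 r) * derive1n 1 phi r) = 0.
  move=> tphi; have t1 := test_derive1n 1 tphi.
  under eq_Rintegral do rewrite mulrBl.
  rewrite RintegralB//; [|exact: locally_integrable_test..].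
  have [_ _ /(_ _ tphi) ->] := antider_weak_deriv aQ.
  rewrite hpq// -mulrBr; apply/eqP; rewrite mulf_eq0 subr_eq0; apply/orP; right; apply/eqP.
  rewrite /Rintegral; congr fine; apply: ae_eq_integral => //.
  - by have := locally_integrable_test lq tphi; move=> /integrableP[].
  - by have := locally_integrable_test (bmeas_locally_integrable bq') tphi; move=> /integrableP[].
  - apply: (ae_imp q'q) => x h /= xI; rewrite h//.
    by move: xI; rewrite unit_intervalE in_itv/= => /andP[? ?]; rewrite !ltW.
have lpQ : locally_integrable `]0, 1[ (fun r => p r - Q0 r).
  split; [|exact: itv_open|].
    by apply: measurable_funB; [case: lp|case: lQ].
  move=> K KI cK.
  have i1 : mu.-integrable K (EFin \o p).
    apply/integrableP; split; last by case: lp => _ _; exact.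
    apply/measurable_EFinP; case: lp => m1 _ _.
    by apply: measurable_funS m1 => //; exact: measurable_itv.
  have i2 : mu.-integrable K (EFin \o Q0).
    apply/integrableP; split; last by case: lQ => _ _; exact.
    apply/measurable_EFinP; case: lQ => m2 _ _.
    by apply: measurable_funS m2 => //; exact: measurable_itv.
  have := @integrableB _ _ _ mu K (compact_measurable cK) _ _ i1 i2.
  by move=> /integrableP[_].
have h14 : (1/4 : R) <= 3/4 by lra.
have teta := smooth_bump_test_function (n := 1) h14 isT ltac:(lra) ltac:(lra).
set eta := smooth_bump _ _ _ in teta.
have beta := test_bmeas teta.
pose ie := integ 0 1 eta.
have ie0 : ie != 0.
  apply/eqP => ie0.
  have b0 x : 0 <= eta x by case/andP: (smooth_bump_ge0_le1 x h14 (ltn0Sn 0)).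
  (* Both factors [x - 1/4] and [3/4 - x] are at least 1/8 here, so the exponent is at least -64. *)
  have b1 x : 3/8 <= x <= 5/8 -> expR (- 64) <= eta x.
    move=> /andP[x1 x2]; rewrite /eta smooth_bumpE//.
    have -> : 1 / 4 < x < 3 / 4 by apply/andP; split; lra.
    rewrite ler_expR lerN2 mul1r -[leRHS]invrK lef_pV2 ?posrE ?invr_gt0//; last nra.
    by rewrite -div1r ler_pdivrMr//; nra.
  have l0 : (0 : R) <= 3/8 by lra.
  have l1 : (5/8 : R) <= 1 by lra.
  have := integ_ge0 (a := 0) (b := 3/8) (f := eta) (fun x _ => b0 x).
  have := integ_ge0 (a := 5/8) (b := 1) (f := eta) (fun x _ => b0 x).
  have := integ_le l0 l1 (bmeas_cst (expR (-64))) beta (fun x h => b1 x h).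
  rewrite integ_cst//; last by lra.
  move: ie0; rewrite /ie (integ_cat (lexx 0) (lexx 1) beta (c := 3/8)); last by apply/andP; split; lra.
  rewrite (integ_cat l0 (lexx 1) beta (c := 5/8)); last by apply/andP; split; lra.
  have := expR_gt0 (- 64 : R).
  by move=> *; lra.
pose c := (\int[mu]_(r in `]0, 1[) ((p r - Q0 r) * eta r)) / ie.
exists (fun x => Q0 x + c), q'; split => //.
  have := antiderD aQ (antider_cst c); congr antider; apply/funext => x.
  by rewrite addr0.
have lpQc : locally_integrable `]0, 1[ (fun r => p r - Q0 r - c).
  split; [|exact: itv_open|].
    by apply: measurable_funB => //; case: lpQ.
  move=> K KI cK.
  have i1 : mu.-integrable K (EFin \o (fun r => p r - Q0 r)).
    apply/integrableP; split; last by case: lpQ => _ _; exact.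
    apply/measurable_EFinP; case: lpQ => m1 _ _.
    by apply: measurable_funS m1 => //; exact: measurable_itv.
  have i2 : mu.-integrable K (EFin \o (fun=> c)).
    by apply: integrableS (integrable_oo (bmeas_cst c)) => //; exact: compact_measurable.
  have := @integrableB _ _ _ mu K (compact_measurable cK) _ _ i1 i2.
  by move=> /integrableP[_].
have := fundamental_lemma lpQc; set X := (X in (X -> _) -> _); move=> H.
suff /H {}H : X.
  apply: (ae_imp H) => x Hx xI; move: (Hx xI) => e; lra.
move=> psi tpsi.
have bpsi := test_bmeas tpsi.
pose k := integ 0 1 psi / ie.
have tk := test_lin k tpsi teta.
have [|phi tphi dphi] := test_primitive tk.
  rewrite integB ?integZ ?lexx ?ler01//; last exact: bmeasZ.
  by rewrite /k divfK// subrr.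
have := key _ tphi; rewrite dphi.
have i1 := locally_integrable_test lpQ tpsi.
have i2 := locally_integrable_test lpQ teta.
have i3 := locally_integrable_test (bmeas_locally_integrable (bmeas_cst c)) tpsi.
have mI : measurable (`]0, 1[ : set R) by exact: measurable_itv.
have -> : \int[mu]_(r in `]0, 1[) ((p r - Q0 r) * (psi r - k * eta r)) =
  \int[mu]_(r in `]0, 1[) ((p r - Q0 r) * psi r) - k * \int[mu]_(r in `]0, 1[) ((p r - Q0 r) * eta r).
  rewrite -RintegralZl// -RintegralB//; last exact: (integrableZl _ _ i2).
  by apply: eq_Rintegral => r _; ring.
have -> : \int[mu]_(r in `]0, 1[) ((p r - Q0 r - c) * psi r) =
  \int[mu]_(r in `]0, 1[) ((p r - Q0 r) * psi r) - c * integ 0 1 psi.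
  rewrite -integ01E// -RintegralZl//; last exact: integrable_oo.
  rewrite -RintegralB//; apply: eq_Rintegral => r _; ring.
move=> e; rewrite /c -{}[RHS]e; congr (_ - _); rewrite /k.
by field.
Qed.

End WeakDerivatives.

(** * From bounded weak derivatives to a chain of Lipschitz functions *)

Section ClassicalRegularity.
Context {R : realType}.
Implicit Types (f g p q v w : R -> R) (a b x y M : R) (n i k : nat).
Local Notation mu := (@lebesgue_measure R).
Local Notation I := (@unit_interval R).

Lemma ae_dense (P : R -> Prop) a b : {ae mu, forall x, P x} -> a < b -> exists2 x, a < x < b & P x.
Proof.
move=> [N [mN N0 NP]] ab; apply/not_exists2P => H.
have sub : `]a, b[ `<=` N.
  by move=> x /= xab; apply: NP => /= Px; case: (H x); rewrite ?Px -?in_itv//; exact.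
have : (mu `]a, b[ <= 0)%E.
  by rewrite -N0; apply: le_measure => //; rewrite inE//; exact: measurable_itv.
by rewrite lebesgue_measure_itv/= lte_fin ab -EFinB lee_fin subr_le0 leNgt ab.
Qed.

Lemma ae_le_continuous f c : {within I, continuous f} -> {ae mu, forall x, I x -> f x <= c} ->
  forall x, 0 <= x <= 1 -> f x <= c.
Proof.
move=> cf ae x x01; rewrite leNgt; apply/negP => cfx.
have xI : I x by rewrite unit_intervalE.
have /subspace_continuousP/(_ x xI) := cf.
move=> /cvgrPdist_lt/(_ (f x - c)).
rewrite subr_gt0 => /(_ cfx); rewrite near_withinE => /nbhs_ballP[e /= e0 He].
have [a [b [ab sub]]] : exists a b, a < b /\ forall y, a < y < b -> 0 <= y <= 1 /\ `|x - y| < e.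
  case/andP: x01 => x0 x1.
  have [x2|x2] := leP x (1/2).
    exists x, (x + Num.min e (1/2)); split; first by rewrite ltrDl lt_min e0; lra.
    move=> y /andP[xy yx]; have : y - x < Num.min e (1/2) by lra.
    rewrite lt_min => /andP[h1 h2]; split; first by apply/andP; split; lra.
    by rewrite ltr0_norm; lra.
  exists (x - Num.min e (1/2)), x; split; first by rewrite ltrBlDr ltrDl lt_min e0; lra.
  move=> y /andP[xy yx]; have : x - y < Num.min e (1/2) by lra.
  rewrite lt_min => /andP[h1 h2]; split; first by apply/andP; split; lra.
  by rewrite gtr0_norm; lra.
have [y yab fy] := ae_dense ae ab.
have [y01 yx] := sub _ yab.
have yI : I y by rewrite unit_intervalE.
have h1 := fy yI; have h2 : `|f x - f y| < f x - c := He y yx yI.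
by have := ler_norm (f x - f y); lra.
Qed.

Lemma ae_eq_continuous f g : {within I, continuous f} -> {within I, continuous g} ->
  {ae mu, forall x, I x -> f x = g x} -> forall x, 0 <= x <= 1 -> f x = g x.
Proof.
move=> cf cg e x x01.
have H f' g' : {within I, continuous f'} -> {within I, continuous g'} ->
    {ae mu, forall x, I x -> f' x = g' x} -> f' x <= g' x.
  move=> c1 c2 e'; rewrite -subr_le0.
  apply: (@ae_le_continuous (fun z => f' z - g' z)) => //.
    by move=> z; apply: continuousB; [exact: c1|exact: c2].
  by apply: (ae_imp e') => z h /h ->; rewrite subrr.
apply/eqP; rewrite eq_le !H//.
by apply: (ae_imp e) => z h /h ->.
Qed.

Lemma normLoo_ae v M : (normL +oo v <= M%:E)%E -> {ae mu, forall x, I x -> `|v x| <= M}.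
Proof.
have muT : (0 < mu setT)%E.
  apply: (@lt_le_trans _ _ (mu `[0%R, 1%R])).
    by rewrite lebesgue_measure_itv/= lte_fin ltr01 -EFinB lte_fin subr0.
  apply: le_measure; [|exact: mem_set|exact: subsetT].
  by apply: mem_set; exact: measurable_itv.
rewrite /normL unlock /Lnorm muT => /ess_supP h.
apply: (ae_imp h) => x /= + xI; rewrite lee_fin patchE mem_set//.
Qed.

Lemma normWoo_ae m v M i : (normWoo m v <= M%:E)%E -> (i <= m)%N ->
  {ae mu, forall x, I x -> `|wD i v x| <= M}.
Proof.
move=> h im; apply: normLoo_ae; apply: le_trans h; rewrite /normWoo.
have im' : (i < m.+1)%N by [].
rewrite (bigD1 (Ordinal im'))//= leeDl//; apply: sume_ge0 => j _.
exact: Lnorm_ge0.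
Qed.

Lemma weak_deriv0 v : {within I, continuous v} -> weak_deriv 0 v v.
Proof.
move=> cv; have lv := bmeas_locally_integrable (within_continuous_bmeas cv).
by split => // phi tphi; rewrite expr0 mul1r.
Qed.

(** [Q i] represents the i-th derivative at every point. All but the last, [Q k.+1], are Lipschitz,
    which encodes W^{k+1}_oo regularity without exceptional sets. *)
Definition smooth_chain k M v (Q : nat -> R -> R) :=
  [/\ forall x, 0 <= x <= 1 -> Q 0%N x = v x,
      forall i, (i <= k)%N -> antider (Q i) (Q i.+1) &
      forall i x, (1 <= i <= k.+1)%N -> 0 <= x <= 1 -> `|Q i x| <= M].

(** Each pair of successive weak derivatives is regularized by [du_bois_reymond]. The bounded
    function of one pair and the Lipschitz function of the next agree almost everywhere, which
    suffices under an integral; almost everywhere bounds extend to all points by continuity. *)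
Lemma sobolev_chain k M v : 0 <= M -> {within I, continuous v} -> sobolev k.+1 +oo v ->
  (normWoo k.+1 v <= M%:E)%E -> exists Q, smooth_chain k M v Q.
Proof.
move=> M0 cv sv nv.
have wv i : (i <= k.+1)%N -> weak_deriv i v (wD i v).
  by move=> ik; have [[g /wDP]] := sv i ik.
have aeM i : (i <= k.+1)%N -> {ae mu, forall x, I x -> `|wD i v x| <= M} by exact: normWoo_ae nv.
have /choice[P HP] : forall i, exists Qq : (R -> R) * (R -> R), (i <= k)%N ->
    [/\ antider Qq.1 Qq.2, forall x, `|Qq.2 x| <= M,
      {ae mu, forall x, I x -> Qq.2 x = wD i.+1 v x} & {ae mu, forall x, I x -> wD i v x = Qq.1 x}].
  move=> i; have [ik|ik] := leqP i k; last by exists (v, v).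
  have wc := weak_deriv_chain (wv i (leqW ik)) (wv i.+1 ik).
  have [Q [q' h]] := du_bois_reymond M0 wc (aeM i.+1 ik).
  by exists (Q, q').
(* Order k + 1 starts no pair; it is represented by the bounded derivative belonging to the last
   pair. *)
pose Q i := if (i <= k)%N then (P i).1 else (P k).2.
have QwD i : (i <= k.+1)%N -> {ae mu, forall x, I x -> Q i x = wD i v x}.
  rewrite leq_eqVlt => /orP[/eqP ->|ik].
    by rewrite /Q ltnn; have [_ _ + _] := HP k (leqnn k).
  rewrite /Q -ltnS ik; have [_ _ _ h] := HP i ik.
  by apply: (ae_imp h) => x hx /hx.
have cQ i : (i <= k)%N -> {within I, continuous (Q i)}.
  by move=> ik; rewrite /Q ik; have [h _ _ _] := HP i ik; exact: antider_continuous h.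
exists Q; split.
- apply: ae_eq_continuous => //; first exact: cQ.
  have h1 := QwD 0%N isT.
  have h2 := weak_deriv_unique (wv 0%N isT) (weak_deriv0 cv).
  apply: (ae_imp (ae_and h1 h2)) => x [h3 h4] xI.
  by rewrite h3// h4.
- move=> i ik.
  have [ai _ qi _] := HP i ik.
  have Qi : Q i = (P i).1 by rewrite /Q ik.
  have bQ : bmeas (Q i.+1).
    rewrite /Q; case: ltnP => ik'; last first.
      by have [[]] := HP k (leqnn k).
    by have [h _ _ _] := HP i.+1 ik'; exact: antider_bmeas h.
  split => // a b a0 ab b1; rewrite Qi (ai.2 _ _ a0 ab b1).
  apply: eq_integ_ae => //; [by case: ai => -[]|by case: bQ|].
  apply: (ae_imp (ae_and qi (QwD i.+1 ik))) => x [h3 h4] xI.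
  by rewrite h3// h4.
- move=> i x /andP[i1 ik] x01; move: (ik); rewrite leq_eqVlt => /orP[/eqP ->|ik'].
    by rewrite /Q ltnn; have [_ + _ _] := HP k (leqnn k); exact.
  have H : {ae mu, forall x, I x -> Q i x <= M}.
    apply: (ae_imp (ae_and (QwD i ik) (aeM i ik))) => y [h1 h2] yI.
    by rewrite h1//; apply: (le_trans (ler_norm _)); exact: h2.
  have H' : {ae mu, forall x, I x -> - Q i x <= M}.
    apply: (ae_imp (ae_and (QwD i ik) (aeM i ik))) => y [h1 h2] yI.
    by rewrite h1//; apply: (le_trans (ler_norm _)); rewrite normrN; exact: h2.
  rewrite ler_norml (ae_le_continuous (cQ i ik') H x01) andbT lerNl.
  apply: (@ae_le_continuous (fun z => - Q i z)) => //.
  by move=> z; apply: continuousN; exact: (cQ i ik').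
Qed.

Definition prim_poly (p : {poly R}) : {poly R} :=
  \poly_(i < (size p).+1) (if i is j.+1 then p`_j / i%:R else 0).

Lemma deriv_prim_poly (p : {poly R}) : (prim_poly p)^`() = p.
Proof.
apply/polyP => i; rewrite coef_deriv coef_poly ltnS.
case: ltnP => ip; last by rewrite mul0rn nth_default.
by rewrite -[LHS]mulr_natr divfK// pnatr_eq0.
Qed.

Lemma size_prim_poly (p : {poly R}) : (size (prim_poly p) <= (size p).+1)%N.
Proof. exact: size_poly. Qed.

(** Start from the zero polynomial for the derivative of order k + 1, which is at most [M], and
    integrate k times from the left end: each integration raises the degree by one and multiplies
    the error by [b - a]. *)
Lemma chain_poly_approx k M v Q a b : smooth_chain k M v Q -> 0 <= a -> a <= b -> b <= 1 ->
  exists2 p : {poly R}, (size p <= k)%N &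
    forall x, a <= x <= b -> `|Q 1%N x - p.[x]| <= M * (b - a) ^+ k.
Proof.
move=> [_ aQ QM] a0 ab b1.
have M0 : 0 <= M by apply: le_trans (QM 1%N 0 _ _); rewrite ?lexx ?ler01.
suff H j : (j <= k)%N -> exists2 p : {poly R}, (size p <= j)%N &
    forall x, a <= x <= b -> `|Q (k.+1 - j)%N x - p.[x]| <= M * (b - a) ^+ j.
  by have := H k (leqnn k); rewrite subSn// subnn.
elim: j => [_|j ih jk].
  exists 0; first by rewrite size_poly0.
  move=> x /andP[ax xb]; rewrite horner0 subr0 expr0 mulr1 subn0 QM ?leqnn//.
  by rewrite (le_trans a0)//= (le_trans xb).
have [p sp hp] := ih (ltnW jk).
have e : (k.+1 - j = (k.+1 - j.+1).+1)%N by rewrite subnSK// leqW.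
exists (prim_poly p + (Q (k.+1 - j.+1)%N a - (prim_poly p).[a])%:P).
  rewrite (leq_trans (size_polyD _ _))// geq_max.
  rewrite (leq_trans (size_prim_poly _))//= (leq_trans (size_polyC_leq1 _))//.
move=> x /andP[ax xb]; rewrite hornerD hornerC.
have ai : antider (fun z => Q (k.+1 - j.+1)%N z - (prim_poly p).[z]) (fun z => Q (k.+1 - j)%N z - p.[z]).
  rewrite e; apply: antiderB; first by apply: aQ; rewrite subSS leq_subr.
  by have := antider_poly (prim_poly p); rewrite deriv_prim_poly.
have := antider_bound ai a0 ax (le_trans xb b1) (K := M * (b - a) ^+ j).
set X := (X in (X -> _) -> _) => h.
have /h {h} : X.
  by move=> z /andP[az zx]; apply: hp; rewrite az (le_trans zx).
rewrite (_ : _ - _ - _ = Q (k.+1 - j.+1)%N x - ((prim_poly p).[x] +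
   (Q (k.+1 - j.+1)%N a - (prim_poly p).[a]))); last by ring.
move=> h; apply: (le_trans h); rewrite exprSr mulrA.
apply: ler_wpM2l; last by lra.
by rewrite mulr_ge0// exprn_ge0// subr_ge0.
Qed.

End ClassicalRegularity.

(** * Semidefinite forms and discrete parabolic smoothing *)

Section Forms.
Context {R : realType} {V : lmodType R}.
Implicit Types (S : V -> Prop) (B m a : V -> V -> R) (L : V -> R) (u v w x : V).

Definition subsp S := S 0 /\ forall c v w, S v -> S w -> S (c *: v + w).

Definition lin_on S L := forall c v w, S v -> S w -> L (c *: v + w) = c * L v + L w.

(** Forms are only semidefinite because functions are total: a function vanishing on [0,1] is a null
    vector without being zero. *)
Record psd_form S B : Prop := {
  psd_sym : forall v w, S v -> S w -> B v w = B w v;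
  psd_lin : forall w, S w -> lin_on S (B^~ w);
  psd_ge0 : forall v, S v -> 0 <= B v v }.

Lemma subspD S v w : subsp S -> S v -> S w -> S (v + w).
Proof. by move=> [_ h] sv sw; have := h 1 v w sv sw; rewrite scale1r. Qed.

Lemma subspZ S c v : subsp S -> S v -> S (c *: v).
Proof. by move=> [s0 h] sv; have := h c v 0 sv s0; rewrite addr0. Qed.

Lemma subspB S v w : subsp S -> S v -> S w -> S (v - w).
Proof. by move=> [_ h] sv sw; have := h (-1) w v sw sv; rewrite scaleN1r addrC. Qed.

Section on_S.
Variables (S : V -> Prop).
Hypothesis sS : subsp S.

Lemma lin_on0 L : lin_on S L -> L 0 = 0.
Proof.
case: (sS) => s0 _ lL; have := lL 1 0 0 s0 s0.
by rewrite scale1r addr0 mul1r => e; lra.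
Qed.

Lemma lin_onD L v w : lin_on S L -> S v -> S w -> L (v + w) = L v + L w.
Proof. by move=> lL sv sw; have := lL 1 v w sv sw; rewrite scale1r mul1r. Qed.

Lemma lin_onZ L c v : lin_on S L -> S v -> L (c *: v) = c * L v.
Proof.
by move=> lL sv; have := lL c v 0 sv sS.1; rewrite addr0 (lin_on0 lL) addr0.
Qed.

Lemma lin_onB L v w : lin_on S L -> S v -> S w -> L (v - w) = L v - L w.
Proof. by move=> lL sv sw; have := lL (-1) w v sw sv; rewrite scaleN1r [- w + v]addrC mulN1r [- L w + _]addrC. Qed.

Variable B : V -> V -> R.
Hypothesis fB : psd_form S B.

Lemma psd_linr v : S v -> lin_on S (B v).
Proof.
move=> sv c w z sw sz; rewrite !(psd_sym fB sv)//; last exact: sS.2.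
exact: (psd_lin fB).
Qed.

Lemma psdBl u v w : S u -> S v -> S w -> B (u - v) w = B u w - B v w.
Proof. by move=> su sv sw; apply: (lin_onB (psd_lin fB sw)). Qed.

Lemma psdBr u v w : S u -> S v -> S w -> B w (u - v) = B w u - B w v.
Proof. by move=> su sv sw; apply: (lin_onB (psd_linr sw)). Qed.

Lemma psdZl c v w : S v -> S w -> B (c *: v) w = c * B v w.
Proof. by move=> sv sw; apply: (lin_onZ _ (psd_lin fB sw)). Qed.

Lemma psdZr c v w : S v -> S w -> B v (c *: w) = c * B v w.
Proof. by move=> sv sw; apply: (lin_onZ _ (psd_linr sv)). Qed.

Lemma psd_sqrB v w : S v -> S w -> B (v - w) (v - w) = B v v - 2 * B v w + B w w.
Proof.
move=> sv sw; have svw := subspB sS sv sw.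
by rewrite psdBl// !psdBr// (psd_sym fB sw sv); ring.
Qed.

Lemma psd_CS v w : S v -> S w -> B v w ^+ 2 <= B v v * B w w.
Proof.
move=> sv sw.
have H t : 0 <= B v v - 2 * t * B v w + t ^+ 2 * B w w.
  have stw := subspZ t sS sw.
  have := psd_ge0 fB (subspB sS sv stw).
  rewrite psd_sqrB// !psdZr// psdZl//.
  by congr (0 <= _); ring.
have b0 := psd_ge0 fB sv; have c0 := psd_ge0 fB sw.
have [c1|c1] := eqVneq (B w w) 0.
  (* For [B w w = 0] the quadratic is affine in t; unless [B v w = 0], it takes the negative value
     [- B v v - 2] at this t. *)
  have := H ((B v v + 1) / B v w); rewrite c1 mulr0 addr0 mulr0.
  have [->|n0] := eqVneq (B v w) 0; first by rewrite expr0n.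
  by rewrite -mulrA divfK// => h; exfalso; lra.
have cp : 0 < B w w by rewrite lt_neqAle eq_sym c1.
have := H (B v w / B w w).
rewrite (_ : _ + _ = (B v v * B w w - B v w ^+ 2) / B w w); last by field.
by rewrite pmulr_lge0 ?invr_gt0// subr_ge0.
Qed.

Lemma psd_CS_sqrt v w : S v -> S w -> `|B v w| <= Num.sqrt (B v v) * Num.sqrt (B w w).
Proof.
move=> sv sw; rewrite -sqrtrM ?(psd_ge0 fB)// -sqrtr_sqr ler_wsqrtr//.
exact: psd_CS.
Qed.

End on_S.

Lemma psd_sub (S S' : V -> Prop) B : (forall v, S v -> S' v) ->
  psd_form S' B -> psd_form S B.
Proof.
move=> SS' [h1 h2 h3]; split.
- by move=> v w /SS' ? /SS' ?; exact: h1.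
- by move=> w /SS' sw c u v /SS' ? /SS' ?; exact: h2.
- by move=> v /SS'; exact: h3.
Qed.

Lemma psd_add S B C (t : R) : 0 <= t -> psd_form S B -> psd_form S C ->
  psd_form S (fun v w => B v w + t * C v w).
Proof.
move=> t0 fB fC; split.
- by move=> v w sv sw; rewrite (psd_sym fB)// (psd_sym fC).
- move=> w sw c u v su sv /=.
  by have /= -> := psd_lin fB sw c su sv; have /= -> := psd_lin fC sw c su sv; ring.
- by move=> v sv; rewrite addr_ge0 ?mulr_ge0 ?(psd_ge0 fB) ?(psd_ge0 fC).
Qed.

Lemma psd_null S B v w : subsp S -> psd_form S B -> S v -> S w -> B w w = 0 -> B v w = 0.
Proof.
move=> sS fB sv sw w0; have := psd_CS sS fB sv sw; rewrite w0 mulr0 => h.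
by apply/eqP; rewrite -sqrf_eq0; apply/eqP/le_anti; rewrite h sqr_ge0.
Qed.

(* Finite dimensionality enters only through [n] functionals that separate the points of [S]. *)
Lemma riesz S B n (ev : nat -> V -> R) : subsp S -> psd_form S B ->
  (forall i, lin_on S (ev i)) ->
  (forall v, S v -> (forall i, (i < n)%N -> ev i v = 0) -> B v v = 0) ->
  forall L, lin_on S L -> (forall v, S v -> B v v = 0 -> L v = 0) ->
  exists2 x, S x & forall v, S v -> B x v = L v.
Proof.
elim: n S => [|n ih] S sS fB lev null L lL L0.
  exists 0; first exact: sS.1.
  move=> v sv; rewrite (lin_on0 sS (psd_lin fB sv)) (L0 v sv)//.
  exact: null.
pose S' v := S v /\ ev n v = 0.
have S'S v : S' v -> S v by case.
have sS' : subsp S'.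
  split; first by split; [exact: sS.1|exact: (lin_on0 sS (lev n))].
  move=> c v w [sv ev0] [sw ew0]; split; first exact: sS.2.
  by rewrite lev// ev0 ew0 mulr0 addr0.
have sub (L' : V -> R) : lin_on S L' -> lin_on S' L' by move=> h c v w [? _] [? _]; exact: h.
have fB' : psd_form S' B.
  split; [by move=> v w [? _] [? _]; exact: (psd_sym fB)|by move=> w [? _]; apply: sub; exact: (psd_lin fB)|].
  by move=> v [? _]; exact: (psd_ge0 fB).
have null' v : S' v -> (forall i, (i < n)%N -> ev i v = 0) -> B v v = 0.
  move=> [sv evn] h; apply: null => // i; rewrite ltnS leq_eqVlt => /orP[/eqP ->//|]; exact: h.
have IH L' : lin_on S L' -> (forall v, S v -> B v v = 0 -> L' v = 0) ->
    exists2 x, S' x & forall v, S' v -> B x v = L' v.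
  move=> h1 h2; apply: (ih S') => //; [by move=> i; exact: sub|exact: sub|].
  by move=> v [sv _]; exact: h2.
have [xL sxL hxL] := IH L lL L0.
have [alln|] := pselect (forall v, S v -> ev n v = 0).
  exists xL; first exact: S'S.
  by move=> v sv; apply: hxL; split => //; exact: alln.
move=> /existsNP[v1 /not_implyP[sv1 /eqP ev1]].
pose v0 := (ev n v1)^-1 *: v1.
have sv0 : S v0 by exact: subspZ.
have ev0 : ev n v0 = 1 by rewrite (lin_onZ sS _ (lev n))// mulVf.
have [x' sx' hx'] := IH (B v0) (psd_linr sS fB sv0)
   (fun v sv => psd_null sS fB sv0 sv).
(* [x'] is the projection of [v0] to the kernel [S'] of the last functional, so [w0] is orthogonal
   to [S'] and spans [S] modulo it. If [w0] is a null vector, [L] kills it by hypothesis and the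
   solution on [S'] already works. *)
pose w0 := v0 - x'.
have sw0 : S w0 by apply: subspB => //; exact: S'S.
have ew0 : ev n w0 = 1 by rewrite (lin_onB (lev n))//; [rewrite ev0 sx'.2 subr0|exact: S'S].
have bw0 v : S' v -> B w0 v = 0.
  by move=> sv; rewrite (psdBl fB)//; [rewrite hx'// subrr|exact: S'S..].
have dec v : S v -> S' (v - ev n v *: w0).
  move=> sv; split; first by apply: subspB => //; exact: subspZ.
  rewrite (lin_onB (lev n))//; last exact: subspZ.
  by rewrite (lin_onZ sS _ (lev n))// ew0 mulr1 subrr.
have dec2 (L' : V -> R) v : lin_on S L' -> S v -> L' v = L' (v - ev n v *: w0) + ev n v * L' w0.
  move=> h sv; rewrite (lin_onB h)//; last exact: subspZ.
  by rewrite (lin_onZ sS _ h)// subrK.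
have bxw : B xL w0 = 0 by rewrite (psd_sym fB)//; [exact: bw0|exact: S'S].
have [bw|bw] := eqVneq (B w0 w0) 0.
  exists xL; first exact: S'S.
  move=> v sv; rewrite (dec2 L v lL sv) (dec2 (B xL) v (psd_linr sS fB (S'S _ sxL)) sv).
  by rewrite bxw (L0 w0)// !mulr0 !addr0 hxL//; exact: dec.
have sxL' := S'S _ sxL.
have sx : S ((L w0 / B w0 w0) *: w0 + xL) by exact: sS.2.
exists ((L w0 / B w0 w0) *: w0 + xL) => // v sv.
rewrite (dec2 L v lL sv) (dec2 (B _) v (psd_linr sS fB sx) sv).
have sd := S'S _ (dec v sv).
have /= -> := psd_lin fB sd (L w0 / B w0 w0) sw0 sxL'.
have /= -> := psd_lin fB sw0 (L w0 / B w0 w0) sw0 sxL'.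
rewrite (bw0 _ (dec v sv)) bxw mulr0 add0r addr0 hxL; last exact: dec.
by rewrite divfK.
Qed.

Section ParabolicSmoothing.
Variables (S : V -> Prop) (m a : V -> V -> R) (kap tau : R).
Hypotheses (sS : subsp S) (fm : psd_form S m) (fa : psd_form S a).
Hypotheses (kap0 : 0 < kap) (tau0 : 0 < tau).
Hypothesis inv_ineq : forall v, S v -> a v v <= kap ^+ 2 * m v v.
Hypothesis solve_m : forall psi, S psi -> exists2 x, S x & forall v, S v -> m x v = a psi v.
Hypothesis solve_step : forall x, S x ->
  exists2 y, S y & forall v, S v -> m y v + tau * a y v = m x v.

(* With A the operator of the form [a] in the inner product [m], [X i] is (1 + tau A)^-i A psi.  Energy
   estimates with weights t_i and t_i^2 bound its increments without a logarithm of the mesh size. *)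
Lemma smoothing_seq psi : S psi -> exists X : nat -> V, [/\ forall i, S (X i),
  forall v, S v -> m (X 0%N) v = a psi v,
  forall i v, S v -> m (X i.+1 - X i) v = - tau * a (X i.+1) v &
  forall n, \sum_(i < n) Num.sqrt (m (X i.+1 - X i) (X i.+1 - X i)) <=
    4 * kap * Num.sqrt (a psi psi) /\ m (X n) (X n) <= kap ^+ 2 * a psi psi].
Proof.
move=> spsi; have [X0 sX0 hX0] := solve_m spsi.
have [step hstep] : exists step : V -> V, forall x, S x ->
    S (step x) /\ forall v, S v -> m (step x) v + tau * a (step x) v = m x v.
  have /choice[step h] : forall x, exists y, S x -> S y /\
      forall v, S v -> m y v + tau * a y v = m x v.
    move=> x; have [sx|sx] := pselect (S x); last by exists 0.
    by have [y sy hy] := solve_step sx; exists y.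
  by exists step => x; exact: h.
pose Y i := iter i step psi.
have sY i : S (Y i) by elim: i => [//|i ih]; rewrite /Y iterS; exact: (hstep _ ih).1.
have hY i v : S v -> m (Y i.+1) v + tau * a (Y i.+1) v = m (Y i) v.
  by move=> sv; rewrite /Y iterS; apply: (hstep _ (sY i)).2.
(* [X i] is [A (Y i)]; for i > 0 the step equation gives it as a difference quotient, so that only
   [A psi] has to be solved for. *)
pose X i := if i is j.+1 then tau^-1 *: (Y j - Y j.+1) else X0.
have sX i : S (X i).
  by case: i => [//|i]; apply: subspZ => //; exact: subspB.
have F0 i v : S v -> m (X i) v = a (Y i) v.
  case: i => [|i] sv; first exact: hX0.
  rewrite /X (psdZl sS fm)//; last exact: subspB.
  rewrite (psdBl fm)// -(hY i v sv); field.
  by rewrite gt_eqF.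
have sXX i : S (X i.+1 - X i) by exact: subspB.
have F1 i v : S v -> m (X i.+1 - X i) v = - tau * a (X i.+1) v.
  move=> sv; rewrite (psdBl fm)// !F0// /X (psdZl sS fa)//; last exact: subspB.
  by rewrite (psdBl fa)//; field; rewrite gt_eqF.
pose x i := m (X i) (X i); pose y i := a (Y i) (Y i); pose z i := a (X i) (X i).
pose d i := m (X i.+1 - X i) (X i.+1 - X i).
have x0 i : 0 <= x i by exact: (psd_ge0 fm).
have y0 i : 0 <= y i by exact: (psd_ge0 fa).
have z0 i : 0 <= z i by exact: (psd_ge0 fa).
have d0 i : 0 <= d i by exact: (psd_ge0 fm).
have E1 i : y i.+1 + 2 * tau * x i.+1 <= y i.
  have h1 := psd_ge0 fa (subspB sS (sY i.+1) (sY i)).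
  rewrite (psd_sqrB sS fa)// in h1.
  have h2 : a (Y i.+1) (Y i.+1) - a (Y i.+1) (Y i) = - tau * x i.+1.
    rewrite /x (F0 i.+1)// /X (psdZr sS fa)//; last exact: subspB.
    by rewrite (psdBr sS fa)//; field; rewrite gt_eqF.
  by rewrite /y; lra.
have E2 i : x i.+1 + 2 * tau * z i.+1 <= x i.
  have h1 := d0 i; have := F1 i _ (sX i.+1).
  rewrite /d (psd_sqrB sS fm)// in h1; rewrite (psdBl fm)// (psd_sym fm (sX i))// => h2.
  by rewrite /x /z; lra.
have E3 i : 2 * d i <= tau * (z i - z i.+1).
  have h1 := psd_ge0 fa (sXX i).
  rewrite (psd_sqrB sS fa)// in h1.
  have h2 : d i = - tau * (z i.+1 - a (X i.+1) (X i)).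
    by rewrite /d F1// (psdBr sS fa).
  by have := mulr_ge0 (ltW tau0) h1; rewrite h2 /z; lra.
have E4 i : d i <= tau ^+ 2 * kap ^+ 4 * x i.+1.
  have h := F1 i _ (sXX i); rewrite -/(d i) in h.
  have h1 := psd_CS sS fa (sX i.+1) (sXX i).
  have h2 := inv_ineq (sX i.+1); have h3 := inv_ineq (sXX i).
  rewrite -/(d i) in h3; rewrite -/(x i.+1) in h2; rewrite -/(z i.+1) in h1 h2.
  set c := a (X i.+1) _ in h h1; set e := a (_ - _) _ in h1 h3.
  have e0 : 0 <= e by exact: (psd_ge0 fa).
  have [di|di] := eqVneq (d i) 0.
    by rewrite di mulr_ge0// mulr_ge0// exprn_ge0 ?ltW.
  have dp : 0 < d i by rewrite lt_neqAle eq_sym di d0.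
  rewrite -(ler_pM2l dp).
  have -> : d i * d i = tau ^+ 2 * c ^+ 2 by rewrite [in LHS]h; ring.
  have -> : d i * (tau ^+ 2 * kap ^+ 4 * x i.+1) =
    tau ^+ 2 * ((kap ^+ 2 * x i.+1) * (kap ^+ 2 * d i)) by ring.
  rewrite ler_pM2l ?exprn_gt0//; apply: (le_trans h1).
  by apply: ler_pM.
have E5 i : d i <= x i.
  have h1 := F1 i _ (sX i.+1); rewrite (psdBl fm)// (psd_sym fm (sX i))// in h1.
  rewrite /d (psd_sqrB sS fm)//; have := x0 i.+1.
  by have := mulr_ge0 (ltW tau0) (z0 i.+1); rewrite /x /z; lra.
have xle i : x i <= x 0%N.
  elim: i => [//|i ih]; apply: le_trans ih.
  by have := E2 i; have := mulr_ge0 (ltW tau0) (z0 i.+1); lra.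
set A2 := a psi psi.
have A20 : 0 <= A2 by exact: (psd_ge0 fa).
have x0A : x 0%N <= kap ^+ 2 * A2.
  have h1 := psd_CS sS fa spsi sX0; have h2 := inv_ineq sX0.
  have h3 : x 0%N = a psi X0 by rewrite /x /X hX0.
  rewrite -/(z 0%N) in h1 h2; rewrite -/(x 0%N) in h2; rewrite -h3 -/A2 in h1.
  have [e|e] := eqVneq (x 0%N) 0; first by rewrite e mulr_ge0// sqr_ge0.
  have xp : 0 < x 0%N by rewrite lt_neqAle eq_sym e x0.
  rewrite -(ler_pM2l xp) -expr2; apply: (le_trans h1).
  rewrite (_ : x 0%N * _ = A2 * (kap ^+ 2 * x 0%N)); last by ring.
  exact: ler_wpM2l.
(* With t_i = i tau, the weights are 1, 2 t_i and 2 t_i t_(i-1). The growth of each is paid by the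
   dissipation of the preceding term, and the last one yields a weighted bound for the increments
   [d i]. *)
pose L i := y i + 2 * (i%:R * tau) * x i + 2 * tau ^+ 2 * (i%:R * (i%:R - 1)) * z i.
have LE i : L i.+1 + 4 * tau * (i%:R * (i%:R - 1)) * d i <= L i.
  have i0 : 0 <= i%:R * (i%:R - 1) :> R.
    by case: i => [|i]; rewrite ?mul0r// mulr_ge0// -natr1 addrK.
  have in0 : 0 <= i%:R :> R by [].
  have h1 := E1 i; have h2 := ler_wpM2l (mulr_ge0 in0 (ltW tau0)) (E2 i).
  have h3 := ler_wpM2l (mulr_ge0 (ltW tau0) i0) (E3 i).
  by rewrite /L -[i.+1%:R]natr1; lra.
have ynb i : y i <= A2.
  elim: i => [|i ih]; first by rewrite /y /Y.
  by apply: le_trans ih; have := E1 i; have := mulr_ge0 (ltW tau0) (x0 i.+1); lra.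
exists X; split => // n; split; last by apply: le_trans x0A; exact: xle.
pose A := Num.sqrt A2.
have sq : A ^+ 2 = A2 by rewrite sqr_sqrtr.
have A0 : 0 <= A by exact: sqrtr_ge0.
have Dk i : Num.sqrt (d i) <= kap * A.
  rewrite -[leRHS]ger0_norm; last exact: mulr_ge0 (ltW kap0) A0.
  rewrite -sqrtr_sqr ler_wsqrtr// exprMn sq; apply: (le_trans (E5 i)); apply: le_trans x0A; exact: xle.
have [A00|Ap] := eqVneq A 0.
  rewrite -/A A00 mulr0; apply: sumr_le0 => i _; have := Dk i.
  by rewrite A00 mulr0.
have {}Ap : 0 < A by rewrite lt_neqAle eq_sym Ap.
(* A lower bound for the time scales of the discrete modes, which regularizes the weight 1 / t^2
   near t = 0. Below, [lam] balances Young's inequality so that each side is a multiple of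
   [kap A]. *)
pose q := (kap ^+ 2)^-1.
have q0 : 0 < q by rewrite invr_gt0 exprn_gt0.
pose lam := kap / A.
have lam0 : 0 < lam by rewrite divr_gt0.
(* Young's inequality for each increment, with [b = s + tau + q]: the terms [tau / b^2] telescope
   against [(s + q)^-1], and [b^2 d / tau] against [L + y]. The sum starts at index 2 because the
   weight i (i - 1) vanishes before. *)
have key k : \sum_(i < k) Num.sqrt (d i.+2) + lam / 2 * (L k.+2 + y k.+2) +
    (2 * lam)^-1 * (k%:R * tau + q)^-1 <= lam / 2 * (2 * A2) + (2 * lam)^-1 * q^-1.
  elim: k => [|k ih].
    rewrite big_ord0 add0r mul0r add0r lerD2r.
    apply: ler_wpM2l; first by rewrite divr_ge0// ltW.
    have h1 := ynb 2%N; have h2 := LE 0%N; have h3 := LE 1%N.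
    rewrite subrr !(mulr0, mul0r) addr0 in h3; rewrite !(mul0r, mulr0) addr0 in h2.
    have h4 : L 0%N = A2 by rewrite /L /y /Y /= !(mul0r, mulr0) !addr0.
    by lra.
  rewrite big_ord_recr/=.
  have tp : 0 < tau by exact: tau0.
  have kt0 : 0 <= k%:R * tau by rewrite mulr_ge0// ltW.
  set s := k%:R * tau in kt0 *.
  have es : k.+1%:R * tau = s + tau by rewrite -natr1 mulrDl mul1r.
  rewrite -/s in ih; rewrite es; set b := (s + tau + q).
  have b0 : 0 < b by rewrite /b; lra.
  have sq0 : 0 < s + q by lra.
  have h1 : tau / b ^+ 2 <= (s + q)^-1 - b^-1.
    rewrite (_ : _ - _ = tau / (b * (s + q))); last first.
      by rewrite /b; field; rewrite !gt_eqF// -/b.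
    rewrite ler_wpM2l ?(ltW tau0)// lef_pV2 ?posrE ?exprn_gt0 ?mulr_gt0// expr2.
    by rewrite ler_pM2l// /b; lra.
  (* The part [(s + tau)^2] of [b^2] is paid by the decrease of [L], the part [q^2] by [E4] and the
     decrease of [y]. *)
  have h2 : b ^+ 2 * (d k.+2 / tau) <= L k.+2 + y k.+2 - (L k.+3 + y k.+3).
    have h3 := LE k.+2; have h4 := E1 k.+2; have h5 := E4 k.+2.
    have k2 : k.+2%:R = k%:R + 2 :> R by rewrite -addn2 natrD.
    have h6 : d k.+2 * q ^+ 2 <= tau ^+ 2 * x k.+3.
      rewrite (_ : q ^+ 2 = (kap ^+ 4)^-1); last by rewrite /q -exprVn -exprM exprVn.
      by rewrite ler_pdivrMr ?exprn_gt0//; nra.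
    have h7 : b ^+ 2 <= 2 * (s + tau) ^+ 2 + 2 * q ^+ 2.
      by rewrite /b; have := sqr_ge0 (s + tau - q); nra.
    rewrite mulrA ler_pdivrMr//.
    apply: (@le_trans _ _ ((2 * (s + tau) ^+ 2 + 2 * q ^+ 2) * d k.+2)).
      exact: ler_wpM2r.
    have h8 : 2 * (s + tau) ^+ 2 * d k.+2 <= tau * (4 * tau * (k.+2%:R * (k.+2%:R - 1)) * d k.+2).
      rewrite (_ : tau * _ = 2 * (2 * (tau ^+ 2 * (k.+2%:R * (k.+2%:R - 1)))) * d k.+2); last by ring.
      apply: ler_wpM2r => //; apply: ler_wpM2l => //.
      rewrite k2 /s; have : 0 <= k%:R :> R by [].
      by move: (k%:R : R) => t t0; have := sqr_ge0 tau; nra.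
    have h9 := ler_wpM2l (ltW tau0) h3; have h10 := ler_wpM2l (ltW tau0) h4.
    by move: h6 h8 h9 h10; move: (L _) (L _) (_ * (_ - 1)) => L1 L2 e; lra.
  have h3 : Num.sqrt (d k.+2) <= lam / 2 * (b ^+ 2 * (d k.+2 / tau)) + (2 * lam)^-1 * (tau / b ^+ 2).
    set D := Num.sqrt _; have dD : d k.+2 = D ^+ 2 by rewrite sqr_sqrtr.
    have D0 : 0 <= D by exact: sqrtr_ge0.
    rewrite dD.
    have := sqr_ge0 (lam * b ^+ 2 * D - tau) => h.
    rewrite -subr_ge0 (_ : _ - _ = (lam * b ^+ 2 * D - tau) ^+ 2 / (2 * lam * tau * b ^+ 2)).
      have P : 0 < 2 * lam * tau * b ^+ 2.
        by apply: mulr_gt0; [apply: mulr_gt0 => //; exact: mulr_gt0|exact: exprn_gt0].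
      exact: divr_ge0 h (ltW P).
    by field; rewrite !gt_eqF.
  have h4 := ler_wpM2l (ltW (divr_gt0 lam0 (ltr0n R 2))) h2.
  have l20 : 0 <= (2 * lam)^-1 by rewrite invr_ge0 mulr_ge0// ltW.
  have h5 := ler_wpM2l l20 h1.
  have h6 : lam / 2 * (L k.+2 + y k.+2 - (L k.+3 + y k.+3)) =
    lam / 2 * (L k.+2 + y k.+2) - lam / 2 * (L k.+3 + y k.+3) by rewrite mulrBr.
  have h7 : (2 * lam)^-1 * ((s + q)^-1 - b^-1) = (2 * lam)^-1 * (s + q)^-1 - (2 * lam)^-1 * b^-1.
    by rewrite mulrBr.
  rewrite h6 in h4; rewrite h7 in h5.
  move: h3 h4 h5 ih; move: (lam / 2 * _) (_ * (tau / _)) => X2 X3.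
  move: (lam / 2 * _) (lam / 2 * _) (_ * b^-1) (_ * (s + q)^-1) => X4 X5 X6 X7.
  by move: (_ * (2 * A2)) (_ * q^-1) (\sum_(i < k) _) (Num.sqrt _) => *; lra.
have key2 k : \sum_(i < k) Num.sqrt (d i.+2) <= 3/2 * kap * A.
  have h := key k.
  have e1 : lam / 2 * (2 * A2) = kap * A by rewrite /lam -sq; field; rewrite gt_eqF.
  have e2 : (2 * lam)^-1 * q^-1 = kap * A / 2 by rewrite /lam /q; field; rewrite !gt_eqF.
  rewrite e1 e2 in h.
  have p1 : 0 <= lam / 2 * (L k.+2 + y k.+2).
    apply: mulr_ge0; first by rewrite divr_ge0// ltW.
    have k0 : 0 <= k.+2%:R * (k.+2%:R - 1) :> R.
      by apply: mulr_ge0 => //; rewrite -[k.+2%:R]natr1 addrK.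
    have t0 : 0 <= tau by exact: ltW.
    apply: addr_ge0 => //; apply: addr_ge0; first by apply: addr_ge0 => //; do !apply: mulr_ge0.
    by do !apply: mulr_ge0 => //; exact: exprn_ge0.
  have p2 : 0 <= (2 * lam)^-1 * (k%:R * tau + q)^-1.
    apply: mulr_ge0; rewrite invr_ge0; first by apply: mulr_ge0 => //; exact: ltW.
    by apply: addr_ge0; [apply: mulr_ge0 => //; exact: ltW|exact: ltW].
  by move: h p1 p2; move: (\sum_(i < _) _) => ?; lra.
have kA0 : 0 <= kap * A by rewrite mulr_ge0// ltW.
rewrite -/A -[leLHS]/(\sum_(i < n) Num.sqrt (d i)).
case: n => [|[|n]].
- by rewrite big_ord0; lra.
- by rewrite big_ord1; have := Dk 0%N; lra.
- rewrite !big_ord_recl/=; have := key2 n; have := Dk 0%N; have := Dk 1%N.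
  by move: (\sum_(i < _) _) => ?; lra.
Qed.

(* Duality: [a (th n) (th n)] is the pairing of the increments of [r] with the sequence of
   [smoothing_seq] run backwards; a summation by parts moves the difference off [r]. *)
Lemma parabolic_smoothing (th : nat -> V) (r : nat -> V -> R) (del : R) :
  0 <= del -> (forall j, S (th j)) -> th 0%N = 0 ->
  (forall j, lin_on S (r j)) ->
  (forall j v, S v -> `|r j v| <= del * Num.sqrt (m v v)) ->
  (forall j v, S v -> m (th j.+1 - th j) v + tau * a (th j.+1) v = r j.+1 v - r j v) ->
  forall n, a (th n) (th n) <= (6 * kap * del) ^+ 2.
Proof.
move=> del0 sth th0 lr rb eqn n.
have [X [sX hX0 hX hsum]] := smoothing_seq (sth n).
set A2 := a (th n) (th n) in hsum *.
have A20 : 0 <= A2 by exact: (psd_ge0 fa).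
pose A := Num.sqrt A2; have sq : A ^+ 2 = A2 by rewrite sqr_sqrtr.
have A0 : 0 <= A by exact: sqrtr_ge0.
(* In the increments of [g] the terms with [a] cancel, and [r] is left acting on an increment of
   [X]. *)
pose g j := m (th j) (X (n - j)%N) - r j (X (n - j)%N).
pose D i := Num.sqrt (m (X i.+1 - X i) (X i.+1 - X i)).
have gs j : (j < n)%N -> `|g j.+1 - g j| <= del * D (n - j.+1)%N.
  move=> jn; have e : (n - j = (n - j.+1).+1)%N by rewrite subnSK.
  rewrite /g e; set i := (n - j.+1)%N.
  have sXX : S (X i.+1 - X i) by exact: subspB.
  have h1 := eqn j _ (sX i.+1); have h2 := hX i _ (sth j.+1).
  rewrite (psd_sym fa (sX _) (sth _)) in h2.
  rewrite (psdBl fm)// (psd_sym fm (sX _) (sth _)) (psd_sym fm (sX i) (sth _)) in h2.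
  rewrite (psdBl fm)// in h1.
  rewrite (_ : _ - _ - _ = r j.+1 (X i.+1 - X i)); first exact: rb.
  by rewrite (lin_onB (lr _))//; lra.
have gn k : (k <= n)%N -> `|g k - g 0%N| <= del * \sum_(i < k) D (n - i.+1)%N.
  elim: k => [_|k ih kn]; first by rewrite subrr normr0 big_ord0 mulr0.
  rewrite big_ord_recr/= mulrDr (_ : g k.+1 - _ = (g k - g 0%N) + (g k.+1 - g k)); last by ring.
  by apply: (le_trans (ler_normD _ _)); apply: lerD; [exact: ih (ltnW kn)|exact: gs].
have sume : \sum_(i < n) D (n - i.+1)%N = \sum_(i < n) D i.
  by rewrite (reindex_inj rev_ord_inj)/=; apply: eq_bigr => i _; rewrite subnSK// subKn// ltnW.
have hn := gn n (leqnn n); rewrite sume in hn.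
have [sn xn] := hsum n; rewrite -/A in sn.
have sD : \sum_(i < n) D i <= 4 * kap * A by exact: sn.
have h1 := ler_wpM2l del0 sD.
have g0 : g 0%N = - r 0%N (X n).
  by rewrite /g subn0 th0 (lin_on0 sS (psd_lin fm (sX n))) sub0r.
have gnE : g n = A2 - r n (X 0%N).
  by rewrite /g subnn (psd_sym fm)// hX0.
have xb k : Num.sqrt (m (X k) (X k)) <= kap * A.
  have [_ h] := hsum k.
  rewrite -[leRHS]ger0_norm ?mulr_ge0 ?(ltW kap0)// -sqrtr_sqr ler_wsqrtr//.
  by rewrite exprMn sq.
have r1 := le_trans (rb 0%N _ (sX n)) (ler_wpM2l del0 (xb n)).
have r2 := le_trans (rb n _ (sX 0%N)) (ler_wpM2l del0 (xb 0%N)).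
have h2 := le_trans hn h1; rewrite gnE g0 in h2.
move: r1 r2 h2; rewrite !ler_norml => /andP[_ r1] /andP[_ r2] /andP[_ h2].
have dkA : 0 <= del * (kap * A) by rewrite !mulr_ge0// ltW.
(* 6 = 4 + 1 + 1: the summed increments and the two end terms [r n (X 0)] and [r 0 (X n)]. *)
have h3 : A ^+ 2 <= 6 * (del * (kap * A)).
  rewrite sq; move: (rb 0%N _ (sX n)); rewrite ler_norml => /andP[r3 _].
  have := ler_wpM2l del0 (xb n).
  have e : del * (4 * kap * A) = 4 * (del * (kap * A)) by ring.
  by rewrite e in h2; lra.
rewrite -sq; have [->|Ap] := eqVneq A 0; first by rewrite expr0n sqr_ge0.
have {}Ap : 0 < A by rewrite lt_neqAle eq_sym Ap.
rewrite lerXn2r ?nnegrE ?mulr_ge0 ?(ltW kap0)//.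
by rewrite -(ler_pM2r Ap); move: h3; rewrite expr2; lra.
Qed.

End ParabolicSmoothing.
End Forms.

(** * The finite element space *)

Section FiniteElements.
Context {R : realType}.
Implicit Types (f g v w : R -> R) (a b x y K : R) (n i k N : nat).
Local Notation I := (@unit_interval R).
Local Notation V := (R -> R^o).

Definition clamp a b x : R := Num.max a (Num.min x b).

Lemma bmeas_indic g a b : bmeas g -> bmeas (fun x => g x * \1_(`[a, b]) x).
Proof.
move=> bg; apply: bmeasM => //; split.
  by apply: measurable_indic; exact: measurable_itv.
by exists 1 => x _; rewrite indicE; case: (_ \in _); rewrite ?normr1 ?normr0.
Qed.

Lemma integ0_oo f a b : 0 <= a -> b <= 1 -> bmeas f -> (forall x, a < x < b -> f x = 0) ->
  integ a b f = 0.
Proof.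
move=> a0 b1 bf f0; have [ab|ba] := leP a b; last first.
  by rewrite /integ set_itv_ge ?Rintegral_set0// bnd_simp -ltNge.
rewrite (eq_integ_oo a0 b1 bf (bmeas_cst 0))//.
by rewrite integ_cst// mul0r.
Qed.

Lemma antider_clamp v g a b : antider v g -> 0 <= a -> a <= b -> b <= 1 ->
  antider (fun x => v (clamp a b x)) (fun x => g x * \1_(`[a, b]) x).
Proof.
move=> vg a0 ab b1; have bg := vg.1; have bh := bmeas_indic a b bg.
split => // x y x0 xy y1.
have out t : ~~ (a <= t <= b) -> g t * \1_(`[a, b]) t = 0.
  by move=> h; rewrite indicE memNset ?mulr0//= in_itv/=; exact/negP.
have inn t : a <= t <= b -> g t * \1_(`[a, b]) t = g t.
  by move=> h; rewrite indicE mem_set ?mulr1//= in_itv.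
have [ya|ay] := leP y a.
  have xa := le_trans xy ya.
  rewrite /clamp !(max_idPl _) ?ge_min ?ya ?xa// subrr integ0_oo// => t /andP[_ ty].
  by apply: out; rewrite negb_and -ltNge (lt_le_trans ty ya).
have [bx|xb] := leP b x.
  have by' := le_trans bx xy.
  rewrite /clamp !(min_idPr _)// subrr integ0_oo// => t /andP[xt _].
  by apply: out; rewrite negb_and -!ltNge (le_lt_trans bx xt) orbT.
have cx : clamp a b x = Num.max a x by rewrite /clamp (min_idPl _)// ltW.
have cy : clamp a b y = Num.min y b by rewrite /clamp (max_idPr _)// le_min (ltW ay).
rewrite cx cy.
have p1 : x <= Num.max a x by rewrite le_max lexx orbT.
have p2 : Num.max a x <= Num.min y b by rewrite ge_max !le_min (ltW ay) ab xy ltW.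
have p3 : Num.min y b <= y by rewrite ge_min lexx.
have m0 : 0 <= Num.max a x by rewrite le_max a0.
have m1 : Num.min y b <= 1 by rewrite ge_min y1.
rewrite (integ_cat x0 y1 bh (c := Num.max a x)) ?p1 ?(le_trans p2)//.
rewrite (integ_cat m0 y1 bh (c := Num.min y b)) ?p2 ?p3//.
rewrite (integ0_oo x0 _ bh) ?(le_trans p2)// ?add0r; last first.
  move=> t /andP[xt]; rewrite lt_max => /orP[ta|tx]; last by have := lt_trans xt tx; rewrite ltxx.
  by apply: out; rewrite negb_and -ltNge ta.
rewrite (integ0_oo _ y1 bh) ?(le_trans m0)// ?addr0; last first.
  move=> t /andP[+ ty]; rewrite gt_min => /orP[yt|bt]; first by have := lt_trans yt ty; rewrite ltxx.
  by apply: out; rewrite negb_and -!ltNge bt orbT.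
rewrite -(antiderE vg m0 p2 m1); apply/esym/eq_integ => t /andP[].
by rewrite ge_max le_min => /andP[at_ _] /andP[_ tb]; apply: inn; rewrite at_.
Qed.

Lemma antider_sum n (v g : nat -> R -> R) : (forall i, (i < n)%N -> antider (v i) (g i)) ->
  antider (fun x => \sum_(i < n) v i x) (fun x => \sum_(i < n) g i x).
Proof.
elim: n => [|n ih] H.
  by apply: (eq_antider (antider_cst 0)) => x _; rewrite big_ord0.
have := antiderD (ih (fun i h => H i (ltnW h))) (H n (ltnSn n)).
by move=> h; apply: (eq_antider h) => x _; rewrite big_ord_recr.
Qed.

Definition node N i : R := i%:R / N%:R.

Lemma node_ge0 N i : 0 <= node N i.
Proof. by rewrite divr_ge0. Qed.

Lemma node_le N i j : (i <= j)%N -> node N i <= node N j.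
Proof. by move=> ij; rewrite ler_wpM2r ?invr_ge0// ler_nat. Qed.

Lemma node_le1 N i : (i <= N)%N -> node N i <= 1.
Proof.
move=> iN; have [->|N0] := eqVneq N 0%N; first by rewrite /node invr0 mulr0.
by rewrite /node ler_pdivrMr ?ltr0n ?lt0n// mul1r ler_nat.
Qed.

Lemma nodeNN N : (0 < N)%N -> node N N = 1.
Proof. by move=> N0; rewrite /node divff// pnatr_eq0 -lt0n. Qed.

Lemma node0 N : node N 0 = 0.
Proof. by rewrite /node mul0r. Qed.

Lemma nodeS N i : node N i.+1 = node N i + N%:R^-1.
Proof. by rewrite /node -natr1 mulrDl mul1r. Qed.

Lemma integ_elements N f n : (n <= N)%N -> bmeas f ->
  integ 0 (node N n) f = \sum_(i < n) integ (node N i) (node N i.+1) f.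
Proof.
move=> nN bf; elim: n nN => [_|n ih nN]; first by rewrite big_ord0 node0 integ_pt.
rewrite big_ord_recr/= -ih ?(ltnW nN)//; apply: integ_cat => //; first exact: node_le1.
by rewrite node_ge0 node_le.
Qed.

Lemma element_of N x : (0 < N)%N -> 0 <= x <= 1 -> exists2 i, (i < N)%N & node N i <= x <= node N i.+1.
Proof.
move=> N0 /andP[x0 x1].
have NR : 0 < N%:R :> R by rewrite ltr0n.
have [/eqP x1'|xn1] := boolP (x == 1).
  exists N.-1; first by rewrite prednK.
  by rewrite prednK// x1' nodeNN// lexx node_le1 ?leq_pred.
have xN0 : 0 <= x * N%:R by rewrite mulr_ge0.
exists (Num.truncn (x * N%:R)).
  by rewrite truncn_lt_nat// -[ltRHS]mul1r ltr_pM2r// lt_neqAle xn1.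
rewrite /node ler_pdivrMr// ler_pdivlMr//; apply/andP; split; first by rewrite truncn_le.
by apply: ltW; exact: truncnS_gt.
Qed.

Lemma lip_nodes N v K : (0 < N)%N ->
  (forall i x y, (i < N)%N -> node N i <= x -> x <= y -> y <= node N i.+1 ->
     `|v y - v x| <= K * (y - x)) ->
  forall x, 0 <= x <= 1 -> `|v x - v 0| <= K * x.
Proof.
move=> N0 H.
have nodeb i : (i <= N)%N -> `|v (node N i) - v 0| <= K * node N i.
  elim: i => [_|i ih iN]; first by rewrite node0 subrr normr0 mulr0.
  have h2 := H i _ _ iN (lexx _) (node_le N (leqnSn i)) (lexx _).
  have h1 := ih (ltnW iN).
  have := ler_normD (v (node N i.+1) - v (node N i)) (v (node N i) - v 0).
  by rewrite addrA subrK; lra.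
move=> r r01; have [i iN /andP[ir ri]] := element_of N0 r01.
have h1 := H i _ _ iN (lexx _) ir ri; have h2 := nodeb i (ltnW iN).
by have := ler_normD (v r - v (node N i)) (v (node N i) - v 0); rewrite addrA subrK; lra.
Qed.

(** [w] sums the increments of the [P i] with arguments clamped to the elements: elements on the
    left contribute whole increments, which telescope, and elements on the right contribute nothing.
    Each summand is Lipschitz on all of [0,1], so the nodes need no separate argument. *)
Lemma glue_poly N (P : nat -> {poly R}) (c : nat -> R) : (0 < N)%N ->
  (forall i, (i < N)%N -> (P i).[node N i] = c i /\ (P i).[node N i.+1] = c i.+1) -> c 0%N = 0 ->
  exists w g, [/\ antider w g,
    forall i, (i < N)%N -> forall r, node N i <= r <= node N i.+1 -> w r = (P i).[r] &
    forall i, (i < N)%N -> forall r, node N i < r < node N i.+1 -> g r = (P i)^`().[r]].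
Proof.
move=> N0 HP c0.
pose t i x := (P i).[clamp (node N i) (node N i.+1) x] - c i.
pose g x := \sum_(i < N) ((P i)^`().[x] * \1_(`[node N i, node N i.+1]) x).
exists (fun x => \sum_(i < N) t i x), g; split.
- apply: (@antider_sum N t (fun i x => (P i)^`().[x] * \1_(`[node N i, node N i.+1]) x)).
  move=> i iN.
  have h := antider_clamp (antider_poly (P i)) (node_ge0 N i) (node_le N (leqnSn i)) (node_le1 iN).
  have h' := antiderB h (antider_cst (c i)).
  by apply: (eq_antider h') => x _; rewrite ?subr0.
- move=> i iN r /andP[ir ri].
  have A n : (n <= i)%N -> \sum_(j < n) t j r = c n.
    elim: n => [_|n ih ni]; first by rewrite big_ord0 c0.
    rewrite big_ord_recr/= ih ?(ltnW ni)// /t /clamp.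
    have nr := le_trans (node_le N ni) ir.
    rewrite (min_idPr _)// (max_idPr _) ?node_le//.
    by have [_ ->] := HP n (ltn_trans ni iN); rewrite addrC subrK.
  have B n : (i < n)%N -> (n <= N)%N -> \sum_(j < n) t j r = (P i).[r].
    elim: n => // n ih; rewrite ltnS leq_eqVlt => /orP[/eqP <- _|lt nN].
      rewrite big_ord_recr/= A// /t /clamp (min_idPl _)// (max_idPr _)//.
      by rewrite addrC subrK.
    rewrite big_ord_recr/= ih ?(ltnW nN)// /t /clamp.
    have rn := le_trans ri (node_le N lt).
    rewrite (max_idPl _) ?ge_min ?rn//.
    by have [-> _] := HP n nN; rewrite subrr addr0.
  exact: B.
- move=> i iN r /andP[ir ri]; rewrite /g (bigD1 (Ordinal iN))//= big1 ?addr0.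
    by rewrite indicE mem_set ?mulr1//= in_itv/= !ltW.
  move=> j ji; rewrite indicE memNset ?mulr0//= in_itv/= => /andP[h1 h2].
  have : (j != i :> nat) by apply: contra ji => /eqP ji; apply/eqP/val_inj.
  rewrite neq_ltn => /orP[lt|lt].
    by have := le_trans h2 (node_le N lt); rewrite leNgt ir.
  by have := le_trans (node_le N lt) h1; rewrite leNgt ri.
Qed.

Definition pw_poly k N v (p : nat -> {poly R}) := forall i, (i < N)%N ->
  (size (p i) <= k.+1)%N /\ forall r, node N i <= r <= node N i.+1 -> v r = (p i).[r].

(** The inequalities for [g] are strict because the two polynomials meeting at a node have different
    slopes there in general. *)
Definition fe_deriv k N v g (p : nat -> {poly R}) :=
  [/\ antider v g, pw_poly k N v p &
    forall i, (i < N)%N -> forall r, node N i < r < node N i.+1 -> g r = (p i)^`().[r]].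

Lemma fe_has_deriv k N v : (0 < N)%N -> fe_space k N v -> exists g p, fe_deriv k N v g p.
Proof.
move=> N0 [cv v0 v1 hv].
have /choice[p hp] : forall i, exists p : {poly R}, (i < N)%N ->
    (size p <= k.+1)%N /\ forall r, node N i <= r <= node N i.+1 -> v r = p.[r].
  move=> i; have [iN|iN] := ltnP i N; last by exists 0.
  by have [p sp vp] := hv i iN; exists p.
have [||w [g [wg wp gp]]] := @glue_poly N p (fun i => v (node N i)) N0.
- move=> i iN; have [_ vp] := hp i iN; have nn := node_le N (leqnSn i).
  by rewrite !vp ?lexx ?nn.
- by rewrite node0.
exists g, p; split => //; apply: (eq_antider wg) => // x x01.
have [i iN xi] := element_of N0 x01; have [_ vp] := hp i iN.
by rewrite (wp i iN x xi) vp.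
Qed.

(** The common setting of finite element functions, of the solution at a fixed time and of the dual
    solutions: [v / r] is bounded, so both inner products are integrals of bounded functions. *)
Definition lip0 v := v 0 = 0 /\ exists g, antider v g.

Lemma fe_lip0 k N v : (0 < N)%N -> fe_space k N v -> lip0 v.
Proof.
move=> N0 fv; split; first by case: fv.
by have [g [p [h _ _]]] := fe_has_deriv N0 fv; exists g.
Qed.

Lemma lip0_bmeas v : lip0 v -> bmeas v.
Proof. by move=> [_ [g vg]]; exact: antider_bmeas vg. Qed.

Lemma lip0_bound v : lip0 v -> exists2 K, 0 <= K & forall x, 0 <= x <= 1 -> `|v x| <= K * x.
Proof.
move=> [v0 [g vg]]; have [K K0 HK] := antider_lip vg; exists K => // x x01.
have := HK 0 x; rewrite v0 !subr0 lexx ler01 => /(_ isT x01).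
by rewrite (@ger0_norm _ x)//; case/andP: x01.
Qed.

Lemma lip0_div_bmeas v : lip0 v -> bmeas (fun x => v x / x).
Proof.
move=> h; have [K _ HK] := lip0_bound h.
by apply: (@bmeas_div _ _ K) => //; case: (lip0_bmeas h).
Qed.

Lemma subsp_lip0 : subsp (lip0 : V -> Prop).
Proof.
split; first by split => //; exists (fun=> 0); exact: (antider_cst 0).
move=> c v w [v0 [g vg]] [w0 [f wf]]; split.
  by rewrite -[LHS]/(c * v 0 + w 0) v0 w0 mulr0 addr0.
by exists (fun x => c * g x + f x); exact: (antiderD (antiderZ c vg) wf).
Qed.

Lemma subsp_bmeas : subsp (bmeas : V -> Prop).
Proof.
split; first exact: (bmeas_cst 0).
by move=> c v w bv bw; exact: (bmeasD (bmeasZ c bv) bw).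
Qed.

Lemma fe_lin k N c v w : fe_space k N v -> fe_space k N w ->
  fe_space k N (fun x => c * v x + w x).
Proof.
move=> [cv v0 v1 hv] [cw w0 w1 hw]; split.
- move=> x; apply: (@continuousD _ _ (subspace I) (fun x => c * v x) w); last exact: cw.
  apply: (@continuousM _ (subspace I) (fun=> c) v); [exact: cst_continuous|exact: cv].
- by rewrite v0 w0 mulr0 addr0.
- by rewrite v1 w1 mulr0 addr0.
- move=> i iN; have [p sp hp] := hv i iN; have [q sq hq] := hw i iN.
  exists (c *: p + q).
    rewrite (leq_trans (size_polyD _ _))// geq_max sq andbT.
    exact: leq_trans (size_scale_leq _ _) sp.
  by move=> r h; rewrite hp// hq// hornerD hornerZ.
Qed.

Lemma subsp_fe k N : subsp (fe_space k N : V -> Prop).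
Proof.
split; last by move=> c v w; exact: fe_lin.
split => //; first by move=> x; exact: cst_continuous.
by move=> i iN; exists 0; rewrite ?size_poly0// => r _; rewrite horner0.
Qed.

Lemma ip0rE v w : ip0r v w = integ 0 1 (fun r => v r * w r * r).
Proof. by []. Qed.

Lemma psd_ip0r : psd_form (bmeas : V -> Prop) (ip0r : V -> V -> R).
Proof.
have bI := @bmeas_id R.
split.
- by move=> v w bv bw; rewrite !ip0rE; apply: eq_integ => x _; rewrite [v x * _]mulrC.
- move=> w bw c u v bu bv; rewrite !ip0rE -integZ ?lexx ?ler01//; last by do !apply: bmeasM.
  rewrite -integD ?lexx ?ler01//; [|by do !apply: bmeasM => //; exact: bmeas_cst|by do !apply: bmeasM].
  by apply: eq_integ => x _; rewrite -[(c *: u + v) x]/(c * u x + v x); ring.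
- move=> v bv; rewrite ip0rE; apply: integ_ge0 => x /andP[x0 x1].
  by rewrite mulr_ge0// -expr2 sqr_ge0.
Qed.

Definition H1r_density v g w f : R -> R := fun r => g r * f r * r + v r / r * (w r / r) * r.

Lemma bmeas_H1r_density v g w f : antider v g -> v 0 = 0 -> antider w f -> w 0 = 0 ->
  bmeas (H1r_density v g w f).
Proof.
move=> vg v0 wf w0; apply: bmeasD.
  by do !apply: bmeasM; [exact: vg.1|exact: wf.1|exact: bmeas_id].
have h1 : bmeas (fun r => v r / r) by apply: lip0_div_bmeas; split => //; exists g.
have h2 : bmeas (fun r => w r / r) by apply: lip0_div_bmeas; split => //; exists f.
by apply: bmeasM; [exact: bmeasM|exact: bmeas_id].
Qed.

Lemma ip0r_wD v g w f : antider v g -> antider w f ->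
  ip0r (wD 1 v) (wD 1 w) = integ 0 1 (fun r => g r * f r * r).
Proof.
move=> vg wf; have bI := @bmeas_id R; have bg := vg.1; have bf := wf.1.
have [mv av] := antider_wD vg; have [mw aw] := antider_wD wf.
rewrite ip0rE; apply: eq_integ_ae => //.
- by apply: measurable_funM; [exact: measurable_funM|exact: measurable_id].
- by have := bmeasM (bmeasM bg bf) bI; case.
- by apply: (ae_imp (ae_and av aw)) => x [h3 h4] xI; rewrite h3// h4.
Qed.

Lemma ipH1rE v g w f : antider v g -> v 0 = 0 -> antider w f -> w 0 = 0 ->
  ipH1r v w = integ 0 1 (H1r_density v g w f).
Proof.
move=> vg v0 wf w0.
have h1 : bmeas (fun r => v r / r) by apply: lip0_div_bmeas; split => //; exists g.
have h2 : bmeas (fun r => w r / r) by apply: lip0_div_bmeas; split => //; exists f.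
have bI := @bmeas_id R; have bg := vg.1; have bf := wf.1.
rewrite /ipH1r (ip0r_wD vg wf) ip0rE /H1r_density integD ?lexx ?ler01//.
- exact: bmeasM (bmeasM bg bf) bI.
- exact: bmeasM (bmeasM h1 h2) bI.
Qed.

Lemma psd_ipH1r : psd_form (lip0 : V -> Prop) (ipH1r : V -> V -> R).
Proof.
split.
- move=> v w [v0 [g vg]] [w0 [f wf]].
  rewrite (ipH1rE vg v0 wf w0) (ipH1rE wf w0 vg v0); apply: eq_integ => x _.
  by rewrite /H1r_density; ring.
- move=> w [w0 [f wf]] c u v [u0 [h uh]] [v0 [g vg]].
  have b1 := bmeas_H1r_density uh u0 wf w0; have b2 := bmeas_H1r_density vg v0 wf w0.
  rewrite (ipH1rE uh u0 wf w0) (ipH1rE vg v0 wf w0).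
  have cuv := antiderD (antiderZ c uh) vg.
  rewrite -integZ ?lexx ?ler01// -integD ?lexx ?ler01//; last exact: bmeasZ.
  rewrite (ipH1rE cuv _ wf w0); last by rewrite u0 v0 mulr0 addr0.
  by apply: eq_integ => x _; rewrite /H1r_density; ring.
- move=> v [v0 [g vg]]; rewrite (ipH1rE vg v0 vg v0).
  apply: integ_ge0 => x /andP[x0 x1]; rewrite /H1r_density.
  by rewrite addr_ge0// mulr_ge0// -expr2 sqr_ge0.
Qed.

Lemma fe_psd_ip0r k N : (0 < N)%N -> psd_form (fe_space k N : V -> Prop) (ip0r : V -> V -> R).
Proof.
by move=> N0; apply: (psd_sub _ psd_ip0r) => v /(fe_lip0 N0); exact: lip0_bmeas.
Qed.

Lemma fe_psd_ipH1r k N : (0 < N)%N -> psd_form (fe_space k N : V -> Prop) (ipH1r : V -> V -> R).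
Proof. by move=> N0; apply: (psd_sub _ psd_ipH1r) => v; exact: fe_lip0. Qed.

(** A polynomial of degree at most k is determined by k + 1 points of its element; the index [e]
    enumerates the pairs of an element [e %/ k.+1] and a point [e %% k.+1]. These evaluations are
    the separating functionals for [riesz]. *)
Lemma fe_eq0 k N v : (0 < N)%N -> fe_space k N v ->
  (forall e, (e < N * k.+1)%N ->
     v (node N (e %/ k.+1) + (e %% k.+1)%:R / (k.+1)%:R / N%:R) = 0) ->
  forall x, 0 <= x <= 1 -> v x = 0.
Proof.
move=> N0 [_ _ _ hv] ev x x01.
have [i iN xi] := element_of N0 x01.
have [p sp hp] := hv i iN; rewrite hp//.
suff -> : p = 0 by rewrite horner0.
pose pt (l : nat) : R := node N i + l%:R / (k.+1)%:R / N%:R.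
have NR : 0 < N%:R :> R by rewrite ltr0n.
have ptI l : (l < k.+1)%N -> node N i <= pt l <= node N i.+1.
  move=> lk; rewrite /pt nodeS lerDl lerD2l !divr_ge0//= -[leRHS]mul1r ler_pM2r ?invr_gt0//.
  by rewrite ler_pdivrMr// mul1r ler_nat ltnW.
have inj : injective pt.
  move=> a b /addrI /(mulIf _) h; have {}h := h (invr_neq0 (lt0r_neq0 NR)).
  have k0 : (k.+1)%:R != 0 :> R by rewrite pnatr_eq0.
  by have /eqP := mulIf (invr_neq0 k0) h; rewrite eqr_nat => /eqP.
apply: (@roots_geq_poly_eq0 _ p [seq pt l | l <- iota 0 k.+1]).
- apply/allP => z /mapP[l]; rewrite mem_iota add0n => /andP[_ lk] ->.
  rewrite rootE -hp ?ptI//; apply/eqP.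
  have := ev (i * k.+1 + l)%N; rewrite divnMDl// divn_small// addn0.
  rewrite modnMDl modn_small//; apply.
  by rewrite -addnS (leq_trans (leq_add (leqnn _) lk))// -mulSnr leq_mul2r iN orbT.
- by rewrite map_inj_uniq// iota_uniq.
- by rewrite size_map size_iota.
Qed.

Lemma fe_riesz k N (B : V -> V -> R) (L : V -> R) : (0 < N)%N ->
  psd_form (fe_space k N : V -> Prop) B ->
  (forall v, fe_space k N v -> (forall x, 0 <= x <= 1 -> v x = 0) -> B v v = 0) ->
  lin_on (fe_space k N : V -> Prop) L ->
  (forall v, fe_space k N v -> B v v = 0 -> L v = 0) ->
  exists2 x, fe_space k N x & forall v, fe_space k N v -> B x v = L v.
Proof.
move=> N0 fB B0 lL L0.
apply: (@riesz R V (fe_space k N) B (N * k.+1)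
  (fun e v => v (node N (e %/ k.+1) + (e %% k.+1)%:R / (k.+1)%:R / N%:R))) => //.
- exact: subsp_fe.
- by move=> v fv ev; apply: B0 => //; exact: fe_eq0 fv ev.
Qed.

End FiniteElements.

(** * Inverse inequalities by scaling from a reference element *)

Section InverseInequalities.
Context {R : realType}.
Implicit Types (f g v w : R -> R) (a b x y K C : R) (n i k N : nat) (p q : {poly R}).

Lemma bmeas_poly p : bmeas (fun x => p.[x]).
Proof. exact: antider_bmeas (antider_poly p). Qed.

Lemma integ_poly a b p : 0 <= a -> a <= b -> b <= 1 ->
  integ a b (fun x => p.[x]) = (prim_poly p).[b] - (prim_poly p).[a].
Proof.
move=> a0 ab b1; have := antider_poly (prim_poly p); rewrite deriv_prim_poly => h.
by rewrite (antiderE h a0 ab b1).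
Qed.

Definition affine_comp a h p := p \Po (a%:P + h *: 'X).

Lemma affine_compE a h p s : (affine_comp a h p).[s] = p.[a + h * s].
Proof. by rewrite horner_comp hornerD hornerC hornerZ hornerX. Qed.

Lemma integ_poly_scale a h p : 0 <= a -> 0 <= h -> a + h <= 1 ->
  integ a (a + h) (fun x => p.[x]) = h * integ 0 1 (fun s => p.[a + h * s]).
Proof.
move=> a0 h0 ah1; rewrite integ_poly ?lerDl//.
rewrite -integZ ?lexx ?ler01//; last first.
  have := bmeas_poly (affine_comp a h p); congr bmeas.
  by apply/funext => s; rewrite affine_compE.
have := antiderE (antider_poly (affine_comp a h (prim_poly p))) (lexx 0) ler01 (lexx 1).
rewrite !affine_compE mulr1 mulr0 addr0 => <-; apply: eq_integ => s _.
rewrite /affine_comp deriv_comp hornerM deriv_prim_poly derivD derivC add0r derivZ derivX.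
by rewrite hornerZ hornerC mulr1 -/(affine_comp a h p) affine_compE mulrC.
Qed.

Definition poly_ip p q : R := integ 0 1 (fun s => (p * q * 'X).[s]).

Lemma psd_poly_ip k : psd_form (fun p => (size p <= k)%N) poly_ip.
Proof.
split.
- by move=> p q _ _; rewrite /poly_ip mulrC [q * p]mulrC mulrC.
- move=> q _ c p1 p2 _ _; rewrite /poly_ip -integZ ?lexx ?ler01//; last exact: bmeas_poly.
  rewrite -integD ?lexx ?ler01//; [|exact: bmeasZ (bmeas_poly _)|exact: bmeas_poly].
  apply: eq_integ => s _; rewrite !hornerM hornerD hornerZ; ring.
- move=> p _; apply: integ_ge0 => s /andP[s0 s1].
  by rewrite !hornerM hornerX mulr_ge0// -expr2 sqr_ge0.
Qed.

Lemma poly_ip_eq0 p : poly_ip p p = 0 -> p = 0.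
Proof.
move=> p0; pose Q := prim_poly (p * p * 'X).
have bQ := bmeas_poly (p * p * 'X).
have pos x : 0 <= x -> 0 <= (p * p * 'X).[x].
  by move=> x0; rewrite !hornerM hornerX mulr_ge0// -expr2 sqr_ge0.
have Qx x : 0 <= x <= 1 -> Q.[x] - Q.[0] = 0.
  move=> /andP[x0 x1]; rewrite -(integ_poly _ (lexx 0) x0 x1).
  have h1 : 0 <= integ 0 x (fun s => (p * p * 'X).[s]).
    by apply: integ_ge0 => s /andP[s0 _]; exact: pos.
  have h2 : 0 <= integ x 1 (fun s => (p * p * 'X).[s]).
    by apply: integ_ge0 => s /andP[s0 _]; apply: pos; exact: le_trans s0.
  have := integ_cat (lexx 0) (lexx 1) bQ (c := x); rewrite x0 x1 => /(_ isT).
  by rewrite -/(poly_ip p p) p0 => e; lra.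
have Q0 : Q - Q.[0]%:P = 0.
  set n := size (Q - Q.[0]%:P).
  apply: (@roots_geq_poly_eq0 _ _ [seq node n.+1 i | i <- iota 0 n.+1] : _ -> _ -> _ -> _ = _).
  - apply/allP => z /mapP[i]; rewrite mem_iota add0n => /andP[_ ik] ->.
    rewrite rootE hornerD hornerN hornerC Qx// node_ge0/=.
    by apply: node_le1; exact: ltnW.
  - rewrite map_inj_uniq ?iota_uniq// => i j /mulIf h.
    have /eqP := h (invr_neq0 (lt0r_neq0 (ltr0Sn R n))).
    by rewrite eqr_nat => /eqP.
  - by rewrite size_map size_iota.
have : (Q - Q.[0]%:P)^`() = 0 by rewrite Q0 deriv0.
rewrite derivD derivN derivC subr0 deriv_prim_poly => /eqP.
by rewrite !mulf_eq0 polyX_eq0 orbF orbb => /eqP.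
Qed.

(** A coefficient is a linear functional on the polynomials of bounded size; Riesz representation
    and Cauchy-Schwarz take the place of compactness in the equivalence of norms. *)
Lemma poly_coef_bound k i : exists2 c, 0 <= c & forall p, (size p <= k)%N ->
  `|p`_i| <= c * Num.sqrt (poly_ip p p).
Proof.
have sS : subsp (fun p => (size p <= k)%N).
  split; first by rewrite size_poly0.
  move=> c p q sp sq; rewrite (leq_trans (size_polyD _ _))// geq_max sq andbT.
  exact: leq_trans (size_scale_leq _ _) sp.
have lc j : lin_on (fun p => (size p <= k)%N) (fun p => p`_j).
  by move=> c p q _ _; rewrite coefD coefZ.
have [x sx hx] : exists2 x : {poly R}, (size x <= k)%N &
    forall p, (size p <= k)%N -> poly_ip x p = p`_i.
  apply: (riesz (n := k) sS (psd_poly_ip k) lc).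
  - move=> p sp h; suff -> : p = 0.
      rewrite /poly_ip (eq_integ (g := fun=> 0)) ?integ_cst ?mul0r ?ler01//.
      by move=> t _; rewrite ?mul0r horner0.
    apply/polyP => j; rewrite coef0; have [jk|kj] := ltnP j k; first exact: h.
    by rewrite nth_default// (leq_trans sp).
  - exact: lc.
  - by move=> p _ /poly_ip_eq0 ->; rewrite coef0.
exists (Num.sqrt (poly_ip x x)); first exact: sqrtr_ge0.
by move=> p sp; rewrite -hx//; exact: (psd_CS_sqrt sS (psd_poly_ip k)).
Qed.

Lemma poly_sup_bound k : exists2 C, 0 < C & forall p, (size p <= k)%N -> forall s, 0 <= s <= 1 ->
  p.[s] ^+ 2 <= C * poly_ip p p /\ p^`().[s] ^+ 2 <= C * poly_ip p p.
Proof.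
have /choice[c hc] : forall i, exists c, 0 <= c /\ forall p, (size p <= k)%N ->
    `|p`_i| <= c * Num.sqrt (poly_ip p p).
  by move=> i; have [c c0 h] := poly_coef_bound k i; exists c.
pose A := \sum_(i < k) c i; pose A' := \sum_(i < k) i.+1%:R * c i.+1.
have A0 : 0 <= A by apply: sumr_ge0 => i _; case: (hc i).
have A'0 : 0 <= A' by apply: sumr_ge0 => i _; case: (hc i.+1) => ? _; rewrite mulr_ge0.
exists (A ^+ 2 + A' ^+ 2 + 1); first by rewrite ltr_wpDl// addr_ge0// sqr_ge0.
move=> p sp s /andP[s0 s1].
have B0 : 0 <= poly_ip p p by exact: (psd_ge0 (psd_poly_ip k)).
set B := poly_ip p p in B0 *.
have sB := sqr_sqrtr B0.
have spow i : 0 <= s ^+ i <= 1 by rewrite exprn_ge0//= exprn_ile1.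
have h1 : `|p.[s]| <= A * Num.sqrt B.
  rewrite (horner_coef_wide _ sp) /A mulr_suml; apply: (le_trans (ler_norm_sum _ _ _)).
  apply: ler_sum => i _; rewrite normrM.
  have [c0 /(_ p sp) hci] := hc i; have /andP[p0 p1] := spow i.
  by rewrite (ger0_norm p0); apply: le_trans hci; rewrite ler_piMr.
have h2 : `|p^`().[s]| <= A' * Num.sqrt B.
  have sp' : (size p^`() <= k)%N.
    have [->|pn0] := eqVneq p 0; first by rewrite deriv0 size_poly0.
    exact: ltnW (leq_trans (lt_size_deriv pn0) sp).
  rewrite (horner_coef_wide _ sp') /A' mulr_suml; apply: (le_trans (ler_norm_sum _ _ _)).
  apply: ler_sum => i _; rewrite normrM coef_deriv normrMn.
  have [c0 /(_ p sp) hci] := hc i.+1; have /andP[p0 p1] := spow i.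
  rewrite (ger0_norm p0).
  apply: (@le_trans _ _ (i.+1%:R * `|p`_i.+1|)).
    by rewrite -[X in X * _]mulr_natl ler_piMr// mulr_ge0.
  by rewrite -mulrA; apply: ler_wpM2l.
have sq z E : 0 <= E -> `|z| <= E * Num.sqrt B -> z ^+ 2 <= E ^+ 2 * B.
  move=> E0 hz; rewrite -real_normK ?num_real// -[in leRHS]sB -exprMn.
  by rewrite lerXn2r ?nnegrE ?mulr_ge0 ?sqrtr_ge0.
have := sq _ _ A0 h1; have := sq _ _ A'0 h2.
have := mulr_ge0 (sqr_ge0 A) B0; have := mulr_ge0 (sqr_ge0 A') B0.
by split; rewrite !mulrDl; lra.
Qed.

Lemma size_affine_comp a h p k : (size p <= k)%N -> (size (affine_comp a h p) <= k)%N.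
Proof.
move=> sp; rewrite /affine_comp.
have [->|pn0] := eqVneq p 0; first by rewrite comp_poly0 size_poly0.
have s2 : (size (a%:P + h *: 'X)%R <= 2)%N.
  rewrite (leq_trans (size_polyD _ _))// geq_max (leq_trans (size_polyC_leq1 _))//=.
  by rewrite (leq_trans (size_scale_leq _ _))// size_polyX.
have s1 : (0 < size p)%N by rewrite size_poly_gt0.
apply: leq_trans (size_comp_poly_leq _ _) _; apply: leq_trans sp.
rewrite -{2}(prednK s1) ltnS -[leqRHS]muln1 leq_mul2l; apply/orP; right.
by move: s2; case: (size _) => [//|[|[|]]].
Qed.

(** In the coordinate s of the element the weight satisfies [a + h s >= (a + h) s], so the bounds on
    the reference interval with weight s transfer uniformly in [a], down to the element at the
    origin. *)
Lemma poly_element_bound k : exists2 C, 0 < C & forall p, (size p <= k)%N ->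
  forall a h, 0 <= a -> 0 < h -> a + h <= 1 -> forall r, a <= r <= a + h ->
  h * (a + h) * p.[r] ^+ 2 <= C * integ a (a + h) (fun r => p.[r] ^+ 2 * r) /\
  h ^+ 3 * (a + h) * p^`().[r] ^+ 2 <= C * integ a (a + h) (fun r => p.[r] ^+ 2 * r).
Proof.
have [C C0 hC] := poly_sup_bound k; exists C => // p sp a h a0 h0 ah1 r /andP[ar rh].
pose P := affine_comp a h p.
have sP : (size P <= k)%N by exact: size_affine_comp.
pose s := (r - a) / h.
have s01 : 0 <= s <= 1.
  by rewrite /s divr_ge0 ?subr_ge0 ?(ltW h0)//= ler_pdivrMr// mul1r lerBlDl.
have rE : a + h * s = r by rewrite /s mulrC divfK ?gt_eqF// addrC subrK.
have [h1 h2] := hC P sP s s01.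
have P1 : P.[s] = p.[r] by rewrite affine_compE rE.
have P2 : P^`().[s] = h * p^`().[r].
  rewrite /P /affine_comp deriv_comp hornerM derivD derivC add0r derivZ derivX hornerZ hornerC mulr1.
  by rewrite -/(affine_comp a h _) affine_compE rE mulrC.
rewrite P1 in h1; rewrite P2 in h2.
have key : h * (a + h) * poly_ip P P <= integ a (a + h) (fun r => p.[r] ^+ 2 * r).
  rewrite (eq_integ (g := fun r => (p ^+ 2 * 'X).[r])); last first.
    by move=> x _; rewrite hornerM horner_exp hornerX.
  rewrite integ_poly_scale ?(ltW h0)// -[leLHS]mulrA ler_pM2l// /poly_ip.
  rewrite -integZ ?lexx ?ler01//; last exact: bmeas_poly.
  apply: integ_le; rewrite ?lexx ?ler01//.
  - exact: bmeasZ (bmeas_poly _).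
  - have := bmeas_poly (affine_comp a h (p ^+ 2 * 'X)); congr bmeas.
    by apply/funext => t; rewrite affine_compE.
  - move=> t /andP[t0 t1]; rewrite !hornerM !affine_compE !hornerX.
    rewrite mulrCA; apply: ler_wpM2l; first by rewrite -expr2 sqr_ge0.
    by rewrite mulrDl lerD2r ler_piMr.
have hah : 0 <= h * (a + h) by rewrite mulr_ge0 ?addr_ge0// ltW.
split.
  apply: (le_trans (ler_wpM2l hah h1)); rewrite mulrCA; apply: ler_wpM2l => //; exact: ltW.
have -> : h ^+ 3 * (a + h) * p^`().[r] ^+ 2 = h * (a + h) * (h * p^`().[r]) ^+ 2 by ring.
apply: (le_trans (ler_wpM2l hah h2)); rewrite mulrCA; apply: ler_wpM2l => //; exact: ltW.
Qed.

Lemma H1r_density_diag v g r : 0 <= r -> H1r_density v g v g r = g r ^+ 2 * r + v r ^+ 2 / r.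
Proof.
move=> r0; rewrite /H1r_density -expr2; congr (_ + _).
have [->|rn0] := eqVneq r 0; first by rewrite invr0 !mulr0.
by field.
Qed.

(** The derivative part is the local bound. For [v / r] there are two cases: away from the origin
    [r >= h], so |v| / r is at most N |v|; on the first element [v 0 = 0] reduces it to a bound on
    the derivative. *)
Lemma fe_inverse k : exists2 C, 0 < C & forall N v, (0 < N)%N -> fe_space k N v ->
  ipH1r v v <= C * N%:R ^+ 2 * ip0r v v.
Proof.
have [C C0 hC] := poly_element_bound k.+1.
exists (2 * C + 1); first by lra.
move=> N v N0 fv; have [g [p [vg vp gp]]] := fe_has_deriv N0 fv.
have v0 : v 0 = 0 by case: fv.
have bv := antider_bmeas vg; have bg := vg.1; have bI := @bmeas_id R.
have bd := bmeas_H1r_density vg v0 vg v0.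
have bvv : bmeas (fun r => v r * v r * r) by exact: bmeasM (bmeasM bv bv) bI.
have ie f : bmeas f -> integ 0 1 f = \sum_(i < N) integ (node N i) (node N i.+1) f.
  by move=> bf; rewrite -(integ_elements (leqnn N) bf) nodeNN.
rewrite (ipH1rE vg v0 vg v0) ip0rE (ie _ bd) (ie _ bvv) mulr_sumr.
apply: ler_sum => i _; have iN := ltn_ord i.
have [sp hp] := vp i iN; have hg := gp i iN.
have NR : 0 < N%:R :> R by rewrite ltr0n.
set h := N%:R^-1 : R; have h0 : 0 < h by rewrite invr_gt0.
have Nh : N%:R * h = 1 :> R by rewrite /h mulfV// gt_eqF.
set a := node N i; have a0 : 0 <= a by exact: node_ge0.
have eb : node N i.+1 = a + h by rewrite nodeS.
have b1 : a + h <= 1 by rewrite -eb; exact: node_le1.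
rewrite eb in hp hg *.
have ib : integ a (a + h) (fun r => v r * v r * r) = integ a (a + h) (fun r => (p i).[r] ^+ 2 * r).
  by apply: eq_integ => r hr; rewrite hp.
set Q := integ a (a + h) (fun r => v r * v r * r) in ib *.
have Q0 : 0 <= Q.
  apply: integ_ge0 => r /andP[ar _]; rewrite -expr2 mulr_ge0 ?sqr_ge0//; exact: le_trans ar.
have hC' r : a <= r <= a + h -> h ^+ 3 * (a + h) * (p i)^`().[r] ^+ 2 <= C * Q.
  by move=> hr; rewrite ib; have [] := hC (p i) sp a h a0 h0 b1 r hr.
have ah : 0 < a + h by rewrite ltr_wpDl.
(* A pointwise bound for the squared derivative on the element, normalized so that
   [W (a + h) h = C N^2 Q]. *)
pose W := C * N%:R ^+ 2 * Q / (h * (a + h)).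
have W0 : 0 <= W.
  apply: divr_ge0; first by apply: mulr_ge0 => //; apply: mulr_ge0; [exact: ltW|exact: sqr_ge0].
  by apply: mulr_ge0; exact: ltW.
have dW r : a <= r <= a + h -> (p i)^`().[r] ^+ 2 <= W.
  move=> /hC' hr; rewrite /W ler_pdivlMr ?mulr_gt0//.
  have := ler_wpM2l (sqr_ge0 N%:R) hr.
  have -> : N%:R ^+ 2 * (h ^+ 3 * (a + h) * (p i)^`().[r] ^+ 2) =
    (N%:R * h) ^+ 2 * ((p i)^`().[r] ^+ 2 * (h * (a + h))) by ring.
  by rewrite Nh expr1n mul1r [N%:R ^+ 2 * (C * Q)]mulrCA !mulrA.
have WE : W * (a + h) * (a + h - a) = C * N%:R ^+ 2 * Q.
  by rewrite /W; field; rewrite !gt_eqF.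
have part1 : integ a (a + h) (fun r => g r ^+ 2 * r) <= C * N%:R ^+ 2 * Q.
  rewrite -WE -(@integ_cst _ a (a + h)) ?lerDl ?(ltW h0)//.
  rewrite (eq_integ_oo (g := fun r => (p i)^`().[r] ^+ 2 * r)) //; last first.
  - by move=> r hr; rewrite hg.
  - by apply: bmeasM => //; apply: bmeasX; exact: bmeas_poly.
  - by apply: bmeasM => //; exact: bmeasX.
  apply: integ_le => //; [by apply: bmeasM => //; apply: bmeasX; exact: bmeas_poly|exact: bmeas_cst|].
  move=> r hr; have /andP[ar rb] := hr; apply: ler_pM => //; [exact: sqr_ge0|exact: le_trans ar|exact: dW].
have part2 : integ a (a + h) (fun r => v r ^+ 2 / r) <= (C + 1) * N%:R ^+ 2 * Q.
  have bvr : bmeas (fun r => v r ^+ 2 / r).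
    have := bmeasM (lip0_div_bmeas (fe_lip0 N0 fv)) bv; congr bmeas.
    by apply/funext => r; rewrite expr2 mulrAC.
  have NQ : 0 <= N%:R ^+ 2 * Q by rewrite mulr_ge0// sqr_ge0.
  have [i0|i0] := posnP i.
    have a00 : a = 0 by rewrite /a i0 node0.
    apply: (@le_trans _ _ (C * N%:R ^+ 2 * Q)); last by rewrite -!mulrA ler_wpM2r//; lra.
    rewrite -WE -(@integ_cst _ a (a + h)) ?lerDl ?(ltW h0)//.
    apply: integ_le => //; first exact: bmeas_cst.
    move=> r hr; have /andP[ar rb] := hr.
    have [->|rn0] := eqVneq r 0; first by rewrite invr0 mulr0 mulr_ge0// ltW.
    have rp : 0 < r by rewrite lt_neqAle eq_sym rn0 (le_trans a0 ar).
    rewrite ler_pdivrMr//.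
    have h1 : `|v r| <= Num.sqrt W * r.
      have e0 : v r - v 0 = (p i).[r] - (p i).[0].
        by rewrite (hp r hr) (hp 0)//; apply/andP; split; [rewrite -/a a00|exact: ltW].
      rewrite -[v r]subr0 -v0 e0 -[X in _ * X]subr0.
      apply: (antider_bound (antider_poly (p i))) => //; [exact: ltW|exact: le_trans rb _|].
      move=> t /andP[t0 tr]; rewrite -sqrtr_sqr ler_wsqrtr// dW// a00 t0/= -a00.
      exact: le_trans rb.
    rewrite -real_normK ?num_real//; apply: (@le_trans _ _ ((Num.sqrt W * r) ^+ 2)).
      by rewrite lerXn2r ?nnegrE ?mulr_ge0 ?sqrtr_ge0// ltW.
    rewrite exprMn sqr_sqrtr// -[leRHS]mulrA; apply: ler_wpM2l => //.
    by rewrite expr2 ler_pM2r.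
  have ha : h <= a.
    by rewrite /a /node /h -[leLHS]mul1r ler_pM2r// ler1n.
  apply: (@le_trans _ _ (N%:R ^+ 2 * Q)); last first.
    by rewrite -mulrA -[leLHS]mul1r ler_wpM2r//; lra.
  rewrite /Q -integZ//; apply: integ_le => //; first exact: bmeasZ.
  move=> r /andP[ar rb]; have rp : 0 < r by apply: lt_le_trans h0 _; exact: le_trans ar.
  rewrite ler_pdivrMr// -expr2.
  rewrite (_ : N%:R ^+ 2 * _ * r = v r ^+ 2 * (N%:R * r) ^+ 2); last by ring.
  rewrite ler_peMr ?sqr_ge0// -[leLHS](expr1n _ 2) lerXn2r ?nnegrE ?mulr_ge0 ?(ltW rp)//.
  by rewrite -[leLHS]Nh ler_pM2l// (le_trans ha).
rewrite (eq_integ (g := fun r => g r ^+ 2 * r + v r ^+ 2 / r)); last first.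
  by move=> r /andP[ar _]; rewrite H1r_density_diag// (le_trans a0).
rewrite integD//.
- apply: (le_trans (lerD part1 part2)); rewrite -mulrDl -mulrDl.
  by rewrite (_ : C + (C + 1) = 2 * C + 1)//; ring.
- by apply: bmeasM => //; exact: bmeasX.
- have := bmeasM (lip0_div_bmeas (fe_lip0 N0 fv)) bv; congr bmeas.
  by apply/funext => r; rewrite expr2 mulrAC.
Qed.

(** The derivative is itself a polynomial on each element, so its square is at most [C N^2] times
    [ipH1r v v]; integration from 0, where [v] vanishes, gives the factor [r]. *)
Lemma fe_pointwise k : exists2 C, 0 < C & forall N v, (0 < N)%N -> fe_space k N v ->
  forall r, 0 <= r <= 1 -> v r ^+ 2 <= C * N%:R ^+ 2 * ipH1r v v * r ^+ 2.
Proof.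
have [C C0 hC] := poly_element_bound k.+1.
exists C => // N v N0 fv; have [g [p [vg vp gp]]] := fe_has_deriv N0 fv.
have v0 : v 0 = 0 by case: fv.
have bv := antider_bmeas vg; have bg := vg.1; have bI := @bmeas_id R.
have bd := bmeas_H1r_density vg v0 vg v0.
have bgg : bmeas (fun r => g r ^+ 2 * r) by apply: bmeasM => //; exact: bmeasX.
have NR : 0 < N%:R :> R by rewrite ltr0n.
set h := N%:R^-1 : R; have h0 : 0 < h by rewrite invr_gt0.
have Nh : N%:R * h = 1 :> R by rewrite /h mulfV// gt_eqF.
set A := ipH1r v v.
have A0 : 0 <= A by exact: (psd_ge0 psd_ipH1r (fe_lip0 N0 fv)).
have dens r : 0 <= r -> g r ^+ 2 * r <= H1r_density v g v g r.
  by move=> r0; rewrite H1r_density_diag// lerDl divr_ge0// sqr_ge0.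
have der i : (i < N)%N -> forall r, node N i <= r <= node N i.+1 ->
    (p i)^`().[r] ^+ 2 <= C * N%:R ^+ 2 * A.
  move=> iN r hr; have [sp hp] := vp i iN; have hg := gp i iN.
  have eb : node N i.+1 = node N i + h by rewrite nodeS.
  have a0 : 0 <= node N i :> R by exact: node_ge0.
  have b1 : node N i + h <= 1 by rewrite -eb; exact: node_le1.
  rewrite eb in hr hg.
  have sp' : (size (p i)^`() <= k.+1)%N.
    have [->|pn0] := eqVneq (p i) 0; first by rewrite deriv0 size_poly0.
    exact: ltnW (leq_trans (lt_size_deriv pn0) sp).
  have [h1 _] := hC _ sp' _ h a0 h0 b1 r hr.
  have e1 : integ (node N i) (node N i + h) (fun r => (p i)^`().[r] ^+ 2 * r) <= A.
    rewrite -(eq_integ_oo a0 b1 bgg); last first.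
    - by move=> t ht; rewrite hg.
    - by apply: bmeasM => //; apply: bmeasX; exact: bmeas_poly.
    apply: (@le_trans _ _ (integ (node N i) (node N i + h) (H1r_density v g v g))).
      by apply: integ_le => // t /andP[at_ _]; apply: dens; exact: le_trans at_.
    rewrite /A (ipH1rE vg v0 vg v0).
    have dpos x y : 0 <= x -> 0 <= integ x y (H1r_density v g v g).
      move=> x0; apply: integ_ge0 => t /andP[xt _]; have t0 := le_trans x0 xt.
      by apply: le_trans (dens t t0); rewrite mulr_ge0// sqr_ge0.
    have ab : node N i <= node N i + h by rewrite lerDl ltW.
    rewrite (integ_cat (lexx 0) (lexx 1) bd (c := node N i)); last by rewrite a0 (le_trans ab).
    rewrite (integ_cat a0 (lexx 1) bd (c := node N i + h)) ?ab//.
    by have := dpos 0 (node N i) (lexx 0); have := dpos _ 1 (le_trans a0 ab); lra.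
  have h2 : h * h * (p i)^`().[r] ^+ 2 <= C * A.
    apply: (@le_trans _ _ (h * (node N i + h) * (p i)^`().[r] ^+ 2)).
      by apply: ler_wpM2r; [exact: sqr_ge0|rewrite ler_pM2l// lerDr].
    by apply: (le_trans h1); rewrite ler_pM2l.
  have := ler_wpM2l (sqr_ge0 N%:R) h2.
  have -> : N%:R ^+ 2 * (h * h * (p i)^`().[r] ^+ 2) = (N%:R * h) ^+ 2 * (p i)^`().[r] ^+ 2 by ring.
  by rewrite Nh expr1n mul1r mulrCA !mulrA.
set G := Num.sqrt (C * N%:R ^+ 2 * A).
have CA0 : 0 <= C * N%:R ^+ 2 * A by rewrite !mulr_ge0// ltW.
have step i x y : (i < N)%N -> node N i <= x -> x <= y -> y <= node N i.+1 -> `|v y - v x| <= G * (y - x).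
  move=> iN ix xy yi; have [sp hp] := vp i iN.
  have -> : v y - v x = (p i).[y] - (p i).[x].
    by rewrite !hp ?ix ?(le_trans xy)// yi (le_trans ix).
  apply: (antider_bound (antider_poly (p i))) => //.
  - exact: le_trans (node_ge0 N i) ix.
  - exact: le_trans yi (node_le1 iN).
  - move=> t /andP[xt ty]; rewrite /G -sqrtr_sqr ler_wsqrtr// der// (le_trans ix xt)/=.
    exact: le_trans yi.
move=> r r01; have h3 := lip_nodes N0 step r01; rewrite v0 subr0 in h3.
rewrite -real_normK ?num_real// -(sqr_sqrtr CA0) -/G -exprMn lerXn2r ?nnegrE//.
by rewrite mulr_ge0 ?sqrtr_ge0//; case/andP: r01.
Qed.

End InverseInequalities.

(** * Interpolation and the Ritz projection *)

Ltac bm := repeat first [assumption | exact: bmeas_id | apply: bmeas_cst | apply: bmeasD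
  | apply: bmeasN | apply: bmeasX | apply: bmeasM].

Section Interpolation.
Context {R : realType}.
Implicit Types (f g v w : R -> R) (a b x y K C : R) (n i k N : nat) (p q : {poly R}).

Lemma integ_le_oo a b f g : 0 <= a -> b <= 1 -> bmeas f -> bmeas g ->
  (forall x, a < x < b -> f x <= g x) -> integ a b f <= integ a b g.
Proof.
move=> a0 b1 bf bg fg.
(* The minimum of [f] and [g]: it agrees with [f] inside the interval and lies below [g] at the end
   points as well. *)
pose s x := 2^-1 * (f x + g x - `|f x - g x|).
have bs : bmeas s by apply: bmeasM; [bm|apply: bmeasB; [bm|apply: bmeas_norm; bm]].
rewrite (eq_integ_oo a0 b1 bf bs); last first.
  by move=> x /fg h; rewrite /s ler0_norm ?subr_le0//; field.
apply: integ_le => // x _; rewrite /s.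
by have := ler_norm (f x - g x); lra.
Qed.

Lemma integ_nodes N f : (0 < N)%N -> bmeas f ->
  integ 0 1 f = \sum_(i < N) integ (node N i) (node N i.+1) f.
Proof. by move=> N0 bf; rewrite -(integ_elements (leqnn N) bf) nodeNN. Qed.

Lemma glue_fe k N (P : nat -> {poly R}) w g : (0 < N)%N -> antider w g ->
  (forall i, (i < N)%N -> (size (P i) <= k.+1)%N) ->
  (forall i, (i < N)%N -> forall r, node N i <= r <= node N i.+1 -> w r = (P i).[r]) ->
  (P 0%N).[0] = 0 -> (P N.-1).[1] = 0 -> fe_space k N w.
Proof.
move=> N0 wg sP wP P0 P1; split.
- exact: antider_continuous wg.
- by rewrite (wP 0%N)// node0 lexx node_ge0.
- rewrite (wP N.-1) ?prednK// nodeNN// lexx node_le1// leq_pred//.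
- by move=> i iN; exists (P i); [exact: sP|exact: wP].
Qed.

Lemma H1r_le_nodes N v g F : (0 < N)%N -> antider v g -> v 0 = 0 ->
  (forall i, (i < N)%N -> integ (node N i) (node N i.+1) (fun r => g r ^+ 2 * r + v r ^+ 2 / r) <= F i) ->
  ipH1r v v <= \sum_(i < N) F i.
Proof.
move=> N0 vg v0 H; have bd := bmeas_H1r_density vg v0 vg v0.
rewrite (ipH1rE vg v0 vg v0) (integ_nodes N0 bd); apply: ler_sum => i _.
apply: le_trans (H i (ltn_ord i)); rewrite le_eqVlt; apply/orP; left; apply/eqP.
apply: eq_integ => r /andP[ar _]; rewrite H1r_density_diag//.
exact: le_trans (node_ge0 N i) ar.
Qed.

(** The construction begins with the derivative: on each element take a polynomial approximation of
    v', its primitive through the left nodal value, and a linear correction for the right one. The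
    correction slope is a mean of the derivative error, hence of the same order; [v - w] then has
    slope at most [2 M h^k] and vanishes at 0. *)
Lemma interpolant k M v Q N : (1 <= k)%N -> smooth_chain k M v Q -> v 0 = 0 -> v 1 = 0 -> (0 < N)%N ->
  exists2 w, fe_space k N w & lip0 (fun r => v r - w r) /\
    (forall r, 0 <= r <= 1 -> `|v r - w r| <= 2 * M * N%:R^-1 ^+ k * r) /\
    ipH1r (fun r => v r - w r) (fun r => v r - w r) <= 2 * (2 * M * N%:R^-1 ^+ k) ^+ 2.
Proof.
move=> k1 cQ v0 v1 N0; have [Q0 aQ QM] := cQ.
have M0 : 0 <= M by apply: le_trans (QM 1%N 0 _ _); rewrite ?lexx ?ler01.
have vQ : antider v (Q 1%N).
  by apply: (eq_antider (aQ 0%N isT)) => // x x01; exact: Q0.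
set h := N%:R^-1 : R; have h0 : 0 < h by rewrite invr_gt0 ltr0n.
have nS i : node N i.+1 = node N i + h :> R by exact: nodeS.
have /choice[p hp] : forall i, exists p, (i < N)%N -> (size p <= k)%N /\
    forall x, node N i <= x <= node N i.+1 -> `|Q 1%N x - p.[x]| <= M * h ^+ k.
  move=> i; have [iN|iN] := ltnP i N; last by exists 0.
  have [p sp Hp] := chain_poly_approx cQ (node_ge0 N i) (node_le N (leqnSn i)) (node_le1 iN).
  by exists p => _; split => // x /Hp; rewrite nS [_ + h]addrC addrK.
pose a i : R := node N i.
pose lam i := (v (a i.+1) - v (a i) - ((prim_poly (p i)).[a i.+1] - (prim_poly (p i)).[a i])) / h.
pose P i := prim_poly (p i) + (v (a i) - (prim_poly (p i)).[a i])%:P + lam i *: ('X - (a i)%:P).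
have PE i r : (P i).[r] = (prim_poly (p i)).[r] + (v (a i) - (prim_poly (p i)).[a i]) + lam i * (r - a i).
  by rewrite /P !hornerD hornerZ hornerD hornerN hornerX !hornerC.
have dP i : (P i)^`() = p i + (lam i)%:P.
  by rewrite /P !derivD derivC addr0 deriv_prim_poly derivZ derivB derivX derivC subr0 alg_polyC.
have aE i : a i.+1 - a i = h by rewrite /a nS addrC addKr.
have Pa i : (P i).[a i] = v (a i) by rewrite PE; ring.
have Pb i : (P i).[a i.+1] = v (a i.+1).
  by rewrite PE /lam aE divfK ?gt_eqF//; ring.
have [w [g [wg wP gP]]] : exists w g, [/\ antider w g,
    forall i, (i < N)%N -> forall r, node N i <= r <= node N i.+1 -> w r = (P i).[r] &
    forall i, (i < N)%N -> forall r, node N i < r < node N i.+1 -> g r = (P i)^`().[r]].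
  apply: (@glue_poly _ N P (fun i => v (a i))) => //.
  by rewrite /a node0.
have sP i : (i < N)%N -> (size (P i) <= k.+1)%N.
  move=> iN; have [sp _] := hp i iN.
  rewrite /P (leq_trans (size_polyD _ _))// geq_max; apply/andP; split.
    rewrite (leq_trans (size_polyD _ _))// geq_max (leq_trans (size_polyC_leq1 _)) ?andbT//.
    exact: leq_trans (size_prim_poly _) _.
  by rewrite (leq_trans (size_scale_leq _ _))// size_XsubC.
have lamb i : (i < N)%N -> `|lam i| <= M * h ^+ k.
  move=> iN; have [_ Hp] := hp i iN.
  have dd : antider (fun x => v x - (prim_poly (p i)).[x]) (fun x => Q 1%N x - (p i).[x]).
    by have := antiderB vQ (antider_poly (prim_poly (p i))); rewrite deriv_prim_poly.
  have := antider_bound dd (node_ge0 N i) (node_le N (leqnSn i)) (node_le1 iN) Hp.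
  rewrite -/(a i) -/(a i.+1) aE => hb.
  rewrite /lam normrM normfV (gtr0_norm h0) ler_pdivrMr//.
  by apply: le_trans hb; rewrite le_eqVlt; apply/orP; left; apply/eqP; congr (`|_|); ring.
set K := 2 * M * h ^+ k.
have dK i x : (i < N)%N -> node N i <= x <= node N i.+1 -> `|Q 1%N x - (P i)^`().[x]| <= K.
  move=> iN hx; rewrite dP hornerD hornerC opprD addrA.
  apply: (le_trans (ler_normB _ _)); have := lamb i iN; have [_ /(_ x hx)] := hp i iN.
  by rewrite /K; lra.
have ew := antiderB vQ wg.
have pt r : 0 <= r <= 1 -> `|v r - w r| <= K * r.
  have w0 : w 0 = 0 by rewrite (wP 0%N)// ?node0 ?lexx ?node_ge0//; have := Pa 0%N; rewrite /a node0 v0.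
  move=> r01; have := @lip_nodes _ N (fun r => v r - w r) K N0 _ r r01.
  rewrite v0 w0 !subr0; apply => i x y iN ix xy yi.
  rewrite !(wP i) ?ix ?yi ?(le_trans xy yi) ?(le_trans ix xy)//.
  apply: (antider_bound (antiderB vQ (antider_poly (P i)))) => //.
  - exact: le_trans (node_ge0 N i) ix.
  - exact: le_trans yi (node_le1 iN).
  - by move=> t /andP[xt ty]; apply: dK => //; rewrite (le_trans ix)// (le_trans ty).
have K0 : 0 <= K by rewrite !mulr_ge0// exprn_ge0// ltW.
have l0 : (fun r => v r - w r) 0 = 0.
  by apply/eqP; rewrite -normr_le0; apply: le_trans (pt 0 _) _; rewrite ?lexx ?ler01 ?mulr0.
exists w; first by apply: (glue_fe N0 wg sP wP); [have := Pa 0%N; rewrite /a node0 v0|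
  have := Pb N.-1; rewrite prednK// /a nodeNN// v1].
split; first by split => //; exists (fun x => Q 1%N x - g x).
split => //.
have bb : bmeas (fun r => (v r - w r) / r) by apply: lip0_div_bmeas; split => //; exists (fun x => Q 1%N x - g x).
have be := antider_bmeas ew; have bde := ew.1; have bI := @bmeas_id R.
have bv := antider_bmeas vQ; have bw := antider_bmeas wg; have bQ := vQ.1; have bg := wg.1.
apply: (le_trans (@H1r_le_nodes N _ _ (fun i => 2 * K ^+ 2 * h) N0 ew l0 _)); last first.
  by rewrite sumr_const card_ord -[X in X <= _]mulr_natr -mulrA /h mulVf ?mulr1// pnatr_eq0 -lt0n.
move=> i iN.
rewrite -[X in _ <= _ * X](aE i) -integ_cst ?node_le//.
apply: integ_le_oo; [exact: node_ge0|exact: node_le1| |bm|].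
  have := bmeasD (bmeasM (bmeasX 2 bde) bI) (bmeasM be bb).
  by congr bmeas; apply/funext => r; rewrite [in RHS]expr2 mulrA.
move=> r hr; have /andP[ir ri] := hr.
have r0 : 0 < r by apply: le_lt_trans ir; exact: node_ge0.
have r1 : r <= 1 by apply: le_trans (ltW ri) _; exact: node_le1.
have d1 : `|Q 1%N r - g r| <= K.
  by rewrite (gP i)//; apply: dK => //; rewrite !ltW.
have d2 : `|v r - w r| <= K * r by apply: pt; rewrite r1 ltW.
have s1 : (Q 1%N r - g r) ^+ 2 <= K ^+ 2.
  by rewrite -real_normK ?num_real// lerXn2r ?nnegrE.
have s2 : (v r - w r) ^+ 2 <= (K * r) ^+ 2.
  by rewrite -real_normK ?num_real// lerXn2r ?nnegrE// mulr_ge0// ltW.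
have s3 : (v r - w r) ^+ 2 / r <= K ^+ 2.
  rewrite ler_pdivrMr//; apply: le_trans s2 _; rewrite exprMn.
  by apply: ler_wpM2l; [exact: sqr_ge0|rewrite expr2 ler_piMl// ltW].
have s4 : (Q 1%N r - g r) ^+ 2 * r <= K ^+ 2.
  by apply: le_trans s1; rewrite ler_piMr// sqr_ge0.
lra.
Qed.

(* [E] vanishes at both ends, so [int F^2 r = - int E g r], and [int E^2 r <= 4 (b - a)^2 int F^2 r] because
   [r (r - a)] has derivative at least [r]. *)
Lemma elem_H1 a b E F g : 0 <= a -> a < b -> b <= 1 -> antider E F -> antider F g ->
  E a = 0 -> E b = 0 ->
  integ a b (fun r => F r ^+ 2 * r) <= 4 * (b - a) ^+ 2 * integ a b (fun r => g r ^+ 2 * r) /\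
  integ a b (fun r => E r ^+ 2 * r) <= 16 * (b - a) ^+ 4 * integ a b (fun r => g r ^+ 2 * r).
Proof.
move=> a0 ab b1 EF Fg Ea Eb.
have bE := antider_bmeas EF; have bF := EF.1; have bg := Fg.1; have bI := @bmeas_id R.
set h := b - a; have h0 : 0 < h by rewrite subr_gt0.
set A := integ a b (fun r => E r ^+ 2 * r); set B := integ a b (fun r => F r ^+ 2 * r).
set G := integ a b (fun r => g r ^+ 2 * r).
have bA : bmeas (fun r => E r ^+ 2 * r) by bm.
have bB : bmeas (fun r => F r ^+ 2 * r) by bm.
have bG : bmeas (fun r => g r ^+ 2 * r) by bm.
have AB : A <= 4 * h ^+ 2 * B.
  have w := antiderM (antiderM EF EF) (antiderM antider_id (antiderB antider_id (antider_cst a))).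
  have := antiderE w a0 (ltW ab) b1; rewrite Ea Eb !mul0r subrr => /esym e.
  have l : integ a b (fun r => 2^-1 * (E r ^+ 2 * r) - 2 * h ^+ 2 * (F r ^+ 2 * r)) <= 0.
    rewrite [leRHS]e; apply: integ_le => //; [by bm|by case: w|].
    move=> r /andP[ar rb]; rewrite -subr_ge0.
    have r0 := le_trans a0 ar.
    rewrite (_ : _ - _ = 2^-1 * (r * (E r + 2 * (r - a) * F r) ^+ 2) + E r ^+ 2 * (r - a) +
      2 * (r * (h - (r - a)) * (h + (r - a)) * F r ^+ 2)); last by field.
    have p1 : 0 <= r - a by rewrite subr_ge0.
    have p2 : 0 <= h - (r - a) by rewrite /h; lra.
    have p3 : 0 <= h + (r - a) by rewrite addr_ge0// ltW.
    have q1 := mulr_ge0 r0 (sqr_ge0 (E r + 2 * (r - a) * F r)).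
    have q2 := mulr_ge0 (sqr_ge0 (E r)) p1.
    have q3 := mulr_ge0 (mulr_ge0 (mulr_ge0 r0 p2) p3) (sqr_ge0 (F r)).
    by lra.
  rewrite integB// in l; [|by bm|by bm].
  rewrite !integZ// -/A -/B in l; lra.
have BG : B <= 4 * h ^+ 2 * G.
  (* The derivative of [E F r - E^2 / 2] is [F^2 r + E g r]: the second term removes the [E F]
     produced by the weight. *)
  have w := antiderB (antiderM (antiderM EF Fg) antider_id) (antiderZ 2^-1 (antiderM EF EF)).
  have := antiderE w a0 (ltW ab) b1; rewrite Ea Eb !mul0r mulr0 !subr0 => /esym e.
  have l : integ a b (fun r => 8 * h ^+ 2 * (F r ^+ 2 * r) - (E r ^+ 2 * r) - 16 * h ^+ 4 * (g r ^+ 2 * r))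
      <= 8 * h ^+ 2 * 0.
    rewrite [X in _ <= _ * X]e -integZ//; last by case: w.
    apply: integ_le => //; [by bm|by apply: bmeasZ; case: w|].
    move=> r /andP[ar rb]; rewrite -subr_ge0.
    have r0 := le_trans a0 ar.
    rewrite (_ : _ - _ = (E r + 4 * h ^+ 2 * g r) ^+ 2 * r); last by field.
    by rewrite mulr_ge0// sqr_ge0.
  rewrite integB// in l; [|by bm|by bm]; rewrite integB// in l; [|by bm].
  rewrite !integZ// -/A -/B -/G mulr0 in l.
  have h2 : 0 < h ^+ 2 by rewrite exprn_gt0.
  rewrite -(ler_pM2l h2); have e4 : h ^+ 4 = h ^+ 2 * h ^+ 2 by ring.
  rewrite e4 in l; lra.
split => //; apply: (le_trans AB).
have := ler_wpM2l (sqr_ge0 h) BG; rewrite (_ : h ^+ 4 = h ^+ 2 * h ^+ 2); last by ring.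
by lra.
Qed.

(** Integrate the derivative of [(r m)^2], a function that vanishes at 0 and at h, and complete the
    square. On the element at the origin the interpolation error of [r m], divided by r, is
    [m - m h], to which this applies. *)
Lemma first_elem (h : R) (m nu : R -> R) : 0 <= h -> h <= 1 -> antider m nu -> m h = 0 ->
  integ 0 h (fun r => m r ^+ 2 * r) <= h ^+ 2 * integ 0 h (fun r => nu r ^+ 2 * r).
Proof.
move=> h0 h1 mn mh.
have bm' := antider_bmeas mn; have bn := mn.1; have bI := @bmeas_id R.
have w := antiderM (antiderM mn mn) (antiderM antider_id antider_id).
have := antiderE w (lexx 0) h0 h1; rewrite mh !(mul0r, mulr0) subrr => /esym e.
have l : integ 0 h (fun r => m r ^+ 2 * r - r ^+ 2 * (nu r ^+ 2 * r)) <= 0.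
  rewrite [leRHS]e; apply: integ_le => //; [by bm|by case: w|].
  move=> r /andP[r0 rh]; rewrite -subr_ge0.
  rewrite (_ : _ - _ = (m r + r * nu r) ^+ 2 * r); last by ring.
  by rewrite mulr_ge0// sqr_ge0.
rewrite integB// in l; [|by bm|by bm].
rewrite -integZ//; last by bm.
apply: (@le_trans _ _ (integ 0 h (fun r => r ^+ 2 * (nu r ^+ 2 * r)))); first by lra.
apply: integ_le => //; [by bm|by bm|].
move=> r /andP[r0 rh]; apply: ler_wpM2r; first by rewrite mulr_ge0// sqr_ge0.
by rewrite lerXn2r.
Qed.

End Interpolation.

(** * Dual problem, Ritz projection and Aubin-Nitsche estimate *)

Section RitzProjection.
Context {R : realType}.
Implicit Types (f g v w m nu rho u z X : R -> R) (a b x y K C : R) (n i k N : nat).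
Local Notation V := (R -> R^o).

Lemma integ_cube_le f K r : 0 <= r -> r <= 1 -> bmeas f ->
  (forall x, 0 <= x <= r -> `|f x| <= K * x ^+ 3) -> `|integ 0 r f| <= K / 4 * r ^+ 4.
Proof.
move=> r0 r1 bf fK; have bI := @bmeas_id R.
have e : K / 4 * r ^+ 4 = integ 0 r (fun x => K * x ^+ 3).
  have w := antiderM (antiderM antider_id antider_id) (antiderM antider_id (@antider_id R)).
  have := antiderE (antiderZ (K / 4) w) (lexx 0) r0 r1.
  rewrite !mul0r mulr0 subr0 => h.
  rewrite (_ : r ^+ 4 = r * r * (r * r)); last by ring.
  by rewrite -h; apply: eq_integ => x _; field.
have h x : 0 <= x <= r -> - (K * x ^+ 3) <= f x <= K * x ^+ 3 by move=> /fK; rewrite ler_norml.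
rewrite ler_norml e -mulN1r -integZ//; last by bm.
apply/andP; split; apply: integ_le => //; try by bm.
  by move=> x /h /andP[? ?]; rewrite mulN1r.
by move=> x /h /andP[].
Qed.

(* [r D = 3 \int_0^r D] improves the bound [|D| <= c r^3] by the factor 3/4. *)
Lemma cubic_vanish D K : bmeas D -> (forall r, 0 <= r <= 1 -> `|D r| <= K * r ^+ 3) ->
  (forall r, 0 <= r <= 1 -> r * D r = integ 0 r (fun x => 3 * D x)) ->
  forall r, 0 <= r <= 1 -> D r = 0.
Proof.
move=> bD DK eD.
have K0 : 0 <= K by have := DK 1; rewrite ler01 lexx expr1n mulr1 => /(_ isT); apply: le_trans.
have it n : forall r, 0 <= r <= 1 -> (4 / 3) ^+ n * `|D r| <= K * r ^+ 3.
  elim: n => [|n ih] r r01; first by rewrite expr0 mul1r; exact: DK.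
  have /andP[r0 r1] := r01.
  have [->|rn0] := eqVneq r 0.
    by have := DK 0; rewrite lexx ler01 => /(_ isT); rewrite expr0n/= mulr0 normr_le0 => /eqP ->; rewrite normr0 mulr0.
  have rp : 0 < r by rewrite lt_neqAle eq_sym rn0.
  rewrite -(ler_pM2l rp).
  have en : `|(4 / 3) ^+ n * (r * D r)| <= (3 * K) / 4 * r ^+ 4.
    rewrite eD// -integZ//; last by bm.
    apply: integ_cube_le => //; first by bm.
    move=> x /andP[x0 xr]; rewrite mulrCA normrM (ger0_norm (_ : 0 <= 3))// -mulrA.
    apply: ler_wpM2l => //; rewrite normrM ger0_norm ?exprn_ge0 ?divr_ge0//.
    by apply: ih; rewrite x0 (le_trans xr).
  rewrite !normrM (gtr0_norm rp) ger0_norm ?exprn_ge0 ?divr_ge0// in en.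
  rewrite exprS; have e4 : r ^+ 4 = r * r ^+ 3 by rewrite exprS.
  rewrite e4 in en; lra.
move=> r r01; apply/eqP; rewrite -normr_le0.
apply: (@arch_le0 _ _ (3 * (K * r ^+ 3))) => n _.
apply: (@le_trans _ _ (3 * ((4 / 3) ^+ n * `|D r|))); last by have := it n r r01; lra.
rewrite mulrA; apply: ler_wpM2r => //.
suff : 1 + n%:R / 3 <= (4 / 3) ^+ n :> R by lra.
elim: n => [|n ih]; first by rewrite mul0r addr0 expr0.
have := ler_wpM2l (_ : 0 <= 4 / 3 :> R) ih => /(_ ltac:(lra)).
have : 0 <= n%:R :> R by [].
by rewrite exprS -[n.+1%:R]natr1; lra.
Qed.

(* [y = r m] solves the dual problem [- (r y')' / r + y / r^2 = X], y(0) = y(1) = 0, and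
   [y' = m + r nu]. *)
Lemma dual_solution X : lip0 X -> exists m nu : R -> R,
  [/\ antider m nu, antider (fun r => r * nu r) (fun r => - X r - 2 * nu r) & m 1 = 0].
Proof.
move=> lX; have bX := lip0_bmeas lX; have [K K0 XK] := lip0_bound lX; have bI := @bmeas_id R.
pose P r := integ 0 r (fun s => s ^+ 2 * X s).
have bs : bmeas (fun s => s ^+ 2 * X s) by bm.
have aP : antider P (fun s => s ^+ 2 * X s) by exact: antider_integ.
have bP := antider_bmeas aP.
have P0 : P 0 = 0 by exact: integ_pt.
have PK r : 0 <= r <= 1 -> `|P r| <= K * r ^+ 4.
  move=> /andP[r0 r1]; apply: (@le_trans _ _ (K / 4 * r ^+ 4)); last first.
    by apply: ler_wpM2r; [exact: exprn_ge0|rewrite ler_pdivrMr//; lra].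
  apply: integ_cube_le => // x /andP[x0 xr].
  rewrite normrM (ger0_norm (exprn_ge0 _ x0)).
  have := ler_wpM2l (exprn_ge0 2 x0) (XK x _); rewrite x0 (le_trans xr r1) => /(_ isT).
  by move=> h; apply: (le_trans h); rewrite le_eqVlt; apply/orP; left; apply/eqP; ring.
have dv f n L : bmeas f -> 0 <= L -> (forall r, 0 <= r <= 1 -> `|f r| <= L * r ^+ n.+1) ->
    bmeas (fun r => f r / r) /\ forall r, 0 <= r <= 1 -> `|f r / r| <= L * r ^+ n.
  move=> bf L0 fL; split.
    apply: (@bmeas_div _ f L); first by case: bf.
    move=> x x01; apply: (le_trans (fL x x01)); apply: ler_wpM2l => //.
    by have /andP[x0 x1] := x01; rewrite exprS ler_piMr// exprn_ile1.
  move=> r r01; have /andP[r0 r1] := r01; have [->|rn0] := eqVneq r 0.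
    by rewrite invr0 mulr0 normr0 mulr_ge0// exprn_ge0.
  have rp : 0 < r by rewrite lt_neqAle eq_sym rn0.
  rewrite normrM normfV (gtr0_norm rp) ler_pdivrMr// -mulrA -exprSr; exact: fL.
have [b1 h1] := dv P 3%N K bP K0 PK.
have [b2 h2] := dv _ 2%N K b1 K0 h1.
have [b3 h3] := dv _ 1%N K b2 K0 h2.
(* The equation [(r nu)' = - X - 2 nu] reads [(r^3 nu)' = - r^2 X], hence [nu = - P / r^3]; as |P|
   <= K r^4, each of the three divisions by r yields a bounded function. *)
pose nu r := - (P r / r / r / r).
have bnu : bmeas nu by exact: bmeasN.
have nuK r : 0 <= r <= 1 -> `|nu r| <= K * r by move=> r01; rewrite normrN; exact: h3.
have nuP r : 0 <= r <= 1 -> r ^+ 3 * nu r = - P r.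
  move=> r01; have [->|rn0] := eqVneq r 0; first by rewrite expr0n/= mul0r P0 oppr0.
  by rewrite /nu; field.
pose q r := integ 0 r (fun s => - X s - 2 * nu s).
have bq' : bmeas (fun s => - X s - 2 * nu s) by bm.
have aq : antider q (fun s => - X s - 2 * nu s) by exact: antider_integ.
have bq := antider_bmeas aq.
(* The claim [q = r nu] is [D = 0]. Differentiating [r D] gives [3 D], so that [cubic_vanish]
   applies and no quotient is differentiated at the origin. *)
pose D r := r * r * q r + P r.
have q3 r : 0 <= r <= 1 -> `|q r| <= 3 * K * r.
  move=> /andP[r0 r1]; rewrite -[X in _ * X]subr0; apply: integ_norm => //.
  move=> x /andP[x0 xr]; have x01 : 0 <= x <= 1 by rewrite x0 (le_trans xr).
  apply: (le_trans (ler_normB _ _)); rewrite normrN normrM (ger0_norm (_ : 0 <= 2))//.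
  have := XK x x01; have := nuK x x01; have := le_trans xr r1.
  have := ler_wpM2l K0 (le_trans xr r1); lra.
have bD : bmeas D by bm.
have aD := antiderD (antiderM (antiderM antider_id (@antider_id R)) aq) aP.
have D0 : forall r, 0 <= r <= 1 -> D r = 0.
  apply: (@cubic_vanish D (4 * K)) => //.
    move=> r r01; have /andP[r0 r1] := r01; apply: (le_trans (ler_normD _ _)).
    rewrite normrM ger0_norm ?mulr_ge0//.
    have := ler_wpM2l (mulr_ge0 r0 r0) (q3 r r01); have := PK r r01.
    have : K * r ^+ 4 <= K * r ^+ 3.
      by apply: ler_wpM2l => //; rewrite exprS ler_piMl// exprn_ge0.
    by rewrite (_ : r ^+ 3 = r * r * r); [lra|ring].
  move=> r /andP[r0 r1].
  have := antiderE (antiderM antider_id aD) (lexx 0) r0 r1; rewrite mul0r subr0 => <-.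
  apply: eq_integ => x /andP[x0 xr].
  have x01 : 0 <= x <= 1 by rewrite x0 (le_trans xr).
  have := nuP x x01; rewrite /D => e; have -> : P x = - (x ^+ 3 * nu x) by rewrite e opprK.
  ring.
exists (fun r => integ 0 r nu - integ 0 1 nu), nu; split; last by rewrite subrr.
  by apply: (eq_antider (antiderB (antider_integ bnu) (antider_cst _))) => // x _; rewrite subr0.
apply: (eq_antider aq) => // x x01.
have [->|xn0] := eqVneq x 0; first by rewrite mul0r /q integ_pt.
have x2 : x * x != 0 by rewrite mulf_neq0.
apply: (mulfI x2); have := D0 x x01; have := nuP x x01; rewrite /D => e1 e2.
by rewrite (_ : x * x * (x * nu x) = x ^+ 3 * nu x); [rewrite e1; lra|ring].
Qed.

(** The derivative of [(r nu)^2] has the nonnegative integral [(nu 1)^2] and equals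
    [2 r nu (- X - 2 nu)]; Young's inequality absorbs the mixed product. *)
Lemma dual_bound X m nu : bmeas X -> antider m nu ->
  antider (fun r => r * nu r) (fun r => - X r - 2 * nu r) ->
  ip0r nu nu <= 4^-1 * ip0r X X.
Proof.
move=> bX [bnu _] aq; have bI := @bmeas_id R; rewrite !ip0rE.
have := antiderE (antiderM aq aq) (lexx 0) ler01 (lexx 1); rewrite !mul0r subr0 mul1r => e.
have l : integ 0 1 (fun r => 2 * (nu r * nu r * r) - 2^-1 * (X r * X r * r)) <= 0.
  apply: (@le_trans _ _ (- (nu 1 * nu 1))); last by rewrite oppr_le0 -expr2 sqr_ge0.
  rewrite -e -mulN1r -integZ ?lexx ?ler01//; last by bm.
  apply: integ_le; rewrite ?lexx ?ler01//; [by bm|by bm|].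
  move=> r /andP[r0 r1]; rewrite -subr_ge0.
  rewrite (_ : _ - _ = 2^-1 * (r * (X r + 2 * nu r) ^+ 2)); last by field.
  by rewrite mulr_ge0// mulr_ge0// sqr_ge0.
rewrite integB ?lexx ?ler01// in l; [|by bm|by bm].
rewrite !integZ ?lexx ?ler01// in l; [|by bm|by bm].
lra.
Qed.

(* Integrate the derivative of [rho r (m + r nu)]. *)
Lemma dual_identity rho X m nu : lip0 rho -> rho 1 = 0 -> lip0 X -> antider m nu ->
  antider (fun r => r * nu r) (fun r => - X r - 2 * nu r) -> m 1 = 0 ->
  ipH1r rho (fun r => r * m r) = ip0r rho X.
Proof.
move=> [r0 [s rs]] r1 lX mn aq m1; have bX := lip0_bmeas lX; have bI := @bmeas_id R.
have bm' := antider_bmeas mn; have bn := mn.1; have bs := rs.1; have brho := antider_bmeas rs.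
have ay := antiderM antider_id mn.
rewrite (ipH1rE rs r0 ay) ?mul0r// ip0rE.
have w := antiderM (antiderM rs antider_id) (antiderD mn aq).
have := antiderE w (lexx 0) ler01 (lexx 1); rewrite r0 r1 !mul0r subrr => e.
rewrite -[LHS]subr0 -[X in _ - X]e -integB ?lexx ?ler01//; last 2 first.
- by apply: bmeas_H1r_density => //; rewrite mul0r.
- by case: w.
apply: eq_integ => r _; rewrite /H1r_density.
have [->|rn0] := eqVneq r 0; first by rewrite r0; ring.
by field.
Qed.

(** Piecewise linear interpolation of [y = r m], for which y'' = - X - nu. The division of the error
    by r is possible on the first element by [first_elem] and elsewhere by [r >= h]. With
    [dual_bound] the constants add up to [20 (2 + 1/2) + 1/4 <= 64]. *)
Lemma dual_interpolation k N X m nu : (1 <= k)%N -> (0 < N)%N -> lip0 X -> antider m nu ->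
  antider (fun r => r * nu r) (fun r => - X r - 2 * nu r) -> m 1 = 0 ->
  exists2 w, fe_space k N w & lip0 (fun r => r * m r - w r) /\
    ipH1r (fun r => r * m r - w r) (fun r => r * m r - w r) <= 64 * N%:R^-1 ^+ 2 * ip0r X X.
Proof.
move=> k1 N0 lX mn aq m1; have bX := lip0_bmeas lX; have bI := @bmeas_id R.
have bm' := antider_bmeas mn; have bn := mn.1.
set h := N%:R^-1 : R; have h0 : 0 < h by rewrite invr_gt0 ltr0n.
have h1 : h <= 1 by rewrite invf_le1 ?ltr0n// ler1n.
have nS i : node N i.+1 = node N i + h :> R by exact: nodeS.
pose y r := r * m r.
pose y' r := m r + r * nu r.
have ay : antider y y'.
  by apply: (eq_antider (antiderM antider_id mn)) => // x _; rewrite mul1r.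
pose g r := - X r - nu r.
have ay' : antider y' g.
  by apply: (eq_antider (antiderD mn aq)) => // x _; rewrite /g; ring.
pose a i : R := node N i.
pose c i := (y (a i.+1) - y (a i)) / h.
have aE i : a i.+1 - a i = h by rewrite /a nS [_ + h]addrC addrK.
pose P i := (y (a i))%:P + c i *: ('X - (a i)%:P).
have PE i r : (P i).[r] = y (a i) + c i * (r - a i).
  by rewrite /P hornerD hornerZ hornerD hornerN hornerX !hornerC.
have dP i r : (P i)^`().[r] = c i.
  by rewrite /P derivD derivC add0r derivZ derivB derivX derivC subr0 alg_polyC hornerC.
have Pa i : (P i).[a i] = y (a i) by rewrite PE; ring.
have Pb i : (P i).[a i.+1] = y (a i.+1).
  by rewrite PE /c aE divfK ?gt_eqF//; ring.
have y0 : y 0 = 0 by rewrite /y mul0r.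
have y1 : y 1 = 0 by rewrite /y m1 mulr0.
have [w [gw [wg wP gP]]] : exists w g, [/\ antider w g,
    forall i, (i < N)%N -> forall r, node N i <= r <= node N i.+1 -> w r = (P i).[r] &
    forall i, (i < N)%N -> forall r, node N i < r < node N i.+1 -> g r = (P i)^`().[r]].
  apply: (@glue_poly _ N P (fun i => y (a i))) => //.
  by rewrite /a node0.
have sP i : (i < N)%N -> (size (P i) <= k.+1)%N.
  move=> iN; rewrite /P (leq_trans (size_polyD _ _))// geq_max (leq_trans (size_polyC_leq1 _))//.
  by rewrite (leq_trans (size_scale_leq _ _))// size_XsubC.
exists w; first by apply: (glue_fe N0 wg sP wP); [have := Pa 0%N; rewrite /a node0 y0|
  have := Pb N.-1; rewrite prednK// /a nodeNN// y1].
have ae := antiderB ay wg.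
have w0 : w 0 = 0 by rewrite (wP 0%N)// ?node0 ?lexx ?node_ge0//; have := Pa 0%N; rewrite /a node0 y0.
have l0 : y 0 - w 0 = 0 by rewrite y0 w0 subr0.
split; first by split => //; exists (fun x => y' x - gw x).
have bg : bmeas g := ay'.1; have bgw := wg.1; have by' := ay.1; have be := antider_bmeas ae.
have bgg : bmeas (fun r => g r ^+ 2 * r) by bm.
have bnn : bmeas (fun r => nu r ^+ 2 * r) by bm.
have bq : bmeas (fun r => (y r - w r) / r).
  by apply: lip0_div_bmeas; split => //; exists (fun x => y' x - gw x).
have bq2 : bmeas (fun r => (y r - w r) ^+ 2 / r).
  by have := bmeasM be bq; congr bmeas; apply/funext => r; rewrite expr2 mulrA.
have bd2 : bmeas (fun r => (y' r - gw r) ^+ 2 * r) by bm.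
pose F i := 20 * h ^+ 2 * integ (a i) (a i.+1) (fun r => g r ^+ 2 * r) +
  h ^+ 2 * integ (a i) (a i.+1) (fun r => nu r ^+ 2 * r).
apply: (le_trans (@H1r_le_nodes _ N _ _ F N0 ae l0 _)); last first.
  rewrite /F big_split/= -!mulr_sumr -!integ_nodes//.
  have i1 : integ 0 1 (fun r => nu r ^+ 2 * r) <= 4^-1 * ip0r X X.
    rewrite (eq_integ (g := fun r => nu r * nu r * r)) => [|r _]; last by rewrite expr2.
    by rewrite -ip0rE; apply: (dual_bound bX mn aq).
  have i2 : integ 0 1 (fun r => g r ^+ 2 * r) <= 2 * ip0r X X + 2 * integ 0 1 (fun r => nu r ^+ 2 * r).
    have bXX : bmeas (fun r => X r * X r * r) by bm.
    rewrite ip0rE -!integZ ?lexx ?ler01// -integD ?lexx ?ler01//; [|exact: bmeasZ|exact: bmeasZ].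
    apply: integ_le; rewrite ?lexx ?ler01//; [by bm|].
    move=> r /andP[r0 _]; rewrite -subr_ge0 /g.
    rewrite (_ : _ - (- X r - nu r) ^+ 2 * r = (X r - nu r) ^+ 2 * r); last by ring.
    by rewrite mulr_ge0// sqr_ge0.
  have XX : 0 <= ip0r X X by exact: (psd_ge0 psd_ip0r).
  have hh : 0 <= h ^+ 2 by exact: sqr_ge0.
  have := ler_wpM2l hh i1; have := ler_wpM2l hh i2; have := mulr_ge0 hh XX; lra.
move=> i iN.
have a0 : 0 <= a i by exact: node_ge0.
have ai1 : a i.+1 <= 1 by exact: node_le1.
have ai : a i < a i.+1 by rewrite -subr_gt0 aE.
pose E r := y r - (P i).[r]; pose E' r := y' r - c i.
have aEE : antider E E'.
  by apply: (eq_antider (antiderB ay (antider_poly (P i)))) => // x _; rewrite /E' dP.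
have aE'g : antider E' g.
  by apply: (eq_antider (antiderB ay' (antider_cst (c i)))) => // x _; rewrite subr0.
have Ea : E (a i) = 0 by rewrite /E Pa subrr.
have Eb : E (a i.+1) = 0 by rewrite /E Pb subrr.
have := elem_H1 a0 ai ai1 aEE aE'g Ea Eb; rewrite aE => -[h2 h3].
set G := integ _ _ (fun r => g r ^+ 2 * r) in h2 h3.
set B := integ (a i) (a i.+1) (fun r => nu r ^+ 2 * r).
have bE := antider_bmeas aEE; have bE' := aEE.1.
have G0 : 0 <= G by apply: integ_ge0 => r /andP[ar _]; rewrite mulr_ge0 ?sqr_ge0// (le_trans a0).
have B0 : 0 <= B by apply: integ_ge0 => r /andP[ar _]; rewrite mulr_ge0 ?sqr_ge0// (le_trans a0).
have hh : 0 <= h ^+ 2 by exact: sqr_ge0.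
rewrite -/(a i) -/(a i.+1) integD// /F -/G -/B.
have p1 : integ (a i) (a i.+1) (fun r => (y' r - gw r) ^+ 2 * r) <= 4 * h ^+ 2 * G.
  apply: le_trans h2; apply: integ_le_oo => //; first by bm.
  by move=> r hr; rewrite (gP i)// dP.
have p2 : integ (a i) (a i.+1) (fun r => (y r - w r) ^+ 2 / r) <= 16 * h ^+ 2 * G + h ^+ 2 * B.
  have [i0|i0] := posnP i.
    apply: (@le_trans _ _ (h ^+ 2 * B)); last by have := mulr_ge0 hh G0; lra.
    have a00 : a i = 0 by rewrite /a i0 node0.
    have a1h : a i.+1 = h by rewrite /a nS -/(a i) a00 add0r.
    rewrite /B a1h a00.
    have am : antider (fun r => m r - m h) nu.
      by apply: (eq_antider (antiderB mn (antider_cst (m h)))) => // x _; rewrite subr0.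
    apply: le_trans (first_elem (ltW h0) h1 am (subrr _)).
    have bmm := antider_bmeas am.
    apply: integ_le_oo => //; first by bm.
    move=> r /andP[r0 rh].
    rewrite (wP i iN) ?PE; last by rewrite -/(a i) -/(a i.+1) a00 a1h !ltW.
    rewrite /c a00 a1h y0 !subr0 add0r /y le_eqVlt; apply/orP; left; apply/eqP.
    by field; rewrite !gt_eqF.
  have ha : h <= a i by rewrite /a /node /h -[leLHS]mul1r ler_pM2r// ler1n.
  apply: (@le_trans _ _ (16 * h ^+ 2 * G)); last by have := mulr_ge0 hh B0; lra.
  have h2p : 0 < h ^+ 2 by rewrite exprn_gt0.
  rewrite -(ler_pM2l h2p).
  have -> : h ^+ 2 * (16 * h ^+ 2 * G) = 16 * h ^+ 4 * G by ring.
  apply: le_trans h3; rewrite -integZ//; apply: integ_le_oo => //; [exact: bmeasZ|by bm|].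
  move=> r hr; have /andP[ar rb] := hr.
  rewrite (wP i iN) -?/(E r); last by rewrite !ltW.
  have hr' : h <= r := ltW (le_lt_trans ha ar).
  have rp : 0 < r by exact: lt_le_trans hr'.
  rewrite mulrA ler_pdivrMr// mulrC -[leRHS]mulrA; apply: ler_wpM2l; first exact: sqr_ge0.
  by rewrite -expr2 lerXn2r ?nnegrE// ltW.
lra.
Qed.

Lemma lip0_zero_ipH1r v w : lip0 v -> lip0 w -> (forall x, 0 <= x <= 1 -> v x = 0) -> ipH1r v w = 0.
Proof.
move=> [v0 _] [w0 [f wf]] vz.
have a0 : antider v (fun=> 0) by apply: (eq_antider (antider_cst 0)) => // x /vz.
rewrite (ipH1rE a0 v0 wf w0) (eq_integ (g := fun=> 0)).
  by rewrite integ_cst ?ler01// mul0r.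
by move=> x h; rewrite /H1r_density vz// !mul0r addr0.
Qed.

Lemma ritz k N u : (0 < N)%N -> lip0 u ->
  exists2 w, fe_space k N w & forall v, fe_space k N v -> ipH1r w v = ipH1r u v.
Proof.
move=> N0 lu.
have fl v : fe_space k N v -> lip0 v by exact: fe_lip0.
have [|||w fw hw] := @fe_riesz R k N ipH1r (ipH1r u) N0 (fe_psd_ipH1r k N0); last by exists w.
- by move=> v fv vz; apply: lip0_zero_ipH1r => //; exact: fl.
- by move=> c v w /fl lv /fl lw; exact: (psd_linr subsp_lip0 psd_ipH1r lu).
- by move=> v /fl lv; exact: (psd_null subsp_lip0 psd_ipH1r lu lv).
Qed.

Lemma ritz_best k N u w v : (0 < N)%N -> lip0 u -> fe_space k N w ->
  (forall z, fe_space k N z -> ipH1r w z = ipH1r u z) -> fe_space k N v ->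
  ipH1r (fun r => u r - w r) (fun r => u r - w r) <= ipH1r (fun r => u r - v r) (fun r => u r - v r).
Proof.
move=> N0 lu fw hw fv.
have lw := fe_lip0 N0 fw; have lv := fe_lip0 N0 fv.
have e1 := psd_sqrB subsp_lip0 psd_ipH1r lu lw.
have e2 := psd_sqrB subsp_lip0 psd_ipH1r lu lv.
have fwv := subspB (subsp_fe k N) fw fv.
have e3 := psd_sqrB subsp_lip0 psd_ipH1r lw lv.
have p := psd_ge0 psd_ipH1r (fe_lip0 N0 fwv).
rewrite e3 in p.
rewrite -[ipH1r _ _]/(ipH1r ((u : V) - w) ((u : V) - w)) e1.
rewrite -[leRHS]/(ipH1r ((u : V) - v) ((u : V) - v)) e2.
have := hw _ fw; have := hw _ fv; lra.
Qed.

(** With a = [ipH1r] and the dual solution y of [X], Galerkin orthogonality turns the weighted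
    product of [rho] and [X] into a(rho, y - w); the interpolation error supplies the factor h. *)
Lemma aubin_nitsche k N rho X : (1 <= k)%N -> (0 < N)%N -> lip0 rho -> rho 1 = 0 ->
  (forall v, fe_space k N v -> ipH1r rho v = 0) -> fe_space k N X ->
  ip0r rho X ^+ 2 <= 64 * N%:R^-1 ^+ 2 * ip0r X X * ipH1r rho rho.
Proof.
move=> k1 N0 lr r1 orth fX; have lX := fe_lip0 N0 fX.
have [m [nu [mn aq m1]]] := dual_solution lX.
have [w fw [le bd]] := dual_interpolation k1 N0 lX mn aq m1.
have lw := fe_lip0 N0 fw.
have ly : lip0 (fun r => r * m r).
  by split; [rewrite mul0r|exists (fun x => 1 * m x + x * nu x); exact: antiderM antider_id mn].
have := psdBr subsp_lip0 psd_ipH1r ly lw lr; rewrite -[ipH1r rho (_ - _)]/(ipH1r rho (fun r => r * m r - w r)).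
rewrite (orth w fw) subr0 (dual_identity lr r1 lX mn aq m1) => <-.
apply: (le_trans (psd_CS subsp_lip0 psd_ipH1r lr le)).
by rewrite mulrC; apply: ler_wpM2r => //; exact: (psd_ge0 psd_ipH1r).
Qed.

End RitzProjection.

(** * The discrete parabolic projection *)

Section ParabolicProjection.
Context {R : realType}.
Implicit Types (f g v w m nu rho z X : R -> R) (a b x y K C : R) (n i k N : nat).
Local Notation V := (R -> R^o).

Lemma sqr_le_norm x y : 0 <= y -> x ^+ 2 <= y ^+ 2 -> `|x| <= y.
Proof. by move=> y0 h; rewrite -(ger0_norm y0) -(sqrtr_sqr x) -(sqrtr_sqr y) ler_wsqrtr. Qed.

Lemma bmeas_zero_ip0r v w : (forall x, 0 <= x <= 1 -> v x = 0) -> ip0r v w = 0.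
Proof.
move=> vz; rewrite ip0rE (eq_integ (g := fun=> 0)) ?integ_cst ?ler01 ?mul0r//.
by move=> x h; rewrite vz// !mul0r.
Qed.

Lemma ip0rBl f g v : bmeas f -> bmeas g -> bmeas v ->
  ip0r (fun r => f r - g r) v = ip0r f v - ip0r g v.
Proof. exact: (psdBl psd_ip0r). Qed.

Lemma ip0rDl f g v : bmeas f -> bmeas g -> bmeas v ->
  ip0r (fun r => f r + g r) v = ip0r f v + ip0r g v.
Proof. by move=> bf bg bv; exact: (lin_onD (psd_lin psd_ip0r bv)). Qed.

Lemma ipH1rBl f g v : lip0 f -> lip0 g -> lip0 v ->
  ipH1r (fun r => f r - g r) v = ipH1r f v - ipH1r g v.
Proof. exact: (psdBl psd_ipH1r). Qed.

Lemma fe_null_ipH1r k N u v : (0 < N)%N -> lip0 u -> fe_space k N v -> ip0r v v = 0 -> ipH1r u v = 0.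
Proof.
move=> N0 lu fv v0; have lv := fe_lip0 N0 fv.
apply: (psd_null subsp_lip0 psd_ipH1r lu lv).
have [C C0 /(_ N v N0 fv)] := @fe_inverse R k; rewrite v0 mulr0 => h.
by apply/le_anti; rewrite h (psd_ge0 psd_ipH1r).
Qed.

Lemma fe_solve k N (tau : R) (L : V -> R) : (0 < N)%N -> 0 <= tau ->
  lin_on (fe_space k N : V -> Prop) L ->
  (forall v, fe_space k N v -> ip0r v v = 0 -> L v = 0) ->
  exists2 y, fe_space k N y & forall v, fe_space k N v -> ip0r y v + tau * ipH1r y v = L v.
Proof.
move=> N0 t0 lL L0.
have fB := psd_add t0 (fe_psd_ip0r k N0) (fe_psd_ipH1r k N0).
have [|v fv e|y fy hy] := @fe_riesz R k N _ L N0 fB _ lL; last by exists y.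
- move=> v fv vz; rewrite bmeas_zero_ip0r// lip0_zero_ipH1r ?mulr0 ?addr0//; exact: fe_lip0 fv.
- apply: L0 => //; have p1 := psd_ge0 (fe_psd_ip0r k N0) fv.
  have p2 := mulr_ge0 t0 (psd_ge0 (fe_psd_ipH1r k N0) fv).
  by apply/le_anti; rewrite p1 andbT; lra.
Qed.

Lemma chain_lip0 k M v Q : smooth_chain k M v Q -> v 0 = 0 -> lip0 v.
Proof.
move=> [Q0 aQ _] v0; split => //; exists (Q 1%N).
by apply: (eq_antider (aQ 0%N isT)) => // x x01; exact: Q0.
Qed.

Lemma psd_sqrD_le (S : V -> Prop) B v w : subsp S -> psd_form S B -> S v -> S w ->
  B (v + w) (v + w) <= 2 * B v v + 2 * B w w.
Proof.
move=> sS fB sv sw.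
have e := psd_ge0 fB (subspB sS sv sw); rewrite (psd_sqrB sS fB)// in e.
have smw : S (- w) by have := subspZ (-1) sS sw; rewrite scaleN1r.
have := psd_sqrB sS fB sv smw; rewrite opprK => ->.
have -> : - w = (-1) *: w by rewrite scaleN1r.
rewrite !(psdZr sS fB)// ?(psdZl sS fB)//; last exact: subspZ.
lra.
Qed.

(* The discrete parabolic projection absorbs the difference quotient of the Ritz error, for which the
   assumed regularity gives no rate: it only appears as an increment, to which smoothing applies. *)
Lemma parabolic_projection k : (1 <= k)%N -> exists2 C, 0 < C & forall M N tau (u : nat -> R -> R),
  (0 < N)%N -> 0 < tau -> 0 <= M ->
  (forall j, (exists Q, smooth_chain k M (u j) Q) /\ u j 0 = 0 /\ u j 1 = 0) ->
  exists w : nat -> R -> R, [/\ forall j, fe_space k N (w j),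
    forall v, fe_space k N v -> ipH1r (w 0%N) v = ipH1r (u 0%N) v,
    forall j v, fe_space k N v ->
      ip0r (fun r => w j.+1 r - w j r) v + tau * ipH1r (w j.+1) v =
      ip0r (fun r => u j.+1 r - u j r) v + tau * ipH1r (u j.+1) v,
    forall j, ipH1r (fun r => w j r - u j r) (fun r => w j r - u j r) <= (C * M * N%:R^-1 ^+ k) ^+ 2 &
    forall j r, 0 <= r <= 1 -> `|w j r - u j r| <= C * M * r].
Proof.
move=> k1; have [C1 C10 inv] := @fe_inverse R k; have [C2 C20 ptw] := @fe_pointwise R k.
(* 144 = 6 x 24 comes from [parabolic_smoothing] and from [del], 8 = 2 x 2^2 from the interpolation
   error, and the outer 2 from the triangle inequality for squares. *)
pose Ca := 2 * (144 ^+ 2 * C1 + 8) + 1.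
have Ca1 : 1 <= Ca by rewrite /Ca; lra.
(* The pointwise bound passes through the interpolant, because [fe_pointwise] is about discrete
   functions; its factor [N^2] is compensated by [(h^k)^2], as [k >= 1]. *)
pose Cb := C2 * (2 * (Ca ^+ 2 + 8)) + 3.
have Cb0 : 0 <= C2 * (2 * (Ca ^+ 2 + 8)).
  by rewrite mulr_ge0 ?(ltW C20)//; have := sqr_ge0 Ca; lra.
exists (Ca + Cb); first by rewrite /Cb; lra.
move=> M N tau u N0 t0 M0 hu.
have NR : 0 < N%:R :> R by rewrite ltr0n.
set h := N%:R^-1 : R; have h0 : 0 < h by rewrite invr_gt0.
have h1 : h <= 1 by rewrite invf_le1// ler1n.
have Nh : N%:R * h = 1 :> R by rewrite /h mulfV// gt_eqF.
have hk0 : 0 <= h ^+ k by rewrite exprn_ge0// ltW.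
have Nhk : N%:R ^+ 2 * (h ^+ k) ^+ 2 <= 1.
  rewrite -exprMn -[leRHS](expr1n _ 2) lerXn2r ?nnegrE ?mulr_ge0// ?ler01//.
  rewrite -(prednK k1) exprS mulrA Nh mul1r exprn_ile1// ltW//.
have lu j : lip0 (u j) by have [[Q cQ] [u0 _]] := hu j; exact: chain_lip0 cQ u0.
have bu j := lip0_bmeas (lu j).
have /choice[Ru hR] : forall j, exists w, fe_space k N w /\
    forall v, fe_space k N v -> ipH1r w v = ipH1r (u j) v.
  by move=> j; have [w fw hw] := ritz k N0 (lu j); exists w.
have /choice[Iu hI] : forall j, exists w, fe_space k N w /\ (lip0 (fun r => u j r - w r) /\
    (forall r, 0 <= r <= 1 -> `|u j r - w r| <= 2 * M * h ^+ k * r) /\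
    ipH1r (fun r => u j r - w r) (fun r => u j r - w r) <= 2 * (2 * M * h ^+ k) ^+ 2).
  by move=> j; have [[Q cQ] [u0 u1]] := hu j; have [w fw hw] := interpolant k1 cQ u0 u1 N0; exists w.
have fR j := (hR j).1; have lR j := fe_lip0 N0 (fR j).
have sS := @subsp_fe R k N; have fm := @fe_psd_ip0r R k N N0; have fa := @fe_psd_ipH1r R k N N0.
have lrho j : lip0 (fun r => u j r - Ru j r) by exact: (subspB subsp_lip0 (lu j) (lR j)).
have arho j : ipH1r (fun r => u j r - Ru j r) (fun r => u j r - Ru j r) <= 2 * (2 * M * h ^+ k) ^+ 2.
  have [fI [_ [_ hI']]] := hI j; apply: le_trans hI'; exact: ritz_best (hR j).2 fI.
have /choice[step hstep] : forall p : nat * (R -> R), exists y : R -> R, fe_space k N p.2 ->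
    fe_space k N y /\ forall v, fe_space k N v -> ip0r (fun r => y r - p.2 r) v + tau * ipH1r y v =
      ip0r (fun r => u p.1.+1 r - u p.1 r) v + tau * ipH1r (u p.1.+1) v.
  move=> [j x] /=; have [fx|nfx] := pselect (fe_space k N x); last by exists x.
  have bx := lip0_bmeas (fe_lip0 N0 fx).
  pose f r := u j.+1 r - u j r + x r.
  have bf : bmeas f by apply: bmeasD => //; exact: bmeasB.
  pose L v := ip0r f v + tau * ipH1r (u j.+1) v.
  have lL : lin_on (fe_space k N : V -> Prop) L.
    move=> c v w fv fw; have bv := lip0_bmeas (fe_lip0 N0 fv); have bw := lip0_bmeas (fe_lip0 N0 fw).
    rewrite /L (psd_linr subsp_bmeas psd_ip0r bf c bv bw).
    rewrite (psd_linr subsp_lip0 psd_ipH1r (lu _) c (fe_lip0 N0 fv) (fe_lip0 N0 fw)); ring.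
  have [|y fy hy] := @fe_solve k N tau L N0 (ltW t0) lL; last first.
  - exists y => _; split => // v fv; have := hy v fv.
    have bv := lip0_bmeas (fe_lip0 N0 fv); have by_ := lip0_bmeas (fe_lip0 N0 fy).
    rewrite (ip0rBl by_ bx bv) /L /f (ip0rDl (bmeasB (bu j.+1) (bu j)) bx bv); lra.
  - move=> v fv v0; rewrite /L (fe_null_ipH1r N0 (lu _) fv v0) mulr0 addr0.
    exact: (psd_null subsp_bmeas psd_ip0r bf (lip0_bmeas (fe_lip0 N0 fv)) v0).
pose w := fix w j := if j is i.+1 then step (i, w i) else Ru 0%N.
have fw j : fe_space k N (w j).
  by elim: j => [|j ih]; [exact: fR|have [] := hstep (j, w j) ih].
have ew j := (hstep (j, w j) (fw j)).2.
have lw j := fe_lip0 N0 (fw j).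
pose th j : V := (w j : V) - Ru j.
have sth j : fe_space k N (th j) by exact: (subspB sS (fw j) (fR j)).
have th0 : th 0%N = 0 by rewrite /th /= subrr.
pose r_ j v := ip0r (fun r => u j r - Ru j r) v.
pose kap := Num.sqrt C1 * N%:R.
have kap0 : 0 < kap by rewrite mulr_gt0// sqrtr_gt0.
have kap2 : kap ^+ 2 = C1 * N%:R ^+ 2 by rewrite exprMn sqr_sqrtr// ltW.
(* 24^2 exceeds 64 x 8, the product of the constants of [aubin_nitsche] and of the squared Ritz
   error. The single factor [h] will cancel the [N] in [kap]. *)
pose del := 24 * M * h * h ^+ k.
have del0 : 0 <= del by rewrite !mulr_ge0// ltW.
have thb j : ipH1r (th j) (th j) <= (6 * kap * del) ^+ 2.
  apply: (@parabolic_smoothing R V (fe_space k N) ip0r ipH1r kap tau sS fm fa kap0 t0 _ _ _ th r_ del) => //.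
  - by move=> v fv; rewrite kap2; exact: inv.
  - move=> psi fpsi; have lpsi := fe_lip0 N0 fpsi.
    have [||y fy hy] := @fe_solve k N 0 (ipH1r psi) N0 (lexx 0).
    + exact: (psd_linr sS fa fpsi).
    + by move=> v fv v0; exact: (fe_null_ipH1r N0 lpsi fv v0).
    + by exists y => // v fv; rewrite -hy// mul0r addr0.
  - move=> x fx; have bx := lip0_bmeas (fe_lip0 N0 fx).
    have [||y fy hy] := @fe_solve k N tau (ip0r x) N0 (ltW t0).
    + exact: (psd_linr sS fm fx).
    + by move=> v fv; apply: (psd_null subsp_bmeas psd_ip0r bx); exact: (lip0_bmeas (fe_lip0 N0 fv)).
    + by exists y.
  - move=> i c v v' fv fv'; apply: (psd_linr subsp_bmeas psd_ip0r (lip0_bmeas (lrho i))).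
      exact: (lip0_bmeas (fe_lip0 N0 fv)).
    exact: (lip0_bmeas (fe_lip0 N0 fv')).
  - move=> i v fv; have mv := psd_ge0 fm fv.
    have := @aubin_nitsche R k N _ v k1 N0 (lrho i) _ _ fv; rewrite (hu i).2.2.
    have [_ _ -> _] := fR i; rewrite subrr => /(_ erefl) an.
    have {}an : ip0r (fun r => u i r - Ru i r) v ^+ 2 <= (del * Num.sqrt (ip0r v v)) ^+ 2.
      apply: (le_trans (an _)).
        by move=> z fz; rewrite (ipH1rBl (lu i) (lR i) (fe_lip0 N0 fz)) (hR i).2// subrr.
      rewrite exprMn sqr_sqrtr//.
      have p : 0 <= 64 * h ^+ 2 * ip0r v v by rewrite mulr_ge0// mulr_ge0// sqr_ge0.
      apply: (le_trans (ler_wpM2l p (arho i))).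
      rewrite /del -subr_ge0.
      rewrite (_ : _ - _ = 64 * h ^+ 2 * (M * h ^+ k) ^+ 2 * ip0r v v); last by ring.
      by rewrite mulr_ge0// mulr_ge0 ?sqr_ge0// mulr_ge0// sqr_ge0.
    by apply: sqr_le_norm an; rewrite mulr_ge0 ?sqrtr_ge0.
  - move=> i v fv; have lv := fe_lip0 N0 fv; have bv := lip0_bmeas lv.
    have e : ip0r (fun r => w i.+1 r - w i r) v + tau * ipH1r (w i.+1) v =
      ip0r (fun r => u i.+1 r - u i r) v + tau * ipH1r (u i.+1) v := ew i v fv.
    have bw l := lip0_bmeas (lw l); have bR l := lip0_bmeas (lR l).
    have bth l : bmeas (th l) by exact: bmeasB.
    have -> : ip0r (th i.+1 - th i) v = ip0r (th i.+1) v - ip0r (th i) v.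
      exact: (ip0rBl (bth i.+1) (bth i) bv).
    have mth l : ip0r (th l) v = ip0r (w l) v - ip0r (Ru l) v by exact: ip0rBl.
    have -> : ipH1r (th i.+1) v = ipH1r (w i.+1) v - ipH1r (Ru i.+1) v by exact: ipH1rBl.
    rewrite /r_ !mth !ip0rBl// (hR i.+1).2//.
    by move: e; rewrite !ip0rBl//; lra.
have aw j : ipH1r (fun r => w j r - u j r) (fun r => w j r - u j r) <= (Ca * M * h ^+ k) ^+ 2.
  have lur : lip0 (fun r => Ru j r - u j r) by exact: (subspB subsp_lip0 (lR j) (lu j)).
  have := psd_sqrD_le subsp_lip0 psd_ipH1r (fe_lip0 N0 (sth j)) lur.
  have -> : (th j + (fun r => Ru j r - u j r) : V) = (fun r => w j r - u j r).
    by apply/funext => r; rewrite -[LHS]/(w j r - Ru j r + (Ru j r - u j r)); ring.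
  have -> : ipH1r (fun r => Ru j r - u j r) (fun r => Ru j r - u j r) =
      ipH1r (fun r => u j r - Ru j r) (fun r => u j r - Ru j r).
    have e1 := psd_sqrB subsp_lip0 psd_ipH1r (lu j) (lR j).
    have e2 := psd_sqrB subsp_lip0 psd_ipH1r (lR j) (lu j).
    rewrite -[LHS]/(ipH1r ((Ru j : V) - u j) ((Ru j : V) - u j)) e2.
    rewrite -[RHS]/(ipH1r ((u j : V) - Ru j) ((u j : V) - Ru j)) e1.
    rewrite (psd_sym psd_ipH1r (lR j) (lu j)); ring.
  move=> H; apply: (le_trans H).
  have h2 := arho j; have h3 := thb j.
  have e : (6 * kap * del) ^+ 2 = 144 ^+ 2 * C1 * (M * h ^+ k) ^+ 2.
    rewrite (_ : 6 * kap * del = 144 * Num.sqrt C1 * (M * h ^+ k) * (N%:R * h)); last by rewrite /kap /del; ring.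
    by rewrite Nh mulr1 !exprMn sqr_sqrtr// ltW.
  rewrite e in h3.
  apply: (@le_trans _ _ (Ca * (M * h ^+ k) ^+ 2)).
    by have := sqr_ge0 (M * h ^+ k); rewrite /Ca; lra.
  rewrite -[Ca * M * _]mulrA [leRHS]exprMn; apply: ler_wpM2r; first exact: sqr_ge0.
  by rewrite expr2 ler_peMr// (le_trans ler01).
exists w; split => //.
- exact: (hR 0%N).2.
- move=> j; apply: (le_trans (aw j)).
  have Cb1 : 0 <= Cb by rewrite /Cb; lra.
  rewrite lerXn2r ?nnegrE ?mulr_ge0//; [lra|lra|].
  by apply: ler_wpM2r => //; apply: ler_wpM2r => //; lra.
- move=> j r r01; have /andP[r0 r1] := r01.
  have [fI [lI [pI aI]]] := hI j.
  have lwu : lip0 (fun r => w j r - u j r) by exact: (subspB subsp_lip0 (lw j) (lu j)).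
  have := psd_sqrD_le subsp_lip0 psd_ipH1r lwu lI.
  have -> : ((fun r => w j r - u j r) + (fun r => u j r - Iu j r) : V) = ((w j : V) - Iu j).
    by apply/funext => x; rewrite -[LHS]/(w j x - u j x + (u j x - Iu j x)) -[RHS]/(w j x - Iu j x); ring.
  move=> H.
  have fwI := subspB sS (fw j) fI.
  have p2 := ptw N _ N0 fwI r r01.
  have M2 : 0 <= M ^+ 2 by exact: sqr_ge0.
  have Ca2 : 0 <= Ca ^+ 2 by exact: sqr_ge0.
  have b1 : ipH1r ((w j : V) - Iu j) ((w j : V) - Iu j) <= 2 * (Ca ^+ 2 + 8) * M ^+ 2 * (h ^+ k) ^+ 2.
    apply: (le_trans H); have := aw j; move: aI; rewrite -/h => a1 a2.
    rewrite !exprMn in a1 a2; have := mulr_ge0 M2 (sqr_ge0 (h ^+ k)); lra.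
  have b2 : C2 * N%:R ^+ 2 * ipH1r ((w j : V) - Iu j) ((w j : V) - Iu j) <= (Cb - 3) * M ^+ 2.
    have CN : 0 <= C2 * N%:R ^+ 2 by rewrite mulr_ge0 ?sqr_ge0// ltW.
    apply: (le_trans (ler_wpM2l CN b1)).
    rewrite (_ : C2 * N%:R ^+ 2 * _ = (Cb - 3) * M ^+ 2 * (N%:R ^+ 2 * (h ^+ k) ^+ 2)); last by rewrite /Cb; ring.
    by rewrite ler_piMr// mulr_ge0// /Cb; lra.
  have b3 : `|w j r - Iu j r| <= (Cb - 2) * M * r.
    have c2 : 1 <= Cb - 2 by rewrite /Cb; lra.
    apply: sqr_le_norm; first by rewrite !mulr_ge0//; lra.
    apply: (le_trans p2); rewrite !exprMn; apply: ler_wpM2r; first exact: sqr_ge0.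
    apply: (le_trans b2); apply: ler_wpM2r => //.
    apply: (@le_trans _ _ (Cb - 2)); first by lra.
    by rewrite expr2 ler_peMr//; lra.
  have b4 : `|u j r - Iu j r| <= 2 * M * r.
    apply: (le_trans (pI r r01)); apply: ler_wpM2r => //; rewrite ler_piMr ?mulr_ge0//.
    by rewrite exprn_ile1// ltW.
  have -> : w j r - u j r = (w j r - Iu j r) - (u j r - Iu j r) by ring.
  apply: (le_trans (ler_normB _ _)).
  have := mulr_ge0 M0 r0; have := mulr_ge0 (le_trans ler01 Ca1) (mulr_ge0 M0 r0); lra.
Qed.

End ParabolicProjection.

(** * The nonlinear term and the discrete energy estimate *)

Section NonlinearTerm.
Context {R : realType}.
Implicit Types (x y z a b u e K L r tau : R).

Lemma is_derive_double (f : R -> R) x d : is_derive (2 * x) 1 f d ->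
  is_derive x 1 (fun y => f (2 * y)) (d * 2).
Proof.
move=> fd; apply: (@is_derive1_comp R f (fun y => 2 * y)) => //.
by apply: is_derive_eq => //; rewrite /GRing.scale/= mulr1.
Qed.

Lemma cos_double x : cos (2 * x) = 1 - 2 * sin x ^+ 2 :> R.
Proof. by rewrite mulr_natl cos_mulr2n cos2sin2 -mulr_natl; ring. Qed.

Lemma sin_double x : sin (2 * x) = 2 * (sin x * cos x) :> R.
Proof. by rewrite mulr_natl sin_mulr2n -mulr_natl [cos x * _]mulrC. Qed.

Lemma is_derive_nonlin x : is_derive x 1 (@nonlin R) (2 * sin x ^+ 2).
Proof.
have h : is_derive x 1 (fun y => 2^-1 * sin (2 * y)) (cos (2 * x)).
  have h := is_derive_double (is_derive_sin (2 * x)).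
  by apply: is_derive_eq; rewrite /GRing.scale/= mulrCA mulVf ?mulr1// pnatr_eq0.
have := @is_deriveB _ _ _ id (fun y => 2^-1 * sin (2 * y)) x 1 _ _ (is_derive_id x 1) h.
by rewrite cos_double (_ : 1 - _ = 2 * sin x ^+ 2)//; ring.
Qed.

Lemma nonlin0 : nonlin 0 = 0 :> R.
Proof. by rewrite /nonlin mulr0 sin0 mulr0 subrr. Qed.

Lemma nonlin_diff x y : exists2 t, 0 <= t <= 1 &
  nonlin y - nonlin x = 2 * sin (x + t * (y - x)) ^+ 2 * (y - x) :> R.
Proof. exact: (MVT_between x y is_derive_nonlin). Qed.

Lemma sin_sqr_le x : sin x ^+ 2 <= x ^+ 2 :> R.
Proof. by rewrite -[leLHS]real_normK ?num_real// -[leRHS]real_normK ?num_real// lerXn2r ?nnegrE// norm_sin_le. Qed.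

Lemma nonlin_cube x : `|nonlin x| <= 2 * `|x| ^+ 3 :> R.
Proof.
have [t /andP[t0 t1]] := nonlin_diff 0 x.
rewrite nonlin0 !subr0 add0r => ->.
rewrite normrM [`|x| ^+ 3]exprSr mulrA; apply: ler_wpM2r => //.
rewrite ger0_norm; last by rewrite mulr_ge0// sqr_ge0.
apply: ler_wpM2l => //; apply: (le_trans (sin_sqr_le _)).
by rewrite real_normK ?num_real// exprMn ler_piMl ?sqr_ge0// exprn_ile1.
Qed.

(* [F x = (x^2 - sin^2 x) / 2] is a convex primitive of [nonlin]. *)
Lemma nonlin_convex x y :
  2^-1 * sin y ^+ 2 - 2^-1 * sin x ^+ 2 <= (y - nonlin x) * (y - x) :> R.
Proof.
pose F z := 2^-1 * (z * z) - 2^-1 * sin z ^+ 2.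
have dF z : is_derive z 1 F (nonlin z).
  have h1 : is_derive z 1 (fun y => 4^-1 * cos (2 * y)) (- (2^-1 * sin (2 * z))).
    have h := is_derive_double (is_derive_cos (2 * z)).
    by apply: is_derive_eq; rewrite /GRing.scale/=; field.
  have h2 : is_derive z 1 (fun y => 2^-1 * (y * y)) z.
    by apply: is_derive_eq; rewrite /GRing.scale/=; field.
  have h3 : is_derive z 1 (fun=> - 4^-1 : R) 0 by exact: is_derive_cst.
  have h4 := is_deriveD (is_deriveD h2 h1) h3.
  have -> : F = (fun y => 2^-1 * (y * y)) \+ (fun y => 4^-1 * cos (2 * y)) \+ (fun=> - 4^-1).
    by apply/funext => t /=; rewrite cos_double /F; field.
  by rewrite (_ : nonlin z = z + - (2^-1 * sin (2 * z)) + 0)// addr0.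
have [t /andP[t0 t1] e] := MVT_between x y dF.
have [s s01 e'] := nonlin_diff x (x + t * (y - x)).
rewrite -subr_ge0.
(* The gap between the two sides is half a square plus the gap of [F] above its tangent at [x],
   which is nonnegative because the derivative of [nonlin] is [2 sin^2]. *)
have -> : (y - nonlin x) * (y - x) - (2^-1 * sin y ^+ 2 - 2^-1 * sin x ^+ 2) =
    2^-1 * (y - x) ^+ 2 + (F y - F x - nonlin x * (y - x)) by rewrite /F; field.
rewrite e -mulrBl e'.
have -> : x + t * (y - x) - x = t * (y - x) by ring.
have p := mulr_ge0 (mulr_ge0 (sqr_ge0 (sin (x + s * (t * (y - x))))) t0) (sqr_ge0 (y - x)).
have p' := sqr_ge0 (y - x).
rewrite (_ : _ * (y - x) = 2 * (sin (x + s * (t * (y - x))) ^+ 2 * t * (y - x) ^+ 2)); last by ring.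
lra.
Qed.

Lemma norm_sinD a b : `|sin (a + b)| <= `|sin a| + `|sin b| :> R.
Proof.
rewrite sinD; apply: (le_trans (ler_normD _ _)); rewrite !normrM; apply: lerD.
  by rewrite ler_piMr// norm_cos_le1.
by rewrite ler_piMl// norm_cos_le1.
Qed.

(** Each term of the defect of additivity contains both sines, one of them squared: for |b| <= K r
    with r <= 1 it is O(r |sin a|). *)
Lemma nonlin_addition a b : nonlin (a + b) - nonlin a - nonlin b =
  2 * (sin a * cos a) * sin b ^+ 2 + 2 * (sin b * cos b) * sin a ^+ 2 :> R.
Proof.
by rewrite /nonlin mulrDr sinD !cos_double !sin_double; field.
Qed.

(** The difference splits into the defect of additivity of [z] and [u], the effect of the projection
    error [e], and the time lag between [u] and [u']. Their constants are 2 K^2 + 2 K, 16 K^2 + 4 K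
    and 2 K^2 L. The value of [z] enters the bound only through |sin z|, the quantity that the
    energy controls. *)
Lemma nonlin_perturbation K L r z u e u' tau : 0 <= K -> 0 <= L -> 0 <= r -> r <= 1 -> 0 <= tau ->
  `|u| <= K * r -> `|u'| <= K * r -> `|u' - u| <= L * tau -> `|e| <= K * r ->
  `|nonlin (z + u + e) - nonlin u' - nonlin z| <=
    (18 * K ^+ 2 + 6 * K + 2 * K ^+ 2 * L) * (r * `|sin z| + r ^+ 2 * `|e| + r ^+ 2 * tau).
Proof.
move=> K0 L0 r0 r1 t0 hu hu' hd he.
have Kr := mulr_ge0 K0 r0.
set s := `|sin z|; have s0 : 0 <= s := normr_ge0 _; have s1 : s <= 1 by exact: norm_sin_le1.
have u1 : `|sin u| <= K * r by exact: le_trans (norm_sin_le u) hu.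
have rs := mulr_ge0 r0 s0; have re := mulr_ge0 (sqr_ge0 r) (normr_ge0 e).
have rt := mulr_ge0 (sqr_ge0 r) t0.
have T1 : `|nonlin (z + u) - nonlin z - nonlin u| <= (2 * K ^+ 2 + 2 * K) * (r * s).
  rewrite nonlin_addition; apply: (le_trans (ler_normD _ _)).
  have nm x y t : `|2 * (x * y) * t ^+ 2| = 2 * (`|x| * `|y| * `|t| ^+ 2).
    by rewrite (normrM (2 * _)) (normrM 2) (normrM x) (normrX 2 t) (ger0_norm (_ : 0 <= 2)) ?mulrA.
  rewrite !nm -/s.
  have c1 : `|cos z| <= 1 by exact: norm_cos_le1.
  have c2 : `|cos u| <= 1 by exact: norm_cos_le1.
  have q1 : s * `|cos z| * `|sin u| ^+ 2 <= s * 1 * (K * r) ^+ 2.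
    apply: ler_pM; rewrite ?mulr_ge0 ?exprn_ge0//; first exact: ler_wpM2l.
    by rewrite lerXn2r ?nnegrE.
  have q2 : `|sin u| * `|cos u| * s ^+ 2 <= K * r * 1 * s.
    apply: ler_pM; rewrite ?mulr_ge0 ?exprn_ge0//; first by apply: ler_pM.
    by rewrite expr2 ler_piMl.
  have q3 : s * 1 * (K * r) ^+ 2 <= K ^+ 2 * (r * s).
    rewrite (_ : _ * _ ^+ 2 = r * (K ^+ 2 * (r * s))); last by ring.
    by rewrite ler_piMl// mulr_ge0// sqr_ge0.
  rewrite -!mulrA; rewrite -!mulrA in q1 q2 q3; lra.
have T2 : `|nonlin (z + u + e) - nonlin (z + u)| <= 4 * K * (r * s) + 16 * K ^+ 2 * (r ^+ 2 * `|e|).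
  have [t /andP[t0' t1] ->] := nonlin_diff (z + u) (z + u + e).
  rewrite (_ : z + u + e - (z + u) = e); last by ring.
  rewrite normrM normrM (ger0_norm (_ : 0 <= 2))// normrX.
  set q := `|sin _|.
  have hq : q <= s + 2 * (K * r).
    rewrite /q -addrA; apply: (le_trans (norm_sinD _ _)); rewrite lerD2l.
    apply: (le_trans (norm_sin_le _)); apply: (le_trans (ler_normD _ _)).
    have : `|t * e| <= `|e| by rewrite normrM ler_piMl// ger0_norm.
    lra.
  have q0 : 0 <= q := normr_ge0 _.
  have q2 : q ^+ 2 <= 2 * s ^+ 2 + 8 * (K * r) ^+ 2.
    apply: (@le_trans _ _ ((s + 2 * (K * r)) ^+ 2)).
      by rewrite lerXn2r ?nnegrE// addr_ge0// mulr_ge0.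
    rewrite -subr_ge0 (_ : _ - _ = (s - 2 * (K * r)) ^+ 2); last by ring.
    exact: sqr_ge0.
  have q3 := ler_wpM2r (normr_ge0 e) q2.
  have q4 : s ^+ 2 * `|e| <= K * (r * s).
    rewrite (_ : K * (r * s) = s * (K * r)); last by ring.
    by apply: ler_pM => //; rewrite ?sqr_ge0// expr2 ler_piMl.
  rewrite -mulrA; rewrite mulrDl in q3.
  have e8 : 8 * (K * r) ^+ 2 * `|e| = 8 * K ^+ 2 * (r ^+ 2 * `|e|) by ring.
  rewrite e8 in q3; rewrite -!mulrA in q3 *; lra.
have T3 : `|nonlin u - nonlin u'| <= 2 * K ^+ 2 * L * (r ^+ 2 * tau).
  have [t /andP[t0' t1] ->] := nonlin_diff u' u.
  rewrite normrM normrM (ger0_norm (_ : 0 <= 2))// normrX.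
  have hq : `|sin (u' + t * (u - u'))| <= K * r.
    apply: (le_trans (norm_sin_le _)).
    rewrite (_ : u' + t * (u - u') = (1 - t) * u' + t * u); last by ring.
    apply: (le_trans (ler_normD _ _)); rewrite !normrM (ger0_norm t0') ger0_norm ?subr_ge0//.
    have t1' : 0 <= 1 - t by rewrite subr_ge0.
    have := ler_wpM2l t1' hu'; have := ler_wpM2l t0' hu; lra.
  have q2 : `|sin (u' + t * (u - u'))| ^+ 2 <= (K * r) ^+ 2 by rewrite lerXn2r ?nnegrE.
  rewrite distrC in hd.
  have := ler_pM (exprn_ge0 2 (normr_ge0 _)) (normr_ge0 _) q2 hd.
  rewrite (_ : (K * r) ^+ 2 * (L * tau) = K ^+ 2 * L * (r ^+ 2 * tau)); last by ring.
  by rewrite -!mulrA; lra.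
rewrite (_ : nonlin (z + u + e) - nonlin u' - nonlin z =
  (nonlin (z + u) - nonlin z - nonlin u) + (nonlin (z + u + e) - nonlin (z + u)) + (nonlin u - nonlin u')); last by ring.
apply: (le_trans (ler_normD _ _)).
have := ler_normD (nonlin (z + u) - nonlin z - nonlin u) (nonlin (z + u + e) - nonlin (z + u)).
have K2 : 0 <= K ^+ 2 by exact: sqr_ge0.
have K2L := mulr_ge0 K2 L0.
have := mulr_ge0 K2 rs; have := mulr_ge0 K2 re; have := mulr_ge0 K2 rt.
have := mulr_ge0 K0 re; have := mulr_ge0 K0 rt.
have := mulr_ge0 K2L rs; have := mulr_ge0 K2L re.
lra.
Qed.

End NonlinearTerm.

(** * The energy of the remainder and its relation to the H^1_r norm *)

Section EnergyStep.
Context {R : realType}.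
Implicit Types (f g v w z d e u U : R -> R) (a b x y K L r tau : R).

(* The real-valued counterpart of [energy]. *)
Definition En z : R := 2^-1 * (ip0r (wD 1 z) (wD 1 z) +
  ip0r (fun r => sin (z r) / r) (fun r => sin (z r) / r)).

Lemma sin_div_bmeas z : lip0 z -> bmeas (fun r => sin (z r) / r).
Proof.
move=> lz; have [K K0 zK] := lip0_bound lz.
apply: (@bmeas_div _ _ K); first by have := bmeas_sin (lip0_bmeas lz); case.
by move=> x x01; apply: le_trans (norm_sin_le _) _; exact: zK.
Qed.

Lemma nonlin_bmeas v : bmeas v -> bmeas (fun r => nonlin (v r)).
Proof.
move=> bv; apply: bmeasB => //; apply: bmeasZ; apply: bmeas_sin; exact: bmeasZ.
Qed.

Lemma nonlin_div_bmeas v : lip0 v -> bmeas (fun r => nonlin (v r) / r ^+ 2).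
Proof.
move=> lv; have [K K0 vK] := lip0_bound lv; have bf := nonlin_bmeas (lip0_bmeas lv).
have fK x : 0 <= x <= 1 -> `|nonlin (v x)| <= 2 * K ^+ 3 * x ^+ 3.
  move=> x01; have /andP[x0 x1] := x01; apply: (le_trans (nonlin_cube _)).
  rewrite -mulrA -exprMn; apply: ler_wpM2l => //.
  by rewrite lerXn2r ?nnegrE ?mulr_ge0// vK.
have CK : 0 <= 2 * K ^+ 3 by rewrite mulr_ge0// exprn_ge0.
have x32 x : 0 <= x <= 1 -> x ^+ 3 <= x ^+ 2 /\ x ^+ 2 <= x.
  move=> /andP[x0 x1]; split; first by rewrite [x ^+ 3]exprS ler_piMl ?sqr_ge0.
  by rewrite expr2 ler_piMl.
have b1 : bmeas (fun r => nonlin (v r) / r).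
  apply: (@bmeas_div _ _ (2 * K ^+ 3)); first by case: bf.
  move=> x x01; apply: (le_trans (fK x x01)); apply: ler_wpM2l => //.
  by have [h1 h2] := x32 x x01; exact: le_trans h2.
have : bmeas (fun r => nonlin (v r) / r / r).
  apply: (@bmeas_div _ _ (2 * K ^+ 3)); first by case: b1.
  move=> x x01; have [->|xn0] := eqVneq x 0; first by rewrite invr0 !mulr0 normr0.
  have xp : 0 < x by rewrite lt_neqAle eq_sym xn0; case/andP: x01.
  rewrite normrM normfV (gtr0_norm xp) ler_pdivrMr//; apply: (le_trans (fK x x01)).
  by rewrite -[leRHS]mulrA; apply: ler_wpM2l => //; rewrite -expr2; case: (x32 x x01).
by congr bmeas; apply/funext => r; rewrite -mulrA -invfM expr2.
Qed.

Lemma EnE z g : antider z g -> z 0 = 0 ->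
  2 * En z = integ 0 1 (fun r => g r ^+ 2 * r + (sin (z r) / r) ^+ 2 * r).
Proof.
move=> zg z0; have bI := @bmeas_id R; have bg := zg.1.
have bs : bmeas (fun r => sin (z r) / r) by apply: sin_div_bmeas; split => //; exists g.
rewrite /En mulrA mulfV ?pnatr_eq0// mul1r (ip0r_wD zg zg) ip0rE integD ?lexx ?ler01//; by bm.
Qed.

Lemma En_ge0 z : lip0 z -> 0 <= En z.
Proof.
move=> [z0 [g zg]]; suff : 0 <= 2 * En z by lra.
rewrite (EnE zg z0); apply: integ_ge0 => r /andP[r0 _].
by rewrite addr_ge0// mulr_ge0// sqr_ge0.
Qed.

Lemma En_le_H1r z : lip0 z -> 2 * En z <= ipH1r z z.
Proof.
move=> [z0 [g zg]]; have lz : lip0 z by split => //; exists g.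
have bI := @bmeas_id R; have bg := zg.1; have bs := sin_div_bmeas lz.
rewrite (EnE zg z0) (ipH1rE zg z0 zg z0); apply: integ_le; rewrite ?lexx ?ler01//; [by bm|exact: bmeas_H1r_density|].
move=> r /andP[r0 _]; rewrite /H1r_density -expr2 lerD2l.
apply: ler_wpM2r => //; rewrite -expr2 !exprMn; apply: ler_wpM2r; first exact: sqr_ge0.
exact: sin_sqr_le.
Qed.

(* [1 - cos (z r) = int_0^r z' sin z <= En z <= 1/2], hence [cos z >= 1/2] on all values of [z], and
   [sin z = z cos xi] for an intermediate value [xi]. *)
Lemma H1r_le_En z : lip0 z -> En z <= 2^-1 -> ipH1r z z <= 8 * En z.
Proof.
move=> [z0 [g zg]] E1; have lz : lip0 z by split => //; exists g.
have bI := @bmeas_id R; have bg := zg.1; have bs := sin_div_bmeas lz.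
have bsin := bmeas_sin (antider_bmeas zg).
pose D r := g r ^+ 2 * r + (sin (z r) / r) ^+ 2 * r.
have bD : bmeas D by bm.
have D0 a b : 0 <= a -> 0 <= integ a b D.
  move=> a0; apply: integ_ge0 => r /andP[ar _].
  by have r0 := le_trans a0 ar; rewrite addr_ge0// mulr_ge0// sqr_ge0.
have cosz r : 0 <= r <= 1 -> 2^-1 <= cos (z r).
  move=> /andP[r0 r1].
  have := antiderE (antider_cos zg) (lexx 0) r0 r1; rewrite z0 cos0 => e.
  have h : integ 0 r (fun x => (-2^-1) * D x) <= integ 0 r (fun x => - (sin (z x) * g x)).
    apply: integ_le => //; [exact: bmeasZ|by bm|].
    move=> x /andP[x0 _]; rewrite /D -subr_ge0.
    have [->|xn0] := eqVneq x 0; first by rewrite z0 sin0; lra.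
    rewrite (_ : _ - _ = 2^-1 * ((g x - sin (z x) / x) ^+ 2 * x)); last by field.
    by rewrite mulr_ge0// mulr_ge0// sqr_ge0.
  rewrite integZ// in h.
  have : integ 0 r D <= 1.
    have c := integ_cat (lexx 0) (lexx 1) bD (c := r); rewrite r0 r1 in c.
    have := c isT; have := D0 r 1 r0; have := EnE zg z0; rewrite -/D; lra.
  by move: e h; lra.
have key r : 0 <= r <= 1 -> z r ^+ 2 <= 4 * sin (z r) ^+ 2.
  move=> /andP[r0 r1].
  have [t /andP[t0 t1]] := MVT_between 0 (z r) (fun x => @is_derive_sin R x).
  rewrite sin0 !subr0 add0r => e.
  have [s sr zs] : exists2 s, s \in `[0, r] & z s = t * z r.
    apply: IVT => //; first exact: itv_within (antider_continuous zg).
    rewrite z0; have [zr|zr] := leP 0 (z r).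
      by rewrite mulr_ge0//= ler_piMl.
    have t1' : 0 <= 1 - t by rewrite subr_ge0.
    have := mulr_ge0 t0 (ltW (_ : 0 < - z r)); rewrite oppr_gt0 => /(_ zr).
    have := mulr_ge0 t1' (ltW (_ : 0 < - z r)); rewrite oppr_gt0 => /(_ zr).
    by move=> h1 h2; apply/andP; split; lra.
  rewrite in_itv/= in sr; have /andP[s0 sr'] := sr.
  have c := cosz s; rewrite s0 (le_trans sr' r1) zs in c.
  have {}c := c isT.
  have c2 : 4^-1 <= cos (t * z r) ^+ 2.
    rewrite (_ : 4^-1 = 2^-1 ^+ 2 :> R); last by field.
    by rewrite lerXn2r ?nnegrE//; lra.
  rewrite e exprMn; have := ler_wpM2r (sqr_ge0 (z r)) c2; lra.
rewrite (ipH1rE zg z0 zg z0).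
apply: (@le_trans _ _ (4 * (2 * En z))); last by lra.
rewrite (EnE zg z0) -integZ ?lexx ?ler01//.
apply: integ_le; rewrite ?lexx ?ler01//; [exact: bmeas_H1r_density|by bm|].
move=> r /andP[r0 r1]; rewrite H1r_density_diag//.
have h := key r; rewrite r0 r1 in h; have {}h := h isT.
have p := mulr_ge0 (sqr_ge0 (g r)) r0.
have q : z r ^+ 2 / r <= 4 * ((sin (z r) / r) ^+ 2 * r).
  have [->|rn0] := eqVneq r 0; first by rewrite invr0 !mulr0.
  rewrite (_ : 4 * _ = 4 * sin (z r) ^+ 2 / r); last by field.
  by apply: ler_wpM2r; rewrite ?invr_ge0.
lra.
Qed.

End EnergyStep.

(** * One step of the scheme in the energy, and Gronwall's lemma *)

Section EnergyEstimate.
Context {R : realType}.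
Implicit Types (f g v w z d e u U : R -> R) (a b x y K L r tau : R).

Lemma integ_lin c f g : bmeas f -> bmeas g ->
  integ 0 1 (fun r => c * f r + g r) = c * integ 0 1 f + integ 0 1 g.
Proof.
by move=> bf bg; rewrite integD ?lexx ?ler01 ?integZ ?lexx ?ler01//; exact: bmeasZ.
Qed.

(** The energy step as an inequality between integrands. Half of [(z' - z)^2 r] absorbs the product
    with [B = A - nonlin z] by Young's inequality, at the cost of [tau^2 B^2 / (2 r^3)]; the powers
    of r in the hypothesis are those that make [B^2 / r^3] comparable to the energy density. The
    part [nonlin z] is treated by [nonlin_convex]. *)
Lemma energy_step_density (C0 tau r g g' z z' e A : R) : 0 <= r <= 1 -> 0 <= tau -> 0 <= C0 ->
  `|A - nonlin z| <= C0 * (r * `|sin z| + r ^+ 2 * `|e| + r ^+ 2 * tau) ->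
  (r = 0 -> z = 0 /\ z' = 0) ->
  2^-1 * ((z' - z) * (z' - z) * r) + (2^-1 * tau * (g' ^+ 2 * r + (sin z' / r) ^+ 2 * r) +
    ((- (2^-1 * tau) - 2^-1 * tau ^+ 2 * (3 * C0 ^+ 2)) * (g ^+ 2 * r + (sin z / r) ^+ 2 * r) +
    (- (2^-1 * tau ^+ 2 * (3 * C0 ^+ 2)) * (e ^+ 2 / r) +
     - (2^-1 * tau ^+ 2 * (3 * C0 ^+ 2) * tau ^+ 2)))) <=
  1 * ((z' - z) * (z' - z) * r) + (tau * (g' * (g' - g) * r + z' / r * ((z' - z) / r) * r) +
    - tau * (A / r ^+ 2 * (z' - z) * r)) :> R.
Proof.
move=> /andP[r0 r1] t0 C00 hA hz; set k := 2^-1 * tau ^+ 2 * (3 * C0 ^+ 2).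
have k0 : 0 <= k.
  have c2 : 0 <= 2^-1 :> R by rewrite invr_ge0.
  exact: mulr_ge0 (mulr_ge0 c2 (sqr_ge0 tau)) (mulr_ge0 (ler0n _ 3) (sqr_ge0 C0)).
have [re|rn0] := eqVneq r 0.
  by have [-> ->] := hz re; rewrite re !(mulr0, mul0r, invr0, subr0, addr0, add0r) oppr_le0 mulr_ge0// sqr_ge0.
have rp : 0 < r by rewrite lt_neqAle eq_sym rn0.
have rVp : 0 < r^-1 by rewrite invr_gt0.
set B := A - nonlin z in hA.
have AE : A = nonlin z + B by rewrite /B; ring.
have B2 : B ^+ 2 / r ^+ 3 <= 3 * C0 ^+ 2 * ((sin z / r) ^+ 2 * r + e ^+ 2 / r + tau ^+ 2).
  rewrite ler_pdivrMr ?exprn_gt0//.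
  have h0 : 0 <= C0 * (r * `|sin z| + r ^+ 2 * `|e| + r ^+ 2 * tau).
    by rewrite mulr_ge0// !addr_ge0// mulr_ge0// sqr_ge0.
  have h1 : B ^+ 2 <= (C0 * (r * `|sin z| + r ^+ 2 * `|e| + r ^+ 2 * tau)) ^+ 2.
    by rewrite -[leLHS]real_normK ?num_real// lerXn2r ?nnegrE.
  apply: (le_trans h1).
  rewrite (_ : 3 * C0 ^+ 2 * _ * r ^+ 3 = C0 ^+ 2 * (3 * (r ^+ 2 * sin z ^+ 2 + r ^+ 2 * e ^+ 2 + r ^+ 3 * tau ^+ 2))); last by field.
  rewrite exprMn; apply: ler_wpM2l; first exact: sqr_ge0.
  apply: (@le_trans _ _ (3 * ((r * `|sin z|) ^+ 2 + (r ^+ 2 * `|e|) ^+ 2 + (r ^+ 2 * tau) ^+ 2))).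
    set x1 := r * _; set x2 := _ * `|e|; set x3 := _ * tau.
    have p1 := sqr_ge0 (x1 - x2); have p2 := sqr_ge0 (x1 - x3); have p3 := sqr_ge0 (x2 - x3).
    move: p1 p2 p3; move: x1 x2 x3 => x1 x2 x3; lra.
  apply: ler_wpM2l => //; rewrite !exprMn !real_normK ?num_real//.
  have r42 : (r ^+ 2) ^+ 2 <= r ^+ 2 by rewrite expr2 ler_piMl ?sqr_ge0// exprn_ile1.
  have r43 : (r ^+ 2) ^+ 2 <= r ^+ 3.
    by rewrite (_ : (r ^+ 2) ^+ 2 = r * r ^+ 3); [rewrite ler_piMl// exprn_ge0|ring].
  have := ler_wpM2r (sqr_ge0 e) r42; have := ler_wpM2r (sqr_ge0 tau) r43; lra.
have cv := nonlin_convex z z'.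
have cvr : (2^-1 * sin z' ^+ 2 - 2^-1 * sin z ^+ 2) / r <= (z' - nonlin z) * (z' - z) / r.
  by apply: ler_wpM2r => //; exact: ltW.
have c2 : 0 <= 2^-1 :> R by rewrite invr_ge0.
have kB := ler_wpM2l (mulr_ge0 c2 (sqr_ge0 tau)) B2.
have cvt := ler_wpM2l t0 cvr.
pose S := sin z / r; pose S' := sin z' / r; pose q := nonlin z / r ^+ 2; pose b := B / r ^+ 2.
pose p' := z' / r; pose dd := (z' - z) / r; pose d := z' - z; pose e2 := e ^+ 2 / r.
have e1 : A / r ^+ 2 = q + b by rewrite AE mulrDl.
have e3 : B ^+ 2 / r ^+ 3 = b ^+ 2 * r by rewrite /b; field.
have e4 : (2^-1 * sin z' ^+ 2 - 2^-1 * sin z ^+ 2) / r = 2^-1 * S' ^+ 2 * r - 2^-1 * S ^+ 2 * r.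
  by rewrite /S /S'; field.
have e5 : (z' - nonlin z) * (z' - z) / r = p' * dd * r - q * d * r by rewrite /p' /dd /q /d; field.
rewrite e1 -/S -/S' -/e2 -/p' -/dd -/d.
rewrite e4 e5 in cvt; rewrite e3 -/S -/e2 in kB.
have {}kB : 2^-1 * tau ^+ 2 * (b ^+ 2 * r) <= k * (S ^+ 2 * r + e2 + tau ^+ 2).
  by apply: (le_trans kB); rewrite le_eqVlt; apply/orP; left; apply/eqP; rewrite /k; ring.
have sq1 : 0 <= r * (d - tau * b) ^+ 2 by rewrite mulr_ge0// sqr_ge0.
have sq2 : 0 <= tau * ((g' - g) ^+ 2 * r) by rewrite mulr_ge0// mulr_ge0// sqr_ge0.
have g2 : 0 <= k * (g ^+ 2 * r) by rewrite mulr_ge0// mulr_ge0// sqr_ge0.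
move: k0 cvt kB sq1 sq2 g2 {AE B2 e1 e3 e4 e5 cv cvr}.
move: S S' q b p' dd d e2 k => S S' q b p' dd d e2 k; lra.
Qed.

(* Testing with [z' - z] makes the discrete equation an estimate for the increment of the energy, since
   the primitive of [nonlin] is convex. *)
Lemma energy_step K L : 0 <= K -> 0 <= L -> exists2 C, 0 <= C & forall tau z z' u u' e,
  0 < tau -> lip0 z -> lip0 z' -> lip0 u -> lip0 u' -> lip0 e ->
  (forall r, 0 <= r <= 1 -> [/\ `|u r| <= K * r, `|u' r| <= K * r, `|u' r - u r| <= L * tau &
     `|e r| <= K * r]) ->
  let d r := z' r - z r in
  ip0r d d + tau * ipH1r z' d <=
    tau * ip0r (fun r => (nonlin (z r + u r + e r) - nonlin (u' r)) / r ^+ 2) d +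
    tau * (L * tau * Num.sqrt (ip0r d d)) ->
  En z' <= (1 + C * tau) * En z + C * tau * (tau ^+ 2 + ipH1r e e).
Proof.
move=> K0 L0; pose C0 := 18 * K ^+ 2 + 6 * K + 2 * K ^+ 2 * L.
have C00 : 0 <= C0.
  by rewrite /C0; have := sqr_ge0 K; have := mulr_ge0 (sqr_ge0 K) L0; lra.
exists (3 * C0 ^+ 2 + L ^+ 2).
  by have := sqr_ge0 C0; have := sqr_ge0 L; lra.
move=> tau z z' u u' e t0 lz lz' lu lu' le hb d H.
have [z0 [g zg]] := lz; have [z'0 [g' zg']] := lz'; have [e0 [ge eg]] := le.
have ld : lip0 d by exact: (subspB subsp_lip0 lz' lz).
have [d0 _] := ld; have dg := antiderB zg' zg.
have lU : lip0 (fun r => z r + u r + e r).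
  exact: (subspD subsp_lip0 (subspD subsp_lip0 lz lu) le).
have bI := @bmeas_id R; have bg := zg.1; have bg' := zg'.1.
have bs := sin_div_bmeas lz; have bs' := sin_div_bmeas lz'.
have bd := lip0_bmeas ld.
pose X r := (nonlin (z r + u r + e r) - nonlin (u' r)) / r ^+ 2.
have bX : bmeas X.
  have := bmeasB (nonlin_div_bmeas lU) (nonlin_div_bmeas lu').
  by congr bmeas; apply/funext => r; rewrite -mulrBl.
pose fD r := d r * d r * r.
pose P r := g r ^+ 2 * r + (sin (z r) / r) ^+ 2 * r.
pose P' r := g' r ^+ 2 * r + (sin (z' r) / r) ^+ 2 * r.
pose Q r := e r ^+ 2 / r.
have bQ : bmeas Q.
  have := bmeasM (lip0_div_bmeas le) (lip0_bmeas le); congr bmeas.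
  by apply/funext => r; rewrite /Q expr2 mulrAC.
pose A' r := g' r * (g' r - g r) * r + z' r / r * (d r / r) * r.
pose Y r := X r * d r * r.
have bfD : bmeas fD by bm.
have bP : bmeas P by bm.
have bP' : bmeas P' by bm.
have bY : bmeas Y by bm.
have bA' : bmeas A' by exact: (bmeas_H1r_density zg' z'0 dg d0).
pose k := 2^-1 * tau ^+ 2 * (3 * C0 ^+ 2).
have I : integ 0 1 (fun r => 2^-1 * fD r + (2^-1 * tau * P' r + ((- (2^-1 * tau) - k) * P r +
     (- k * Q r + - (k * tau ^+ 2))))) <=
   integ 0 1 (fun r => 1 * fD r + (tau * A' r + - tau * Y r)).
  apply: integ_le; rewrite ?lexx ?ler01//; [by bm|by bm|].
  move=> r r01; have [h1 h2 h3 h4] := hb r r01; have /andP[r0 r1] := r01.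
  apply: energy_step_density => //; first exact: ltW.
    exact: (nonlin_perturbation _ K0 L0 r0 r1 (ltW t0) h1 h2 h3 h4).
  by move=> ->; rewrite z0 z'0.
have bc c : bmeas (fun=> c : R) := bmeas_cst c.
rewrite !integ_lin// in I; try (by bm).
rewrite integ_cst ?ler01// subr0 mulr1 integZ ?lexx ?ler01// in I.
have eP := EnE zg z0; have eP' := EnE zg' z'0.
rewrite -/P in eP; rewrite -/P' in eP'.
have eQ : integ 0 1 Q <= ipH1r e e.
  rewrite (ipH1rE eg e0 eg e0); apply: integ_le; rewrite ?lexx ?ler01//; first exact: bmeas_H1r_density.
  by move=> r /andP[r0 r1]; rewrite H1r_density_diag// /Q lerDr mulr_ge0// sqr_ge0.
have eA : ipH1r z' d = integ 0 1 A' by exact: (ipH1rE zg' z'0 dg d0).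
have eY : ip0r X d = integ 0 1 Y by [].
rewrite -/X eA eY ip0rE -/fD in H.
rewrite -eP -eP' in I.
set D := integ 0 1 fD in I H.
have D0 : 0 <= D by exact: (psd_ge0 psd_ip0r bd).
have sD := sqr_sqrtr D0.
(* The half of [ip0r d d] that is still available absorbs the consistency error. *)
have amgm : tau * (L * tau * Num.sqrt D) <= 2^-1 * D + 2^-1 * (L ^+ 2 * tau * (tau * (tau * tau))).
  rewrite -subr_ge0 -[X in _ * X + _]sD.
  rewrite (_ : _ - _ = 2^-1 * (Num.sqrt D - L * tau * tau) ^+ 2); last by field.
  by rewrite mulr_ge0 ?invr_ge0// sqr_ge0.
have k0 : 0 <= k.
  have c2 : 0 <= 2^-1 :> R by rewrite invr_ge0.
  exact: mulr_ge0 (mulr_ge0 c2 (sqr_ge0 tau)) (mulr_ge0 (ler0n _ 3) (sqr_ge0 C0)).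
have kQ := ler_wpM2l k0 eQ.
have main : tau * (En z' - En z) <= k * (2 * En z + ipH1r e e + tau ^+ 2) +
   2^-1 * (L ^+ 2 * tau * (tau * (tau * tau))) by lra.
have {}main : tau * (En z' - En z) <= tau * (2^-1 * tau * (3 * C0 ^+ 2) * (2 * En z + ipH1r e e + tau ^+ 2) +
   2^-1 * (L ^+ 2 * (tau * (tau * tau)))).
  by apply: (le_trans main); rewrite le_eqVlt; apply/orP; left; apply/eqP; rewrite /k; ring.
rewrite ler_pM2l// in main.
have E0 := En_ge0 lz; have e00 : 0 <= ipH1r e e by exact: (psd_ge0 psd_ipH1r).
have tt : 0 <= tau := ltW t0.
have p1 := mulr_ge0 (mulr_ge0 tt (sqr_ge0 C0)) E0.
have p2 := mulr_ge0 (mulr_ge0 tt (sqr_ge0 C0)) e00.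
have p3 := mulr_ge0 (mulr_ge0 tt (sqr_ge0 C0)) (sqr_ge0 tau).
have p4 := mulr_ge0 (mulr_ge0 tt (sqr_ge0 L)) E0.
have p5 := mulr_ge0 (mulr_ge0 tt (sqr_ge0 L)) e00.
have p6 := mulr_ge0 (mulr_ge0 tt (sqr_ge0 L)) (sqr_ge0 tau).
rewrite (_ : L ^+ 2 * (tau * (tau * tau)) = tau * L ^+ 2 * tau ^+ 2) in main; last by ring.
lra.
Qed.

(** [E + eta] satisfies the homogeneous recursion, and [(1 + C tau)^j <= exp (C j tau)]. *)
Lemma discrete_gronwall (E : nat -> R) (C tau eta T : R) J : 0 <= C -> 0 <= tau -> 0 <= eta ->
  J%:R * tau <= T -> (forall j, 0 <= E j) ->
  (forall j, (j < J)%N -> E j.+1 <= (1 + C * tau) * E j + C * tau * eta) ->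
  forall j, (j <= J)%N -> E j <= expR (C * T) * (E 0%N + eta).
Proof.
move=> C0 t0 e0 JT E0 step j jJ.
have Ct : 0 <= C * tau by rewrite mulr_ge0.
have H i : (i <= J)%N -> E i + eta <= (1 + C * tau) ^+ i * (E 0%N + eta).
  elim: i => [_|i ih iJ]; first by rewrite expr0 mul1r.
  have h := ler_wpM2l (_ : 0 <= 1 + C * tau) (ih (ltnW iJ)); have {}h := h (addr_ge0 ler01 Ct).
  by rewrite exprS -mulrA; have := step i iJ; lra.
have := H j jJ.
have EE : 0 <= E 0%N + eta by rewrite addr_ge0.
suff : (1 + C * tau) ^+ j <= expR (C * T) by move=> /(ler_wpM2r EE); lra.
apply: (@le_trans _ _ (expR (C * tau) ^+ j)).
  by rewrite lerXn2r ?nnegrE ?expR_ge0 ?expR_ge1Dx// addr_ge0.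
rewrite -expRM_natl ler_expR mulrCA; apply: ler_wpM2l => //; apply: le_trans JT.
by apply: ler_wpM2r => //; rewrite ler_nat.
Qed.

End EnergyEstimate.

(** * Consistency of the time discretization *)

Section DerivativesWithin.
Context {R : realType}.
Implicit Types (f g v w q : R -> R) (A : set R) (a b x y d e : R).
Local Notation mu := (@lebesgue_measure R).
Local Notation I := (@unit_interval R).

Lemma has_deriv_withinP A f x d : has_deriv_within A f x d <->
  forall e, 0 < e -> exists2 del, 0 < del & forall y, A y -> y != x -> `|y - x| < del ->
    `|(f y - f x) / (y - x) - d| <= e.
Proof.
split=> [/cvgrPdist_le H e e0|H].
  have := H e e0; rewrite near_withinE => /nbhs_ballP[del del0 Hd]; exists del => // y Ay yx ydel.
  by rewrite distrC; apply: Hd => //; rewrite /ball/= distrC.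
apply/cvgrPdist_le => e /H[del del0 Hd]; rewrite near_withinE.
apply/nbhs_ballP; exists del => //= y; rewrite /ball/= distrC => ydel yx Ay.
by rewrite distrC; exact: Hd.
Qed.

Lemma has_deriv_within_is_derive a b f x d : a < x -> x < b ->
  has_deriv_within `[a, b] f x d -> is_derive x 1 f d.
Proof.
move=> ax xb /has_deriv_withinP H.
suff cv : h^-1 *: (f (h *: 1 + x) - f x) @[h --> 0^'] --> d.
  by apply: DeriveDef; [apply/cvg_ex; exists d|exact: cvg_lim].
apply/cvgrPdist_le => e /H[del del0 Hd]; rewrite near_withinE.
pose eta := Num.min del (Num.min (x - a) (b - x)).
have eta0 : 0 < eta by rewrite !lt_min del0 !subr_gt0 ax.
apply/nbhs_ballP; exists eta => //= h; rewrite /ball/= sub0r normrN !lt_min => /and3P[h1 h2 h3] h0.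
have e1 : h + x - x = h by ring.
have := Hd (h + x); rewrite e1 distrC => Hh.
rewrite /GRing.scale/= mulr1 mulrC; apply: Hh => //.
- move: h2 h3; rewrite !ltr_norml => /andP[h2 _] /andP[_ h3].
  by rewrite /= in_itv/=; apply/andP; split; lra.
- by rewrite -subr_eq0 e1.
Qed.

Lemma has_deriv_within_cont A f x d : has_deriv_within A f x d ->
  f y @[y --> within A (nbhs x)] --> f x.
Proof.
move=> /has_deriv_withinP /(_ 1 ltr01)[del del0 Hd].
apply/cvgrPdist_le => e e0; rewrite near_withinE.
pose eta := Num.min del (e / (`|d| + 1)).
have d1 : 0 < `|d| + 1 by rewrite ltr_wpDl.
apply/nbhs_ballP; exists eta => /=; first by rewrite lt_min del0 divr_gt0.
move=> y; rewrite /ball/= distrC lt_min => /andP[y1 y2] Ay.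
have [->|yx] := eqVneq y x; first by rewrite subrr normr0 ltW.
have yx0 : y - x != 0 by rewrite subr_eq0.
rewrite distrC -[f y - f x](divfK yx0) normrM.
have h : `|(f y - f x) / (y - x)| <= `|d| + 1.
  have := ler_normD ((f y - f x) / (y - x) - d) d; rewrite subrK.
  by have := Hd y Ay yx y1; lra.
apply: (le_trans (ler_wpM2r (normr_ge0 _) h)).
by rewrite mulrC -ler_pdivlMr// ltW.
Qed.

(** Lebesgue differentiation. It identifies the bounded representative of the second space
    derivative with the classical one in the equation. *)
Lemma antider_is_derive_ae v g : antider v g ->
  {ae mu, forall x, 0 < x < 1 -> derive1 v x = g x}.
Proof.
move=> vg; have bg := vg.1.
pose f := g \_ I.
have ig : mu.-integrable I (EFin \o g) by exact: bmeas_integrable.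
have iT : mu.-integrable setT (EFin \o f).
  by rewrite -restrict_EFin; exact: ((@integrable_mkcond _ _ _ mu _ (EFin \o g) (measurable_itv _)).1 ig).
have lf : locally_integrable [set: R] f by exact: (integrable_locally (measurable_itv _) ig).
have ify y : mu.-integrable [set` Interval (BLeft 0) (BRight y)] (EFin \o f).
  by apply: integrableS iT.
apply: (ae_imp (FTC1 ify lf)) => x H /andP[x0 x1].
have [] := H; first by rewrite /= lte_fin.
set F := fun x => _.
have F0 : \forall z \near x, v z - v 0 = F z.
  have : \forall z \near x, 0 < z < 1.
    near=> z; apply/andP; split; near: z; [exact: lt_nbhsr|exact: lt_nbhsl].
  apply: filterS => z /andP[z0 z1]; rewrite /F -(antiderE vg (lexx 0) (ltW z0) (ltW z1)).
  apply/esym/eq_Rintegral => t; rewrite inE/= in_itv/= => /andP[t0 tz].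
  by rewrite /f patchE mem_set// unit_intervalE t0 (le_trans tz)// ltW.
rewrite derive1E => dF eF.
have hF : is_derive x 1 F (f x) by exact: DeriveDef.
have hG : is_derive x 1 (F + cst (v 0)) (f x).
  by have := is_deriveD hF (is_derive_cst (v 0) x 1); rewrite addr0.
have vF : {near x, F + cst (v 0) =1 v}.
  apply: filterS F0 => z e; rewrite -[LHS]/(F z + v 0) -e subrK //.
rewrite derive1E -(near_eq_derive _ vF) derive_val /f patchE mem_set//.
by rewrite unit_intervalE !ltW.
Unshelve. all: by end_near. Qed.

Lemma normL2_bmeas q : bmeas q -> normL 2 q = (Num.sqrt (integ 0 1 (fun r => q r ^+ 2)))%:E.
Proof.
move=> bq; have bq2 := bmeasX 2 bq.
have Q0 : 0 <= integ 0 1 (fun r => q r ^+ 2) by apply: integ_ge0 => r _; exact: sqr_ge0.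
have h : ('N[mu]_2%:E[EFin \o (q \_ I)] `^ 2 = (integ 0 1 (fun r => q r ^+ 2))%:E)%E.
  rewrite powR_Lnorm ?pnatr_eq0//.
  have iq : mu.-integrable I (EFin \o (fun r => q r ^+ 2)) by exact: bmeas_integrable.
  rewrite /integ /Rintegral fineK; last exact: integrable_fin_num.
  rewrite [RHS]integral_mkcond; apply: eq_integral => x _.
  rewrite /= !patchE; case: ifPn => xI /=.
    by rewrite powR_mulrn// real_normK// num_real.
  by rewrite (_ : point = 0 :> R)// normr0 powR0// pnatr_eq0.
move: h; rewrite /normL.
have := Lnorm_ge0 mu 2%:E (EFin \o (q \_ I)).
case: ('N[mu]_2%:E[_])%E => [n| |]//=.
- rewrite lee_fin => n0 [e]; congr EFin.
  by rewrite -e powR_mulrn// sqrtr_sqr ger0_norm.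
- by rewrite pnatr_eq0.
Qed.

Lemma pair_L2 f q m : measurable_fun I f -> bmeas q -> (normL 2 f <= m%:E)%E ->
  mu.-integrable I (EFin \o (fun r => f r * q r)) /\
  `|integ 0 1 (fun r => f r * q r)| <= m * Num.sqrt (integ 0 1 (fun r => q r ^+ 2)).
Proof.
move=> mf bq nf; have mI : measurable (I : set R) by exact: measurable_itv.
set Q := Num.sqrt _; have Q0 : 0 <= Q by exact: sqrtr_ge0.
have mfI : measurable_fun setT (f \_ I) by exact/(measurable_restrictT _ mI).
have mqI : measurable_fun setT (q \_ I) by apply/(measurable_restrictT _ mI); case: bq.
have := @hoelder _ _ _ mu (f \_ I) (q \_ I) 2 2 mfI mqI (ltr0n _ 2) (ltr0n _ 2).
have e2 : 2^-1 + 2^-1 = 1 :> R by field.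
move=> /(_ e2); rewrite -/(normL 2 f) -/(normL 2 q) (normL2_bmeas bq) -/Q => H.
have {}H : (\int[mu]_(x in I) `|(f x * q x)%:E| <= (m * Q)%:E)%E.
  rewrite EFinM; apply: le_trans (lee_wpmul2r _ nf); last by rewrite lee_fin.
  apply: le_trans H; rewrite Lnorm1 [X in (X <= _)%E]integral_mkcond le_eqVlt; apply/orP; left; apply/eqP.
  apply: eq_integral => x _; rewrite /= !patchE; case: ifPn => xI //=.
  by rewrite (_ : point = 0 :> R)// mul0r normr0.
have ifq : mu.-integrable I (EFin \o (fun r => f r * q r)).
  apply/integrableP; split; last exact: le_lt_trans H (ltry _).
  by apply/measurable_EFinP; apply: measurable_funM => //; case: bq.
split => //; apply: (le_trans (le_normr_Rintegral _ _)) => //.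
rewrite -lee_fin /Rintegral fineK//; apply: (@integrable_fin_num _ _ _ mu) => //.
exact: integrable_norm ifq.
Qed.

End DerivativesWithin.

(** * Pointwise bounds, weak form and time consistency of the solution *)

Section PDESolution.
Context {R : realType}.
Implicit Types (f g v w p q : R -> R) (A : set R) (a b x y d e r s t K : R).
Local Notation mu := (@lebesgue_measure R).
Local Notation I := (@unit_interval R).

Lemma antider_quad v g K : antider v g ->
  (forall x y, 0 <= x <= 1 -> 0 <= y <= 1 -> `|g y - g x| <= K * `|y - x|) ->
  forall x y, 0 <= x <= 1 -> 0 <= y <= 1 -> `|v y - v x - g x * (y - x)| <= K * (y - x) ^+ 2.
Proof.
move=> vg gK x y x01 y01; have /andP[x0 x1] := x01; have /andP[y0 y1] := y01.
have K0 : 0 <= K.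
  by have := gK 0 1; rewrite !lexx ler01 subr0 normr1 mulr1 => /(_ isT isT); apply: le_trans.
have w : antider (fun z => v z - g x * z) (fun z => g z - g x).
  have h := antiderB vg (antiderZ (g x) antider_id).
  by apply: (eq_antider h) => // z _; rewrite mulr1.
rewrite (_ : _ - _ = v y - g x * y - (v x - g x * x)); last by ring.
rewrite -real_normK ?num_real// expr2 mulrA.
have [xy|yx] := leP x y.
  rewrite (ger0_norm (_ : 0 <= y - x)) ?subr_ge0//.
  apply: (antider_bound w) => // z /andP[xz zy].
  apply: (le_trans (gK x z x01 _)); first by rewrite (le_trans x0)// (le_trans zy).
  by apply: ler_wpM2l => //; rewrite ger0_norm ?subr_ge0// lerD2r.
rewrite distrC [`|y - x|]distrC (ger0_norm (_ : 0 <= x - y)) ?subr_ge0 ?(ltW yx)//.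
apply: (antider_bound w) => //; first exact: ltW.
move=> z /andP[yz zx].
apply: (le_trans (gK x z x01 _)); first by rewrite (le_trans y0)// (le_trans zx).
by apply: ler_wpM2l => //; rewrite distrC ger0_norm ?subr_ge0// lerD2l lerN2.
Qed.

Lemma antider_is_derive v g K r : antider v g ->
  (forall x y, 0 <= x <= 1 -> 0 <= y <= 1 -> `|g y - g x| <= K * `|y - x|) ->
  0 < r < 1 -> is_derive r 1 v (g r).
Proof.
move=> vg gK /andP[r0 r1]; apply: (@is_derive_quad _ _ _ _ K).
near=> s; apply: (antider_quad vg gK); first by rewrite !ltW.
by apply/andP; split; apply: ltW; near: s; [exact: lt_nbhsr|exact: lt_nbhsl].
Unshelve. all: by end_near. Qed.

Lemma derivative_le_lip v x d K : is_derive x 1 v d ->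
  (\forall y \near x, `|v y - v x| <= K * `|y - x|) -> `|d| <= K.
Proof.
move=> [dv vd] /nbhs_ballP[del /= del0 H].
apply/ler_addgt0Pr => e e0.
have /cvgrPdist_le /(_ e e0) : h^-1 *: (v (h *: 1 + x) - v x) @[h --> 0^'] --> d.
  by rewrite -vd; exact: dv.
rewrite near_withinE => /nbhs_ballP[del' /= del0' H'].
pose h := Num.min del del' / 2.
have m0 : 0 < Num.min del del' by rewrite lt_min del0.
have h0 : 0 < h by rewrite divr_gt0.
have hm : h < Num.min del del' by rewrite /h ltr_pdivrMr//; lra.
have [h1 h2] : h < del /\ h < del' by move: hm; rewrite lt_min => /andP.
have := H' h; rewrite /ball/= sub0r normrN (gtr0_norm h0) => /(_ h2 (lt0r_neq0 h0)).
have := H (h + x); rewrite /ball/= opprD addrCA subrr addr0 normrN addrK (gtr0_norm h0) => /(_ h1).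
rewrite /GRing.scale/= mulr1 => a1 a2.
have a3 : `|h^-1 * (v (h + x) - v x)| <= K.
  by rewrite normrM normfV (gtr0_norm h0) mulrC ler_pdivrMr.
by have := ler_normD (d - h^-1 * (v (h + x) - v x)) (h^-1 * (v (h + x) - v x)); rewrite subrK; lra.
Qed.

Lemma sobolev_measurable v : sobolev 1 2 v -> measurable_fun I v.
Proof.
by move=> sv; have [[g [lv _ _]] _] := sv 0%N isT; exact: locally_integrable_measurable.
Qed.

Variables (T : R) (k : nat) (M : R) (u0 : R -> R) (u ut utt : R -> R -> R).
Hypotheses (T_gt0 : 0 < T) (k1 : (1 <= k)%N) (M0 : 0 <= M).
Hypotheses (sol : pde_solution T u0 u ut) (reg : regularity_bound T k M u ut utt).

Lemma time_in t : 0 <= t <= T -> t \in `[0, T].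
Proof. by rewrite in_itv. Qed.

Lemma sol_within t : 0 <= t <= T -> {within I, continuous (u t)}.
Proof.
move=> tT; apply/subspace_continuousP => x xI.
have /subspace_continuousP/(_ (t, x)) H := sol_continuous sol.
have {}H := H (conj (time_in tT) xI).
apply/cvgrPdist_le => e e0; move/cvgrPdist_le: H => /(_ e e0).
rewrite !near_withinE => -[[A B] /= [At Bx] AB].
apply: filterS Bx => y By yI; apply: (AB (t, y)) => /=.
  by split => //; exact: nbhs_singleton At.
by split => //; exact: time_in.
Qed.

Lemma sol_bounds t : 0 <= t <= T ->
  (normWoo k.+1 (u t) <= M%:E)%E /\ (normL 2 (utt t) <= M%:E)%E.
Proof.
move=> tT; have := reg_bound reg (time_in tT).
have h1 : (0 <= normWoo k.+1 (u t))%E by apply: sume_ge0 => i _; exact: Lnorm_ge0.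
have h2 : (0 <= normH 1 (ut t))%E by exact: sqrte_ge0.
have h3 : (0 <= normL 2 (utt t))%E by exact: Lnorm_ge0.
move=> H; split; apply: le_trans H.
  by rewrite -addeA leeDl// adde_ge0.
by rewrite leeDr// adde_ge0.
Qed.

Lemma sol_chain t : 0 <= t <= T -> exists Q, smooth_chain k M (u t) Q.
Proof.
move=> tT; apply: sobolev_chain => //; first exact: sol_within.
  exact: (reg_u reg (time_in tT)).
by case: (sol_bounds tT).
Qed.

Lemma sol_bdry t : 0 <= t <= T -> u t 0 = 0 /\ u t 1 = 0.
Proof. by move=> tT; exact: (sol_bc sol (time_in tT)). Qed.

Lemma sol_derivs t : 0 <= t <= T -> exists Q1 Q2, [/\ antider (u t) Q1, antider Q1 Q2,
  forall x, 0 <= x <= 1 -> `|Q1 x| <= M & forall x, 0 <= x <= 1 -> `|Q2 x| <= M].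
Proof.
move=> /sol_chain[Q [Q0 aQ QM]]; exists (Q 1%N), (Q 2%N); split.
- by apply: (eq_antider (aQ 0%N isT)) => // x; exact: Q0.
- exact: aQ.
- by move=> x; exact: QM.
- by move=> x; exact: QM.
Qed.

Lemma sol_lip0 t : 0 <= t <= T -> lip0 (u t).
Proof.
move=> tT; have [Q1 [Q2 [h _ _ _]]] := sol_derivs tT.
by split; [case: (sol_bdry tT)|exists Q1].
Qed.

Lemma sol_le t r : 0 <= t <= T -> 0 <= r <= 1 -> `|u t r| <= M * r.
Proof.
move=> tT r01; have [Q1 [Q2 [h _ hb _]]] := sol_derivs tT.
have := antider_lip_bound h hb (x := 0) (y := r).
rewrite lexx ler01 (sol_bdry tT).1 !subr0 => /(_ isT r01).
by rewrite (@ger0_norm _ r)//; case/andP: r01.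
Qed.

Lemma sol_classical t Q1 Q2 r : 0 < t -> t <= T -> antider (u t) Q1 -> antider Q1 Q2 ->
  (forall x, 0 <= x <= 1 -> `|Q2 x| <= M) -> 0 < r < 1 ->
  [/\ derive1 (u t) r = Q1 r, derive1n 2 (u t) r = derive1 Q1 r & `|derive1 Q1 r| <= M].
Proof.
move=> t0 tT h1 h2 hM r01.
have lQ := antider_lip_bound h2 hM.
have d1 x : 0 < x < 1 -> derive1 (u t) x = Q1 x.
  by move=> x01; have hd := antider_is_derive h1 lQ x01; rewrite derive1E derive_val.
have nr : {near r, derive1 (u t) =1 Q1}.
  have /andP[r0 r1] := r01.
  near=> s; apply: d1; apply/andP; split; near: s; [exact: lt_nbhsr|exact: lt_nbhsl].
have tin : t \in `]0, T] by rewrite in_itv/= t0.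
have rin : r \in `]0, 1[ by rewrite in_itv.
have [_ dd] := sol_dr sol tin rin.
have dQ : derivable Q1 r 1 := near_eq_derivable nr dd.
split; first exact: d1.
  by rewrite /derive1n/= derive1E (near_eq_derive _ nr) -derive1E.
have iQ : is_derive r 1 Q1 (derive1 Q1 r) by rewrite derive1E; exact: DeriveDef.
apply: (derivative_le_lip iQ); have /andP[r0 r1] := r01.
near=> s; apply: lQ; first by rewrite !ltW.
by apply/andP; split; apply: ltW; near: s; [exact: lt_nbhsr|exact: lt_nbhsl].
Unshelve. all: by end_near. Qed.

(** The singular terms are grouped so that each quotient is bounded: [r Q1 - u] vanishes to second
    order at the origin and [nonlin u] to third order. *)
Lemma sol_equation t Q1 Q2 r : 0 < t -> t <= T -> antider (u t) Q1 -> antider Q1 Q2 ->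
  (forall x, 0 <= x <= 1 -> `|Q2 x| <= M) -> 0 < r < 1 ->
  ut t r = derive1 Q1 r + (r * Q1 r - u t r) / r ^+ 2 + nonlin (u t r) / r ^+ 2.
Proof.
move=> t0 tT h1 h2 hM r01; have [e1 e2 _] := sol_classical t0 tT h1 h2 hM r01.
have rn0 : r != 0 by rewrite gt_eqF//; case/andP: r01.
have := sol_pde sol (_ : t \in `]0, T]) (_ : r \in `]0, 1[).
rewrite !in_itv/= t0 r01 => /(_ tT isT) ->.
by rewrite /= in e2; rewrite e1 e2 /nonlin; field.
Qed.

(** The equation turns space regularity into a pointwise bound of the time derivative. It provides
    the Lipschitz constant in time for the nonlinear term and a dominating function for
    differentiation under the integral. *)
Lemma ut_bound t r : 0 < t -> t <= T -> 0 < r < 1 -> `|ut t r| <= 2 * M + 2 * M ^+ 3.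
Proof.
move=> t0 tT r01; have tT' : 0 <= t <= T by rewrite ltW.
have [Q1 [Q2 [h1 h2 b1 b2]]] := sol_derivs tT'.
rewrite (sol_equation t0 tT h1 h2 b2 r01).
have [_ _ hd] := sol_classical t0 tT h1 h2 b2 r01.
have /andP[r0 r1] := r01; have r01' : 0 <= r <= 1 by rewrite !ltW.
have r2 : 0 < r ^+ 2 by rewrite exprn_gt0.
have p1 : `|(r * Q1 r - u t r) / r ^+ 2| <= M.
  rewrite normrM normfV (gtr0_norm r2) ler_pdivrMr//.
  have := antider_quad h1 (antider_lip_bound h2 b2) (x := r) (y := 0) r01'.
  rewrite lexx ler01 (sol_bdry tT').1 !sub0r sqrrN => /(_ isT).
  by rewrite (_ : - u t r - Q1 r * - r = r * Q1 r - u t r)//; ring.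
have p2 : `|nonlin (u t r) / r ^+ 2| <= 2 * M ^+ 3.
  rewrite normrM normfV (gtr0_norm r2) ler_pdivrMr//; apply: (le_trans (nonlin_cube _)).
  rewrite -mulrA; apply: ler_wpM2l => //; apply: (@le_trans _ _ ((M * r) ^+ 3)).
    by rewrite lerXn2r ?nnegrE ?mulr_ge0 ?(ltW r0)// sol_le.
  rewrite exprMn; apply: ler_wpM2l; first exact: exprn_ge0.
  by rewrite exprS ler_piMl// ltW.
apply: (le_trans (ler_normD _ _)).
by have := ler_normD (derive1 Q1 r) ((r * Q1 r - u t r) / r ^+ 2); lra.
Qed.

Let B := 2 * M + 2 * M ^+ 3.

Let B_ge0 : 0 <= B.
Proof. by have := exprn_ge0 3 M0; have := M0; rewrite /B; lra. Qed.

Lemma u_time_derive s r : 0 < s < T -> 0 <= r <= 1 -> is_derive s 1 (fun z => u z r) (ut s r).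
Proof.
move=> /andP[s0 sT] r01; apply: (has_deriv_within_is_derive s0 sT).
by apply: (sol_dt sol); [rewrite in_itv/= !ltW|rewrite unit_intervalE].
Qed.

Lemma u_time_within r : 0 <= r <= 1 -> {within `[0, T], continuous (fun z => u z r)}.
Proof.
move=> r01; apply/subspace_continuousP => s sT.
by apply: (@has_deriv_within_cont _ _ _ _ (ut s r)); apply: (sol_dt sol); rewrite ?unit_intervalE.
Qed.

Lemma sol_lip_time s t r : 0 <= s <= T -> 0 <= t <= T -> 0 <= r <= 1 ->
  `|u t r - u s r| <= B * `|t - s|.
Proof.
suff H a b : 0 <= a -> a < b -> b <= T -> 0 <= r <= 1 -> `|u b r - u a r| <= B * `|b - a|.
  move=> /andP[s0 sT] /andP[t0 tT] r01; have [st|ts|->] := ltgtP s t; first exact: H.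
    by rewrite distrC [`|t - s|]distrC; exact: H.
  by rewrite !subrr normr0 mulr0.
move=> a0 ab bT r01; have /andP[r0 r1] := r01.
have aT : 0 <= a <= T by rewrite a0 (le_trans (ltW ab)).
have bT' : 0 <= b <= T by rewrite bT (le_trans a0)// ltW.
have Bab : 0 <= B * `|b - a| by rewrite mulr_ge0// B_ge0.
have [->|rn0] := eqVneq r 0; first by rewrite !(sol_bdry _).1// subrr normr0.
have [->|rn1] := eqVneq r 1; first by rewrite !(sol_bdry _).2// subrr normr0.
have r01' : 0 < r < 1 by rewrite !lt_neqAle eq_sym rn0 r0 rn1.
have [c cab ->] : exists2 c, c \in `]a, b[ & u b r - u a r = ut c r * (b - a).
  apply: (MVT (f := fun z => u z r) (df := fun z => ut z r) ab).
    move=> z; rewrite in_itv/= => /andP[az zb]; apply: u_time_derive => //.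
    by rewrite (le_lt_trans a0 az) (lt_le_trans zb bT).
  apply: continuous_subspaceW (u_time_within r01) => z /=.
  by rewrite !in_itv/= => /andP[az zb]; rewrite (le_trans a0)//= (le_trans zb).
move: cab; rewrite in_itv/= => /andP[ac cb].
rewrite normrM; apply: ler_wpM2r => //; apply: ut_bound => //.
- exact: le_lt_trans ac.
- exact: le_trans (ltW cb) bT.
Qed.

Lemma ut_measurable t : 0 <= t <= T -> measurable_fun I (ut t).
Proof. by move=> tT; apply: sobolev_measurable; exact: (reg_ut reg (time_in tT)). Qed.

(** The bound on [ut] is known for 0 < r < 1; the factor [p r] vanishes at both ends and extends it
    to [0,1]. *)
Lemma ut_test_bound p K t r : lip0 p -> p 1 = 0 -> 0 <= K ->
  (forall x, 0 <= x <= 1 -> `|p x * x| <= K) ->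
  0 < t -> t <= T -> 0 <= r <= 1 -> `|ut t r * (p r * r)| <= B * K.
Proof.
move=> lp p1 K0 pK t0 tT r01; have /andP[r0 r1] := r01; have BK := mulr_ge0 B_ge0 K0.
have [->|rn0] := eqVneq r 0; first by rewrite !mulr0 normr0.
have [->|rn1] := eqVneq r 1; first by rewrite p1 !(mul0r, mulr0) normr0.
rewrite normrM; apply: ler_pM => //; last exact: pK.
by apply: ut_bound => //; rewrite !lt_neqAle eq_sym rn0 r0 rn1.
Qed.

Lemma ut_test_bmeas p t : lip0 p -> p 1 = 0 -> 0 < t -> t <= T ->
  bmeas (fun r => ut t r * (p r * r)).
Proof.
move=> lp p1 t0 tT; have bp := lip0_bmeas lp; have bI := @bmeas_id R.
have bq : bmeas (fun r => p r * r) by bm.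
have [K K0 pK] := bmeas_pos_bound bq; split.
  apply: measurable_funM; last by case: bq.
  by apply: ut_measurable; rewrite ltW.
by exists (B * K) => r r01; exact: ut_test_bound.
Qed.

(** Integrate the derivative of [Q1 v r], a function that vanishes at both ends; the pointwise
    equation is inserted almost everywhere. *)
Lemma sol_weak t v : 0 < t -> t <= T -> lip0 v -> v 1 = 0 ->
  ip0r (ut t) v + ipH1r (u t) v = ip0r (fun r => nonlin (u t r) / r ^+ 2) v.
Proof.
move=> t0 tT lv v1; have tT' : 0 <= t <= T by rewrite ltW.
have [Q1 [Q2 [h1 h2 b1 b2]]] := sol_derivs tT'.
have lu := sol_lip0 tT'; have [u00 _] := lu; have [v0 [g vg]] := lv.
have bI := @bmeas_id R; have bv := lip0_bmeas lv; have bg := vg.1; have bQ1 := h1.1; have bQ2 := h2.1.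
have w := antiderM (antiderM h2 vg) antider_id.
have := antiderE w (lexx 0) ler01 (lexx 1); rewrite v1 v0 !(mulr0, mul0r) subrr => e.
rewrite (ipH1rE h1 u00 vg v0) !ip0rE.
have bH := bmeas_H1r_density h1 u00 vg v0.
have bN := nonlin_div_bmeas lu.
have bw := w.1.
have bR : bmeas (fun r => nonlin (u t r) / r ^+ 2 * v r * r) by exact: bmeasM (bmeasM bN bv) bI.
have -> : integ 0 1 (fun r => ut t r * v r * r) =
  integ 0 1 (fun r => ((Q2 r * v r + Q1 r * g r) * r + Q1 r * v r * 1) - H1r_density (u t) Q1 v g r +
     nonlin (u t r) / r ^+ 2 * v r * r).
  apply: eq_integ_ae => //.
  - apply: measurable_funM; last exact: measurable_id.
    by apply: measurable_funM; [exact: ut_measurable|case: bv].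
  - by case: (bmeasD (bmeasB bw bH) bR).
  - apply: (ae_imp (ae_and (antider_is_derive_ae h2) (ae_and (ae_neq 0) (ae_neq 1)))) => r [hr [r0 r1]].
    rewrite unit_intervalE => /andP[r0' r1'].
    have r01 : 0 < r < 1 by rewrite !lt_neqAle eq_sym r0 r0' r1.
    rewrite (sol_equation t0 tT h1 h2 b2 r01) (hr r01) /H1r_density; field.
    by [].
rewrite integD ?lexx ?ler01//; last exact: bmeasB.
rewrite integB ?lexx ?ler01// e; ring.
Qed.

Lemma kappa_deriv p s : lip0 p -> p 1 = 0 -> 0 < s -> s <= T ->
  has_deriv_within `[0, T] (fun z => integ 0 1 (fun r => ut z r * (p r * r))) s
    (integ 0 1 (fun r => utt s r * (p r * r))).
Proof.
move=> lp p1 s0 sT; have sT' : 0 <= s <= T by rewrite ltW.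
have bp := lip0_bmeas lp; have bI := @bmeas_id R.
have bq : bmeas (fun r => p r * r) by bm.
have [mu2 L2] := reg_utt reg (time_in sT').
have muI : measurable (I : set R) by exact: measurable_itv.
have mutt : measurable_fun I (utt s).
  apply/(measurable_restrictT _ muI).
  by move: mu2; rewrite /memL inE => /andP[+ _]; rewrite inE.
apply/has_deriv_withinP => e e0.
set Z := Num.sqrt (integ 0 1 (fun r => (p r * r) ^+ 2)).
have Z0 : 0 <= Z by exact: sqrtr_ge0.
have Z1 : 0 < Z + 1 by lra.
have eZ : 0 < e / (Z + 1) by rewrite divr_gt0.
move/fine_cvgP: L2 => [finL /cvgrPdist_le /(_ _ eZ) cvL].
move: finL; rewrite near_withinE => /nbhs_ballP[del1 /= del10 H1].
move: cvL; rewrite near_withinE => /nbhs_ballP[del2 /= del20 H2].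
(* The bound [s] keeps [y] positive, where the equation bounds [ut y]. *)
exists (Num.min (Num.min del1 del2) s); first by rewrite !lt_min del10 del20.
move=> y yT ys; rewrite !lt_min => /andP[/andP[y11 y12] y2].
have y0 : 0 < y by move: y2; rewrite ltr_norml => /andP[y2 _]; lra.
have yT' : y <= T by move: yT; rewrite /= in_itv/= => /andP[].
have yT2 : 0 <= y <= T by rewrite ltW.
have finy := H1 y ltac:(by rewrite /ball/= distrC) ys yT.
have cvy := H2 y ltac:(by rewrite /ball/= distrC) ys yT.
rewrite sub0r normrN in cvy.
set f := (fun r => (ut y r - ut s r) / (y - s) - utt s r) in finy cvy.
have mf : measurable_fun I f.
  apply: measurable_funB => //; apply: measurable_funM => //.
  by apply: measurable_funB; exact: ut_measurable.
have nf : (normL 2 f <= (e / (Z + 1))%:E)%E.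
  rewrite -(fineK finy) lee_fin; apply: le_trans cvy; exact: ler_norm.
have [_ hb] := pair_L2 mf bq nf.
have [iutt _] := pair_L2 mutt bq (sol_bounds sT').2.
have by_ := ut_test_bmeas lp p1 y0 yT'; have bs := ut_test_bmeas lp p1 s0 sT.
have bD : bmeas (fun r => (y - s)^-1 * (ut y r * (p r * r) - ut s r * (p r * r))).
  by apply: bmeasZ; exact: bmeasB.
have <- : integ 0 1 (fun r => f r * (p r * r)) =
  (integ 0 1 (fun r => ut y r * (p r * r)) - integ 0 1 (fun r => ut s r * (p r * r))) / (y - s) -
  integ 0 1 (fun r => utt s r * (p r * r)).
  rewrite -integB ?lexx ?ler01// mulrC -integZ ?lexx ?ler01//; last exact: bmeasB.
  rewrite /integ -RintegralB//; last exact: bmeas_integrable.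
  by apply: eq_Rintegral => r _; rewrite /f; ring.
apply: (le_trans hb); rewrite -/Z mulrAC ler_pdivrMr//.
by apply: ler_wpM2l; [exact: ltW|lra].
Qed.

(** Differentiation under the integral sign, dominated by the constant [B K]. *)
Lemma ell_deriv p s : lip0 p -> p 1 = 0 -> 0 < s < T ->
  is_derive s 1 (fun z => integ 0 1 (fun r => u z r * (p r * r)))
    (integ 0 1 (fun r => ut s r * (p r * r))).
Proof.
move=> lp p1 sT.
have bp := lip0_bmeas lp; have bI := @bmeas_id R.
have bq : bmeas (fun r => p r * r) by bm.
have [K K0 pK] := bmeas_pos_bound bq.
have muI : measurable (I : set R) by exact: measurable_itv.
pose f x y := u x y * (p y * y).
have df x y : 0 < x < T -> 0 <= y <= 1 -> is_derive x 1 (f ^~ y) (ut x y * (p y * y)).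
  move=> xT y01; have h := u_time_derive xT y01.
  have := @is_deriveM _ _ (fun z => u z y) (fun=> p y * y) x 1 _ _ h (is_derive_cst _ _ _).
  move=> h'; have : is_derive x 1 (f ^~ y) (u x y *: 0 + (p y * y) *: ut x y) := h'.
  by rewrite scaler0 add0r /GRing.scale/= mulrC.
have d1 x y : 0 < x < T -> 0 <= y <= 1 -> partial1of2 f x y = ut x y * (p y * y).
  by move=> xT y01; have h := df x y xT y01; rewrite partial1of2E derive_val.
have := @cvg_differentiation_under_integral R _ _ mu f I muI s 0 T _ _ _ (fun=> B * K) _ _ _.
have h1 : `]0, T[%classic s by rewrite /= in_itv.
have h2 x : `]0, T[%classic x -> mu.-integrable I (EFin \o f x).
  rewrite /= in_itv/= => /andP[x0 xT]; apply: bmeas_integrable => //.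
  by apply: bmeasM bq; apply: lip0_bmeas; apply: sol_lip0; rewrite !ltW.
have h3 x y : `]0, T[%classic x -> I y -> derivable (f ^~ y) x 1.
  by rewrite /= in_itv/= unit_intervalE => xT y01; have [] := df x y xT y01.
have h4 (y : R) : 0 <= B * K by rewrite mulr_ge0// B_ge0.
have h5 : mu.-integrable I (EFin \o (fun=> B * K)).
  by apply: bmeas_integrable => //; exact: bmeas_cst.
have h6 x y : `]0, T[%classic x -> I y -> `|partial1of2 f x y| <= B * K.
  rewrite /= in_itv/= unit_intervalE => xT y01; rewrite d1//.
  by have /andP[x0 xT'] := xT; apply: ut_test_bound => //; exact: ltW.
move=> /(_ h1 h2 h3 h4 h5 h6) H.
have e : \int[mu]_(y in I) partial1of2 f s y = integ 0 1 (fun r => ut s r * (p r * r)).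
  by apply: eq_Rintegral => y; rewrite inE unit_intervalE => y01; exact: d1.
have {}H : h^-1 *: (integ 0 1 (f (h *: 1 + s)) - integ 0 1 (f s)) @[h --> 0^'] -->
    integ 0 1 (fun r => ut s r * (p r * r)).
  rewrite -e; apply: cvg_trans H; apply: near_eq_cvg; near=> h.
  by rewrite [h *: 1]mulr1.
by apply: DeriveDef; [apply/cvg_ex; exists (integ 0 1 (fun r => ut s r * (p r * r)))|exact: cvg_lim].
Unshelve. all: by end_near. Qed.

(* The mean value theorem twice: for [int u(t) p r dr], then for [int ut(t) p r dr]. *)
Lemma sol_consistency s t p : 0 <= s -> s < t -> t <= T -> lip0 p -> p 1 = 0 ->
  `|ip0r (ut t) p - ip0r (fun r => (u t r - u s r) / (t - s)) p| <=
  M * (t - s) * Num.sqrt (ip0r p p).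
Proof.
move=> s0 st tT lp p1.
have bp := lip0_bmeas lp; have bI := @bmeas_id R.
have bq : bmeas (fun r => p r * r) by bm.
have t0 : 0 < t by exact: le_lt_trans st.
have sT : s <= T by exact: le_trans (ltW st) tT.
have ts : 0 < t - s by rewrite subr_gt0.
pose kap z := integ 0 1 (fun r => ut z r * (p r * r)).
pose ell z := integ 0 1 (fun r => u z r * (p r * r)).
have bu z : 0 <= z <= T -> bmeas (fun r => u z r * (p r * r)).
  by move=> zT; apply: bmeasM bq; apply: lip0_bmeas; exact: sol_lip0.
have [K K0 pK] := bmeas_pos_bound bq.
have [z zst ez] : exists2 z, z \in `]s, t[ & ell t - ell s = kap z * (t - s).
  apply: (MVT st).
    move=> z; rewrite in_itv/= => /andP[sz zt]; apply: ell_deriv => //.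
    by rewrite (le_lt_trans s0 sz) (lt_le_trans zt tT).
  apply: (@lip_within _ _ _ (B * K)); first by rewrite mulr_ge0// B_ge0.
  move=> x y; rewrite /= !in_itv/= => /andP[sx xt] /andP[sy yt].
  have xT : 0 <= x <= T by rewrite (le_trans s0 sx) (le_trans xt tT).
  have yT : 0 <= y <= T by rewrite (le_trans s0 sy) (le_trans yt tT).
  rewrite /ell -integB ?lexx ?ler01//; try exact: bu.
  rewrite -[leRHS]mulr1 -[X in _ * X](subr0 1).
  apply: integ_norm; rewrite ?lexx ?ler01//; first by apply: bmeasB; exact: bu.
  move=> r r01; rewrite -mulrBl normrM mulrAC; apply: ler_pM => //; last exact: pK.
  exact: sol_lip_time.
move: zst; rewrite in_itv/= => /andP[sz zt].
have z0 : 0 < z by exact: le_lt_trans sz.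
have [y yzt ey] : exists2 y, y \in `]z, t[ & kap t - kap z =
    integ 0 1 (fun r => utt y r * (p r * r)) * (t - z).
  apply: (MVT zt (df := fun y => integ 0 1 (fun r => utt y r * (p r * r)))).
    move=> x; rewrite in_itv/= => /andP[zx xt].
    have x0 : 0 < x by exact: lt_trans zx.
    have xT : x < T by exact: lt_le_trans tT.
    by apply: (has_deriv_within_is_derive x0 xT); apply: kappa_deriv => //; exact: ltW.
  apply/subspace_continuousP => x; rewrite /= in_itv/= => /andP[zx xt].
  have x0 : 0 < x by exact: lt_le_trans zx.
  have := has_deriv_within_cont (kappa_deriv lp p1 x0 (le_trans xt tT)).
  apply: cvg_trans; apply: cvg_app; apply: within_subset.
  by move=> v /=; rewrite !in_itv/= => /andP[zv vt]; rewrite (le_trans (ltW z0) zv) (le_trans vt tT).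
move: yzt; rewrite in_itv/= => /andP[zy yt].
have yT : 0 <= y <= T by rewrite ltW ?(lt_trans z0)//= (le_trans (ltW yt)).
have -> : ip0r (ut t) p = kap t by rewrite ip0rE; apply: eq_integ => r _; rewrite mulrA.
have -> : ip0r (fun r => (u t r - u s r) / (t - s)) p = kap z.
  apply: (@mulIf _ (t - s)); first by rewrite gt_eqF.
  rewrite -ez ip0rE mulrC -integZ ?lexx ?ler01//.
    rewrite /ell -integB ?lexx ?ler01//; try (by apply: bu; rewrite ?s0 ?(ltW t0)).
    by apply: eq_integ => r _; field; rewrite gt_eqF.
  apply: bmeasM => //; apply: bmeasM => //; apply: bmeasM; last exact: bmeas_cst.
  by apply: bmeasB; apply: lip0_bmeas; apply: sol_lip0; rewrite ?s0 ?(ltW t0).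
have muI : measurable (I : set R) by exact: measurable_itv.
have [mu2 _] := reg_utt reg (time_in yT).
have mutt : measurable_fun I (utt y).
  apply/(measurable_restrictT _ muI).
  by move: mu2; rewrite /memL inE => /andP[+ _]; rewrite inE.
have [_ hb] := pair_L2 mutt bq (sol_bounds yT).2.
have hq : Num.sqrt (integ 0 1 (fun r => (p r * r) ^+ 2)) <= Num.sqrt (ip0r p p).
  apply: ler_wsqrtr; rewrite ip0rE; apply: integ_le; rewrite ?lexx ?ler01//; [by bm|by bm|].
  move=> r /andP[r0 r1]; rewrite exprMn expr2; apply: ler_wpM2l; first by rewrite -expr2 sqr_ge0.
  by rewrite expr2 ler_piMl.
rewrite ey normrM mulrAC; apply: ler_pM => //.
  by apply: (le_trans hb); apply: ler_wpM2l.
by rewrite ger0_norm ?subr_ge0 ?(ltW zt)// lerD2l lerN2 ltW.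
Qed.

End PDESolution.

(** * The error estimate *)

Section ErrorEstimate.
Context {R : realType}.
Implicit Types (f g v w z e : R -> R) (r tau A C D K L M T : R) (k N J j : nat).
Local Notation mu := (@lebesgue_measure R).
Local Notation I := (@unit_interval R).
Local Notation V := (R -> R^o).

Lemma sqnorm0r_ae f g : measurable_fun I f -> bmeas g ->
  {ae mu, forall x, I x -> f x = g x} ->
  sqnorm0r f = (integ 0 1 (fun r => g r ^+ 2 * r))%:E.
Proof.
move=> mf bg fg; have bI := @bmeas_id R.
have bG : bmeas (fun r => g r ^+ 2 * r) by bm.
have muI : measurable (I : set R) by exact: measurable_itv.
have iG : mu.-integrable I (EFin \o (fun r => g r ^+ 2 * r)) by exact: bmeas_integrable.
rewrite /integ /Rintegral fineK; last by apply: (@integrable_fin_num _ _ _ mu).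
apply: ae_eq_integral => //.
- by apply/measurable_EFinP; apply: measurable_funM => //; exact: measurable_funX.
- by apply/measurable_EFinP; case: bG.
- by apply: (ae_imp fg) => x fgx xI; rewrite fgx.
Qed.

Lemma norm0r_wD v : lip0 v -> norm0r (wD 1 v) = (Num.sqrt (ip0r (wD 1 v) (wD 1 v)))%:E.
Proof.
move=> [v0 [g vg]]; have [mv av] := antider_wD vg.
by rewrite /norm0r (sqnorm0r_ae mv vg.1 av) (ip0r_wD vg vg).
Qed.

Lemma normH1rE v : lip0 v -> normH1r v = (Num.sqrt (ipH1r v v))%:E.
Proof.
move=> lv; have [v0 [g vg]] := lv; have [mv av] := antider_wD vg.
have bq := lip0_div_bmeas lv; have bI := @bmeas_id R; have bg := vg.1.
rewrite /normH1r (sqnorm0r_ae mv bg av) (sqnorm0r_ae _ bq (ae_imp (ae_neq 0) (fun x _ _ => erefl))).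
  rewrite -EFinD /=; congr (Num.sqrt _)%:E.
  by rewrite (ipH1rE vg v0 vg v0) -integD ?lexx ?ler01//; bm.
by case: bq.
Qed.

Lemma eq_lip0 v w : lip0 v -> (forall x, 0 <= x <= 1 -> v x = w x) ->
  lip0 w /\ ipH1r w w = ipH1r v v.
Proof.
move=> [v0 [g vg]] vw.
have wg : antider w g by exact: (eq_antider vg).
have w0 : w 0 = 0 by rewrite -vw ?lexx ?ler01.
split; first by split => //; exists g.
rewrite (ipH1rE wg w0 wg w0) (ipH1rE vg v0 vg v0); apply: eq_integ => r r01.
by rewrite /H1r_density vw.
Qed.

Lemma ip0r_wD_le z e : lip0 z -> lip0 e ->
  ip0r (wD 1 (fun r => z r + e r)) (wD 1 (fun r => z r + e r)) <= 4 * En z + 2 * ipH1r e e.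
Proof.
move=> lz le; have [z0 [g zg]] := lz; have [e0 [f ef]] := le; have bI := @bmeas_id R.
have bg := zg.1; have bf := ef.1; have ze := antiderD zg ef.
have bs := sin_div_bmeas lz; have bE := bmeas_H1r_density ef e0 ef e0.
rewrite (ip0r_wD ze ze) (_ : 4 * En z = 2 * (2 * En z)); last by ring.
rewrite (EnE zg z0) (ipH1rE ef e0 ef e0).
have bZ : bmeas (fun r => g r ^+ 2 * r + (sin (z r) / r) ^+ 2 * r) by bm.
rewrite -!integZ ?lexx ?ler01// -integD ?lexx ?ler01//; [|exact: bmeasZ|exact: bmeasZ].
apply: integ_le; rewrite ?lexx ?ler01//; [by bm|by apply: bmeasD; exact: bmeasZ|].
move=> r /andP[r0 r1]; rewrite H1r_density_diag//.
have p1 : 0 <= (g r - f r) ^+ 2 * r by rewrite mulr_ge0// sqr_ge0.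
have p2 : 0 <= (sin (z r) / r) ^+ 2 * r by rewrite mulr_ge0// sqr_ge0.
have p3 : 0 <= e r ^+ 2 / r by rewrite divr_ge0// sqr_ge0.
lra.
Qed.

Lemma ip0r_div f v tau : bmeas f -> bmeas v -> ip0r (fun r => f r / tau) v = ip0r f v / tau.
Proof.
move=> bf bv; rewrite mulrC -(psdZl subsp_bmeas psd_ip0r tau^-1 bf bv).
by congr ip0r; apply/funext => r; rewrite mulrC.
Qed.

(** Pythagoras: [|u - U|^2 = |u - w|^2 + |U - w|^2] for the Ritz projection [w]. Hence the remainder
    starts with the initial error alone, without a power of h. *)
Lemma fe_initial_error k N U w u : (0 < N)%N -> fe_space k N U -> fe_space k N w -> lip0 u ->
  (forall v, fe_space k N v -> ipH1r w v = ipH1r u v) ->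
  ipH1r (fun r => U r - w r) (fun r => U r - w r) <= ipH1r (fun r => u r - U r) (fun r => u r - U r).
Proof.
move=> N0 fU fw lu hw; have lU := fe_lip0 N0 fU; have lw := fe_lip0 N0 fw.
have fz : fe_space k N ((U : V) - w) by exact: (subspB (@subsp_fe R k N) fU fw).
have e1 := psd_sqrB subsp_lip0 psd_ipH1r lU lw.
have e2 := psd_sqrB subsp_lip0 psd_ipH1r lu lU.
have e3 := psd_sqrB subsp_lip0 psd_ipH1r lu lw.
have p := psd_ge0 psd_ipH1r (subspB subsp_lip0 lu lw); rewrite e3 in p.
rewrite -[leLHS]/(ipH1r ((U : V) - w) ((U : V) - w)) e1.
rewrite -[leRHS]/(ipH1r ((u : V) - U) ((u : V) - U)) e2.
have h1 := hw _ fw; have h2 := hw _ fU.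
have h3 := psd_sym psd_ipH1r lU lw.
lra.
Qed.

(** Here [z = uh - w] and [e = w - u], with [w] the discrete parabolic projection. The two bounds
    stay separate because [z] is known in the energy and [e] in the H^1_r norm; [D] precedes both
    the solution and the discretization. *)
Lemma error_decomposition T k M : 0 < T -> (1 <= k)%N -> 0 <= M -> exists2 D, 0 <= D &
  forall u0 u ut utt, pde_solution T u0 u ut -> regularity_bound T k M u ut utt ->
  forall N J uh, (0 < N)%N -> (0 < J)%N -> discrete_solution k N J (T / J%:R) uh ->
  forall j, (j <= J)%N -> exists z e, [/\ lip0 z, lip0 e,
    (fun r => uh j r - u (j%:R * (T / J%:R)) r) = (fun r => z r + e r),
    En z <= D * (ipH1r (fun r => u 0 r - uh 0%N r) (fun r => u 0 r - uh 0%N r) +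
       (T / J%:R) ^+ 2 + (N%:R^-1 ^+ k) ^+ 2) &
    ipH1r e e <= D * (N%:R^-1 ^+ k) ^+ 2].
Proof.
move=> T0 k1 M0; have [Cp Cp0 proj] := @parabolic_projection R k k1.
have CM : 0 <= Cp * M by rewrite mulr_ge0// ltW.
pose B := 2 * M + 2 * M ^+ 3.
have B0 : 0 <= B by have := exprn_ge0 3 M0; rewrite /B; lra.
pose K := M + Cp * M; pose L := B + M.
have K0 : 0 <= K by rewrite /K addr_ge0.
have L0 : 0 <= L by rewrite /L addr_ge0.
have [C1 C10 step] := energy_step K0 L0.
pose X := expR (C1 * T); have X0 : 0 <= X := expR_ge0 _.
pose D := X * (1 + (Cp * M) ^+ 2) + (Cp * M) ^+ 2.
have CM2 := sqr_ge0 (Cp * M).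
have XC := mulr_ge0 X0 CM2.
have D0 : 0 <= D by rewrite /D; lra.
exists D => // u0 u ut utt sol reg N J uh N0 J0 [fuh0 dstep].
set tau := T / J%:R.
have JR : 0 < J%:R :> R by rewrite ltr0n.
have t0 : 0 < tau by rewrite divr_gt0.
have Jt : J%:R * tau = T by rewrite /tau mulrC divfK// gt_eqF.
have fuh j : (j <= J)%N -> fe_space k N (uh j).
  by case: j => // j jJ; have [] := dstep j jJ.
have tin j : (j <= J)%N -> 0 <= j%:R * tau <= T.
  by move=> jJ; rewrite mulr_ge0 ?(ltW t0)//= -Jt ler_pM2r// ler_nat.
(* Freezing the time at T beyond step J makes the sequence satisfy the hypotheses of
   [parabolic_projection] for every j. *)
pose uu j := u ((minn j J)%:R * tau).
have uuE j : (j <= J)%N -> uu j = u (j%:R * tau) by move=> jJ; rewrite /uu (minn_idPl jJ).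
have [|w [fw w0 wstep wH1 wpt]] := proj M N tau uu N0 t0 M0.
  move=> j; have tT : 0 <= (minn j J)%:R * tau <= T by apply: tin; exact: geq_minr.
  split; last exact: sol_bdry sol _ tT.
  exact: sol_chain M0 sol reg _ tT.
have luu j : lip0 (uu j) by apply: (sol_lip0 k1 M0 sol reg); apply: tin; exact: geq_minr.
have lw j := fe_lip0 N0 (fw j).
pose z j r := uh j r - w j r; pose e j r := w j r - uu j r.
have le j : lip0 (e j) by exact: (subspB subsp_lip0 (lw j) (luu j)).
have fz j : (j <= J)%N -> fe_space k N (z j).
  by move=> jJ; exact: (subspB (@subsp_fe R k N) (fuh j jJ) (fw j)).
have lz j (jJ : (j <= J)%N) := fe_lip0 N0 (fz j jJ).
set h := N%:R^-1 ^+ k in wH1 *.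
pose eta := tau ^+ 2 + (Cp * M) ^+ 2 * h ^+ 2.
have eta0 : 0 <= eta by rewrite addr_ge0 ?sqr_ge0// mulr_ge0 ?sqr_ge0.
have Estep j : (j < J)%N -> En (z j.+1) <= (1 + C1 * tau) * En (z j) + C1 * tau * eta.
  move=> jJ; have jJ' := ltnW jJ.
  have lz1 := lz j jJ'; have lz2 := lz j.+1 jJ.
  apply: (le_trans (step tau (z j) (z j.+1) (uu j) (uu j.+1) (e j) t0 lz1 lz2 (luu j) (luu j.+1) (le j) _ _)).
  - move=> r r01; have /andP[r0 r1] := r01.
    have Kr x : 0 <= x -> x <= K -> x * r <= K * r by move=> _ xK; exact: ler_wpM2r.
    split.
    + rewrite uuE//; apply: (le_trans (sol_le k1 M0 sol reg (tin j jJ') r01)); apply: ler_wpM2r => //.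
      by rewrite /K lerDl.
    + rewrite uuE//; apply: (le_trans (sol_le k1 M0 sol reg (tin j.+1 jJ) r01)); apply: ler_wpM2r => //.
      by rewrite /K lerDl.
    + rewrite !uuE//; apply: (le_trans (sol_lip_time k1 M0 sol reg (tin j jJ') (tin j.+1 jJ) r01)).
      rewrite -mulrBl -[j.+1%:R]natr1 addrAC subrr add0r mul1r gtr0_norm//.
      by apply: ler_wpM2r; [exact: ltW|rewrite /L lerDl].
    + by apply: (le_trans (wpt j r r01)); apply: ler_wpM2r => //; rewrite /K lerDr.
  - set d := (fun r => z j.+1 r - z j r).
    have fd : fe_space k N d by exact: (subspB (@subsp_fe R k N) (fz j.+1 jJ) (fz j jJ')).
    have ld := fe_lip0 N0 fd; have bd := lip0_bmeas ld; have [_ _ d1 _] := fd.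
    have luh1 := fe_lip0 N0 (fuh j.+1 jJ); have luh := fe_lip0 N0 (fuh j jJ').
    have buh := lip0_bmeas luh; have buh1 := lip0_bmeas luh1.
    have bw i := lip0_bmeas (lw i); have buu i := lip0_bmeas (luu i).
    (* [E1] is the scheme, [E2] the projection, [E3] the weak equation at t_(j+1) and [E4] the
       consistency error. Combining [E1] and [E3], both multiplied by tau, with [E2] leaves the
       equation for [z], perturbed by [E4]. *)
    have [_ /(_ d fd) E1] := dstep j jJ.
    have E2 := wstep j d fd.
    have tj1 : 0 < j.+1%:R * tau by rewrite mulr_gt0// ltr0n.
    have /andP[_ tjT] := tin j.+1 jJ; have /andP[tj0 _] := tin j jJ'.
    have E3 := sol_weak k1 M0 sol reg tj1 tjT ld d1.
    have tt : j.+1%:R * tau - j%:R * tau = tau by rewrite -[j.+1%:R]natr1; ring.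
    have tlt : j%:R * tau < j.+1%:R * tau by rewrite -subr_gt0 tt.
    have E4 := sol_consistency k1 M0 sol reg tj0 tlt tjT ld d1.
    rewrite tt -!uuE// in E4; rewrite -!uuE// in E3.
    have bdu : bmeas (fun r => uu j.+1 r - uu j r) by exact: bmeasB.
    have bduh : bmeas (fun r => uh j.+1 r - uh j r) by exact: bmeasB.
    rewrite (ip0r_div _ bdu bd) in E4; rewrite (ip0r_div _ bduh bd) in E1.
    have E6 : ip0r d d = ip0r (fun r => uh j.+1 r - uh j r) d - ip0r (fun r => w j.+1 r - w j r) d.
      rewrite -(ip0rBl bduh (bmeasB (bw j.+1) (bw j)) bd); congr ip0r.
      by apply/funext => r; rewrite /d /z; ring.
    have E7 : ipH1r (z j.+1) d = ipH1r (uh j.+1) d - ipH1r (w j.+1) d by exact: ipH1rBl.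
    have E8 : ip0r (fun r => (nonlin (z j r + uu j r + e j r) - nonlin (uu j.+1 r)) / r ^+ 2) d =
      ip0r (fun r => nonlin (uh j r) / r ^+ 2) d - ip0r (fun r => nonlin (uu j.+1 r) / r ^+ 2) d.
      rewrite -(ip0rBl (nonlin_div_bmeas luh) (nonlin_div_bmeas (luu j.+1)) bd); congr ip0r.
      apply/funext => r; rewrite -mulrBl (_ : z j r + uu j r + e j r = uh j r)//.
      by rewrite /z /e; ring.
    rewrite E7 E8; set S := Num.sqrt _ in E4 *; have S0 : 0 <= S := sqrtr_ge0 _.
    rewrite E6 -/tau.
    set a1 := ip0r (fun r => uh j.+1 r - uh j r) d in E1 *.
    set a2 := ip0r (fun r => w j.+1 r - w j r) d in E2 *.
    set a3 := ip0r (fun r => uu j.+1 r - uu j r) d in E2 E4.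
    have tn0 : tau != 0 by rewrite gt_eqF.
    have F1 : a1 + tau * ipH1r (uh j.+1) d = tau * ip0r (fun r => nonlin (uh j r) / r ^+ 2) d.
      by rewrite -E1 -/tau; field.
    have F3 := congr1 (fun x => tau * x) E3; rewrite /= mulrDr in F3.
    have F4 : tau * ip0r (ut (j.+1%:R * tau)) d - a3 <= tau * (M * tau * S).
      have := le_trans (ler_norm _) E4 => /(ler_wpM2l (ltW t0)).
      by rewrite (_ : tau * (_ - a3 / tau) = tau * ip0r (ut (j.+1%:R * tau)) d - a3)//; field.
    have F5 : tau * (M * tau * S) <= tau * (L * tau * S).
      apply: ler_wpM2l; first exact: ltW.
      by apply: ler_wpM2r => //; apply: ler_wpM2r; [exact: ltW|rewrite /L lerDr].
    lra.
  - rewrite lerD2l; apply: ler_wpM2l; first by rewrite mulr_ge0// ltW.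
    rewrite /eta lerD2l; apply: (le_trans (wH1 j)).
    by rewrite exprMn.
move=> j jJ; exists (z j), (e j); split => //.
- exact: lz.
- by apply/funext => r; rewrite -uuE// /z /e; ring.
(* The energy is replaced by 0 beyond J, where the scheme says nothing, so that nonnegativity holds
   for every index. *)
- pose E i := if (i <= J)%N then En (z i) else 0.
  have Ei0 i : 0 <= E i by rewrite /E; case: leqP => // iJ; apply: En_ge0; exact: lz.
  have := @discrete_gronwall R E C1 tau eta T J C10 (ltW t0) eta0 _ Ei0 _ j jJ.
  rewrite Jt lexx {3}/E jJ => /(_ isT) H.
  have {}H := H ltac:(by move=> i iJ; rewrite /E iJ (ltnW iJ); exact: Estep).
  apply: (le_trans H); rewrite {1}/E leq0n -/X.
  have i0 : 2 * En (z 0%N) <= ipH1r (fun r => u 0 r - uh 0%N r) (fun r => u 0 r - uh 0%N r).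
    apply: (le_trans (En_le_H1r (lz 0%N (leq0n _)))).
    have u00 : uu 0%N = u 0 by rewrite uuE// mul0r.
    rewrite -u00; apply: (fe_initial_error N0 (fuh 0%N (leq0n _)) (fw 0%N) (luu 0%N)).
    exact: w0.
  set A := ipH1r _ _ in i0 *.
  have A0 : 0 <= A.
    by have := En_ge0 (lz 0%N (leq0n _)); lra.
  have h1 := ler_wpM2l X0 i0.
  have t2 := sqr_ge0 tau; have h2 := sqr_ge0 h.
  have m1 := mulr_ge0 X0 A0; have m2 := mulr_ge0 X0 t2; have m3 := mulr_ge0 X0 h2.
  have m4 := mulr_ge0 XC A0; have m5 := mulr_ge0 XC t2; have m6 := mulr_ge0 XC h2.
  have m7 := mulr_ge0 CM2 A0; have m8 := mulr_ge0 CM2 t2; have m9 := mulr_ge0 CM2 h2.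
  rewrite /eta /D.
  lra.
- apply: (le_trans (wH1 j)); rewrite exprMn; apply: ler_wpM2r; first exact: sqr_ge0.
  by rewrite /D; lra.
Qed.

End ErrorEstimate.

(** Serves to replace [M] by |M|: the constants are built from a nonnegative bound, while [M] has no
    sign in the theorem. *)
Lemma regularity_bound_weaken (R : realType) (T : R) k (M M' : R) (u ut utt : R -> R -> R) :
  M <= M' -> regularity_bound T k M u ut utt -> regularity_bound T k M' u ut utt.
Proof.
move=> MM' [h1 h2 h3 h4]; split => // t tT.
by apply: (le_trans (h4 t tT)); rewrite lee_fin.
Qed.

Theorem theorem4p4 (R : realType) (T : R) (k : nat) (M : R)
    (T_gt0 : 0 < T) (k_ge1 : (1 <= k)%N) :
  exists C c : R, [/\ 0 < C, 0 < c &
    forall (u0 : R -> R) (u ut utt : R -> R -> R),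
      Cn_within unit_interval 2 u0 ->
      u0 0 = 0 -> u0 1 = 0 ->
      (forall r, unit_interval r -> `|u0 r| < pi) ->
      pde_solution T u0 u ut ->
      regularity_bound T k M u ut utt ->
      sobolev k.+1 2 u0 ->
      energy_set 1 u0 ->
      (forall (N J : nat) (uh : nat -> R -> R), (0 < N)%N -> (0 < J)%N ->
        let h := N%:R^-1 in
        let tau := T / J%:R in
        discrete_solution k N J tau uh ->
        energy_set 1 (uh 0%N) ->
        forall j : nat, (1 <= j <= J)%N ->
          (norm0r (wD 1 (fun r => uh j r - u (j%:R * tau) r)%R)
             <= (C * (tau + h ^+ k))%:E
                + c%:E * normH1r (fun r => u0 r - uh 0%N r)%R)%E)
      /\
      (forall c0 : R,
        exists C' h0 tau0 : R, [/\ 0 < C', 0 < h0, 0 < tau0 &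
          forall (N J : nat) (uh : nat -> R -> R), (0 < N)%N -> (0 < J)%N ->
            let h := N%:R^-1 in
            let tau := T / J%:R in
            discrete_solution k N J tau uh ->
            energy_set 1 (uh 0%N) ->
            (normH1r (fun r => u0 r - uh 0%N r)%R <= (c0 * h ^+ k)%:E)%E ->
            h <= h0 -> tau <= tau0 ->
            forall j : nat, (1 <= j <= J)%N ->
              (normH1r (fun r => uh j r - u (j%:R * tau) r)%R
                 <= (C' * (tau + h ^+ k))%:E)%E])].
Proof.
have [D D0 main] := error_decomposition T_gt0 k_ge1 (normr_ge0 M).
(* 6 = 4 + 2 comes from [ip0r_wD_le]; the summand 1 gives [C <= C^2], so that one constant serves
   for the squares and for the norms. *)
pose C := 6 * D + 1; have C1 : 1 <= C by rewrite /C; lra.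
exists C, C; split; [by lra|by lra|].
move=> u0 u ut utt _ _ _ _ sol /(regularity_bound_weaken (ler_norm M)) reg _ _.
have {}main := main u0 u ut utt sol reg.
have T00 : (0 : R) <= 0 <= T by rewrite lexx ltW.
have lu0 : lip0 (u 0) by exact: (sol_lip0 k_ge1 (normr_ge0 M) sol reg).
have initial N J tau uh : (0 < N)%N -> discrete_solution k N J tau uh ->
    normH1r (fun r => u0 r - uh 0%N r) =
    (Num.sqrt (ipH1r (fun r => u 0 r - uh 0%N r) (fun r => u 0 r - uh 0%N r)))%:E /\
    0 <= ipH1r (fun r => u 0 r - uh 0%N r) (fun r => u 0 r - uh 0%N r).
  move=> N0 [fuh _]; have ld : lip0 (fun r => u 0 r - uh 0%N r).
    exact: (subspB subsp_lip0 lu0 (fe_lip0 N0 fuh)).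
  have [|lw ew] := eq_lip0 (w := fun r => u0 r - uh 0%N r) ld.
    by move=> x x01; rewrite (sol_init sol)// unit_intervalE.
  by split; [rewrite normH1rE// ew|exact: (psd_ge0 psd_ipH1r)].
have grid N : (0 < N)%N -> 0 <= N%:R^-1 ^+ k :> R /\ N%:R^-1 ^+ k <= N%:R^-1 :> R.
  move=> N0; have NR : 0 <= N%:R^-1 :> R by rewrite invr_ge0.
  have N1 : N%:R^-1 <= 1 :> R by rewrite invf_le1 ?ltr0n// ler1n.
  split; first exact: exprn_ge0.
  by rewrite -(prednK k_ge1) exprS ler_piMr// exprn_ile1.
split.
  move=> N J uh N0 J0 h tau ds _ j /andP[_ jJ].
  have [z [e [lz le de Ez Ee]]] := main N J uh N0 J0 ds j jJ.
  have [-> A0] := initial N J _ uh N0 ds; set A := ipH1r _ _ in A0 Ez *.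
  have t0 : 0 <= tau by rewrite divr_ge0// ltW.
  have [hk0 _] := grid N N0; rewrite -/h in hk0 Ez Ee; rewrite -/tau in Ez de.
  have lze : lip0 (fun r => z r + e r) by exact: (subspD subsp_lip0 lz le).
  rewrite de (norm0r_wD lze) -EFinM -EFinD lee_fin.
  rewrite -mulrDr -[leRHS]ger0_norm; last first.
    by rewrite mulr_ge0 ?addr_ge0 ?sqrtr_ge0//; lra.
  rewrite -(sqrtr_sqr (C * _)) ler_wsqrtr//.
  apply: (le_trans (ip0r_wD_le lz le)); rewrite exprMn.
  set a := Num.sqrt A; have a0 : 0 <= a := sqrtr_ge0 _; have aA : a ^+ 2 = A by exact: sqr_sqrtr.
  have b1 : 4 * En z + 2 * ipH1r e e <= 6 * D * (A + tau ^+ 2 + (h ^+ k) ^+ 2).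
    have := mulr_ge0 D0 A0; have := mulr_ge0 D0 (sqr_ge0 tau); lra.
  have b2 : A + tau ^+ 2 + (h ^+ k) ^+ 2 <= (tau + h ^+ k + a) ^+ 2.
    rewrite -aA; have := mulr_ge0 t0 hk0; have := mulr_ge0 t0 a0; have := mulr_ge0 hk0 a0; lra.
  apply: (le_trans b1); apply: ler_pM => //; first by lra.
  - exact: addr_ge0 (addr_ge0 A0 (sqr_ge0 _)) (sqr_ge0 _).
  - have : C <= C ^+ 2 by rewrite expr2 ler_peMr//; lra.
    by rewrite /C; lra.
(* Chosen so that h and tau below [del] imply [En z <= G del^2 = del / 2 <= 1 / 2], the threshold of
   [H1r_le_En]. *)
move=> c0; pose G := (D + 1) * (c0 ^+ 2 + 2).
have c00 := sqr_ge0 c0; have Dc := mulr_ge0 D0 c00.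
have G1 : 2 <= G by rewrite /G; lra.
pose del := (2 * G)^-1.
have del0 : 0 < del by rewrite invr_gt0; lra.
have Gdel : G * del = 2^-1 by rewrite /del; field; lra.
have del1 : del <= 1 by rewrite invf_le1; lra.
(* 18 = 2 x 8 + 2: the triangle inequality for squares, the factor 8 of [H1r_le_En] for [z], and the
   bound on [e]. *)
pose C' := (18 * D + 1) * (c0 ^+ 2 + 1).
have C'1 : 1 <= C' by rewrite /C'; lra.
exists C', del, del; split => //; first by lra.
move=> N J uh N0 J0 h tau ds _ hc0 hdel tdel j /andP[_ jJ].
have [z [e [lz le de Ez Ee]]] := main N J uh N0 J0 ds j jJ.
have [iA A0] := initial N J _ uh N0 ds; rewrite iA lee_fin -/h in hc0.
set A := ipH1r _ _ in A0 Ez hc0.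
have t0 : 0 <= tau by rewrite divr_ge0// ltW.
have [hk0 hk1] := grid N N0; rewrite -/h in hk0 hk1 Ez Ee; rewrite -/tau in Ez de.
have lze : lip0 (fun r => z r + e r) by exact: (subspD subsp_lip0 lz le).
(* [c0] carries no sign; [c0 h^k >= 0] follows because it bounds a norm. *)
have Ac : A <= c0 ^+ 2 * (h ^+ k) ^+ 2.
  rewrite -(sqr_sqrtr A0) -exprMn lerXn2r ?nnegrE ?sqrtr_ge0//.
  exact: le_trans (sqrtr_ge0 _) hc0.
have hk2 := sqr_ge0 (h ^+ k); have t2 := sqr_ge0 tau.
have Ez' : En z <= D * ((c0 ^+ 2 + 1) * (h ^+ k) ^+ 2 + tau ^+ 2).
  by apply: (le_trans Ez); apply: ler_wpM2l => //; lra.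
have sq x : 0 <= x -> x <= del -> x ^+ 2 <= del ^+ 2.
  by move=> x0 xd; rewrite lerXn2r ?nnegrE// ltW.
have small : En z <= 2^-1.
  apply: (le_trans Ez').
  have q1 := sq _ hk0 (le_trans hk1 hdel); have q2 := sq _ t0 tdel.
  apply: (@le_trans _ _ (G * del ^+ 2)).
    have c1 : 0 <= c0 ^+ 2 + 1 by lra.
    have := ler_wpM2l D0 (ler_wpM2l c1 q1); have := ler_wpM2l D0 q2.
    have := mulr_ge0 (_ : 0 <= c0 ^+ 2 + 2) (sqr_ge0 del) => /(_ ltac:(lra)).
    rewrite /G; lra.
  by rewrite expr2 mulrA Gdel ler_piMr// invr_ge0.
rewrite de (normH1rE lze) lee_fin -[leRHS]ger0_norm; last first.
  by rewrite mulr_ge0 ?addr_ge0//; lra.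
rewrite -(sqrtr_sqr (C' * _)) ler_wsqrtr//.
apply: (le_trans (psd_sqrD_le subsp_lip0 psd_ipH1r lz le)); rewrite exprMn.
have zz := H1r_le_En lz small.
have b2 : (h ^+ k) ^+ 2 + tau ^+ 2 <= (tau + h ^+ k) ^+ 2.
  by have := mulr_ge0 t0 hk0; lra.
apply: (@le_trans _ _ (C' * ((h ^+ k) ^+ 2 + tau ^+ 2))).
  have Dt := mulr_ge0 D0 t2; have Dh := mulr_ge0 D0 hk2.
  have := mulr_ge0 Dc t2; have := mulr_ge0 Dc hk2.
  have := mulr_ge0 c00 t2; have := mulr_ge0 c00 hk2.
  rewrite /C'; lra.
apply: ler_pM => //; [lra|exact: addr_ge0|].
by rewrite expr2 ler_peMr//; lra.
Qed.
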